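(* Let $L$ be a finite-dimensional Lie algebra over a field $F$ of characteristic zero. Then $L$ is minimal non-elementary if and only if either (i) $L=L^2\rtimes Fx$ for some $x\in L$, where $L^2=[L,L]$ is abelian, $\phi(L)=\mathrm{Asoc}(L)\neq 0$, and $\mathrm{Asoc}(L)$ is the largest ideal of $L$ properly contained in $L^2$ (every ideal of $L$ properly contained in $L^2$ is contained in $\mathrm{Asoc}(L)$, and $\mathrm{Asoc}(L)\ne L^2$); or (ii) $L$ is the three-dimensional Heisenberg algebra.
   Context: The Frattini ideal $\phi(B)$ of a Lie algebra $B$ is the largest ideal of $B$ contained in every maximal subalgebra of $B$. $B$ is elementary if $\phi(C)=0$ for every subalgebra $C$ of $B$. $L$ is minimal non-elementary if $L$ is not elementary but every proper subalgebra of $L$ is elementary. $\mathrm{Asoc}(L)$ is the sum of all minimal abelian ideals of $L$. $\rtimes$ denotes a semidirect product (here $L^2$ is an ideal and $Fx$ a one-dimensional complementary subalgebra). The three-dimensional Heisenberg algebra has basis $x,y,z$ with $[x,y]=z$ and $[x,z]=[y,z]=0$. *)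

(* Defs.v *)
(* A finite-dimensional Lie algebra over a field F is modelled as
   a finite-dimensional vector space V : vectType F together with a bracket
   br : V -> V -> V satisfying the Lie axioms; the Lie algebra L is the whole
   space fullv.  Subalgebras, ideals etc. are subspaces {vspace V}. *)
From HB Require Import structures.
From mathcomp Require Import all_boot all_order all_algebra.
Set Implicit Arguments. Unset Strict Implicit. Unset Printing Implicit Defensive.
Import GRing.Theory.
Local Open Scope ring_scope.

Section Lie.
Variables (F : fieldType) (V : vectType F) (br : V -> V -> V).

Definition is_lie_bracket : Prop :=
  [/\ (forall (a : F) (u v w : V), br (a *: u + v) w = a *: br u w + br v w),
      (forall (a : F) (u v w : V), br w (a *: u + v) = a *: br w u + br w v),
      (forall u : V, br u u = 0) &
      (forall u v w : V, br u (br v w) + br v (br w u) + br w (br u v) = 0)].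

Definition vproper (A B : {vspace V}) : bool := (A <= B)%VS && (A != B).

Definition subalg (A : {vspace V}) : Prop :=
  forall a b, a \in A -> b \in A -> br a b \in A.

Definition ideal_of (C I : {vspace V}) : Prop :=
  (I <= C)%VS /\ forall c i, c \in C -> i \in I -> br c i \in I.

Definition abelian (A : {vspace V}) : Prop :=
  forall a b, a \in A -> b \in A -> br a b = 0.

Definition max_subalg_of (C M : {vspace V}) : Prop :=
  [/\ subalg M, vproper M C &
      forall N, subalg N -> (M <= N)%VS -> (N <= C)%VS -> N = M \/ N = C].

Definition in_all_max (C I : {vspace V}) : Prop :=
  forall M, max_subalg_of C M -> (I <= M)%VS.

Definition is_frattini (C P : {vspace V}) : Prop :=
  [/\ ideal_of C P, in_all_max C P &
      forall I, ideal_of C I -> in_all_max C I -> (I <= P)%VS].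

Definition elementary (C : {vspace V}) : Prop :=
  forall D, subalg D -> (D <= C)%VS -> forall P, is_frattini D P -> P = 0%VS.

Definition minimal_non_elementary : Prop :=
  ~ elementary fullv /\
  forall C, subalg C -> vproper C fullv -> elementary C.

Definition minimal_ideal (I : {vspace V}) : Prop :=
  [/\ ideal_of fullv I, I != 0%VS &
      forall J, ideal_of fullv J -> (J <= I)%VS -> J = 0%VS \/ J = I].

Definition minimal_abelian_ideal (I : {vspace V}) : Prop :=
  minimal_ideal I /\ abelian I.

(* A = Asoc(L): the sum (least upper bound in the subspace lattice) of all
   minimal abelian ideals of L. *)
Definition is_asoc (A : {vspace V}) : Prop :=
  (forall I, minimal_abelian_ideal I -> (I <= A)%VS) /\
  (forall B : {vspace V},
      (forall I, minimal_abelian_ideal I -> (I <= B)%VS) -> (A <= B)%VS).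

(* L^2 = [L, L], the span of all brackets (spanned by brackets of basis
   vectors, by bilinearity). *)
Definition derived : {vspace V} :=
  <<[seq br a b | a <- vbasis (fullv : {vspace V}), b <- vbasis (fullv : {vspace V})]>>%VS.

End Lie.

(* Main.v *)
(** In a minimal non-elementary algebra L every proper subalgebra is elementary, and some
    nonzero ideal P lies in all maximal subalgebras, so no ideal inside P has a proper
    supplement. An abelian ideal of an elementary algebra C is complemented in C; applied
    to E + Fx this makes ad x semisimple on abelian ideals E, hence, in characteristic 0,
    annihilated there by a separable polynomial.

    Suppose L is solvable. Then [L, L] is abelian. If L = [L, L] + Fx, the ideals inside
    [L, L] are the x-stable subspaces, the proper ones are semisimple for ad x, and (i)
    follows. If there is no such x, the commuting semisimple operators ad y on [L, L]
    have equivariant complements, which forces them to vanish: L is nilpotent of class 2,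
    and two elements that do not commute generate a Heisenberg algebra.

    Suppose L is not solvable, with radical R. Then P lies in R, L = R + C for a Levi
    complement C, and an abelian ideal A of L inside P has a complement in R. By Weyl's
    theorem for C the complement can be chosen stable under C, and together with C it is a
    proper supplement of A, a contradiction. *)
Require Import Defs.
From HB Require Import structures.
From mathcomp Require Import all_boot all_order all_algebra.
From mathcomp Require Import all_field zify ring.
From Stdlib Require Import Classical.
Set Implicit Arguments. Unset Strict Implicit. Unset Printing Implicit Defensive.
Import GRing.Theory Num.Theory VectorInternalTheory.
Local Open Scope ring_scope.

(** * Lie brackets, subalgebras and Frattini ideals *)

(** [F] need not be algebraically closed, so eigenvectors are replaced by a separable polynomial p
    with p(T) = 0 on [E]. Then p'(T) is invertible on [E], which serves twice: a commutator [T, S]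
    that commutes with T vanishes, because [p(T), S] = p'(T) [T, S]; and the inverse of p'(T)
    corrects a projection to one that commutes with T. The first fact leads to the abelian derived
    algebra, the second to equivariant complements. Semisimplicity of [ad x] on [E] requires E + Fx
    to be a proper subalgebra. Each use must therefore exclude E + Fx = L, and this is where
    alternative (i) separates from the rest. In the nonsolvable case the complement of [A] in the
    radical must be stable under the Levi complement and also a subalgebra. The second condition is
    made linear: the projection onto [A] is required to be a cocycle on the radical, and Weyl's
    theorem is applied to a space of such maps. Scalars are extended only inside Cartan's criterion,
    on which Weyl's theorem rests. *)

Lemma linfun_apply (F : fieldType) (U V : vectType F) (f : U -> V) :
  (forall a u v, f (a *: u + v) = a *: f u + f v) ->
  forall u, linfun f u = f u.
Proof.
move=> fP u; pose fL := GRing.isLinear.Build F U V *:%R f fP.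
pose g : {linear U -> V} := HB.pack f fL.
exact: (lfunE g u).
Qed.

Lemma nat_min (T : Type) (f : T -> nat) (Q : T -> Prop) t0 :
  Q t0 -> exists2 t, Q t & forall s, Q s -> (f t <= f s)%N.
Proof.
have [n] := ubnP (f t0); elim: n t0 => // n IH t le_n Qt.
case: (classic (forall s, Q s -> (f t <= f s)%N)) => [minU|]; first by exists t.
move=> /(not_all_ex_not _ _) [W HW]; have [QW /negP] := imply_to_and _ _ HW.
by rewrite -ltnNge => ltWU; apply: (IH W) => //; apply: leq_trans ltWU _.
Qed.

Lemma dim_min (F : fieldType) (V : vectType F) (Q : {vspace V} -> Prop) U0 :
  Q U0 -> exists2 U, Q U & forall W, Q W -> (\dim U <= \dim W)%N.
Proof. exact: (@nat_min _ (fun U : {vspace V} => \dim U)). Qed.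

Lemma dim_max (F : fieldType) (V : vectType F) (Q : {vspace V} -> Prop) U0 :
  Q U0 -> exists2 U, Q U & forall W, Q W -> (\dim W <= \dim U)%N.
Proof.
case/(@nat_min _ (fun U : {vspace V} => \dim {:V} - \dim U)%N) => U QU minU.
by exists U => // W /minU; rewrite leq_sub2lE // dimvS ?subvf.
Qed.

(** A subspace of maximal dimension inside [Q] exhausts [Q], as adjoining one more vector of [Q]
    stays inside [Q]. This turns centralisers, null components and spaces of cocycles, given by
    propositions, into subspaces. *)
Lemma vspace_of_pred (F : fieldType) (V : vectType F) (Q : V -> Prop) :
  Q 0 -> (forall a u v, Q u -> Q v -> Q (a *: u + v)) ->
  exists U : {vspace V}, forall v, (v \in U) <-> Q v.
Proof.
move=> Q0 QL.
have [|U QU maxU] := @dim_max F V (fun U => forall v, v \in U -> Q v) 0%VS.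
  by move=> v; rewrite memv0 => /eqP->.
exists U => v; split=> [/QU //|Qv].
have QUv w : w \in (<[v]> + U)%VS -> Q w.
  by case/memv_addP=> _ /vlineP[k ->] [u /QU Qu ->]; apply: QL.
have := maxU _ QUv; have sU : (U <= <[v]> + U)%VS by apply: addvSr.
move=> le_d; have /eqP -> : U == (<[v]> + U)%VS by rewrite eqEdim sU.
by rewrite (subvP (addvSl _ _)) ?memv_line.
Qed.

Section Bracket.
Variables (F : fieldType) (V : vectType F) (br : V -> V -> V).
Hypothesis Hlie : is_lie_bracket br.
Implicit Types (u v w x y z : V) (A B C D I J M U : {vspace V}).

Lemma brDl u v w : br (u + v) w = br u w + br v w.
Proof. by case: Hlie => H _ _ _; rewrite -[u]scale1r H !scale1r. Qed.
Lemma brDr u v w : br w (u + v) = br w u + br w v.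
Proof. by case: Hlie => _ H _ _; rewrite -[u]scale1r H !scale1r. Qed.
Lemma br0l w : br 0 w = 0.
Proof. by apply: (addrI (br 0 w)); rewrite -brDl !addr0. Qed.
Lemma br0r w : br w 0 = 0.
Proof. by apply: (addrI (br w 0)); rewrite -brDr !addr0. Qed.
Lemma brZl a u w : br (a *: u) w = a *: br u w.
Proof. by case: Hlie => H _ _ _; rewrite -[a *: u]addr0 H br0l addr0. Qed.
Lemma brZr a u w : br w (a *: u) = a *: br w u.
Proof. by case: Hlie => _ H _ _; rewrite -[a *: u]addr0 H br0r addr0. Qed.
Lemma brNl u w : br (- u) w = - br u w.
Proof. by rewrite -scaleN1r brZl scaleN1r. Qed.
Lemma brNr u w : br w (- u) = - br w u.
Proof. by rewrite -scaleN1r brZr scaleN1r. Qed.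
Lemma brBr u v w : br w (u - v) = br w u - br w v.
Proof. by rewrite brDr brNr. Qed.
Lemma brxx u : br u u = 0.
Proof. by case: Hlie. Qed.
Lemma brC u v : br u v = - br v u.
Proof.
apply/eqP; rewrite -addr_eq0; apply/eqP.
by have := brxx (u + v); rewrite brDl !brDr !brxx addr0 add0r.
Qed.
Lemma brJ x y z : br x (br y z) = br (br x y) z + br y (br x z).
Proof.
case: Hlie => _ _ _ /(_ x y z) /eqP.
rewrite (brC z (br x y)) (brC z x) brNr -addrA -opprD addr_eq0 opprK addrC => /eqP ->.
by [].
Qed.
Lemma brJl x y z : br (br x y) z = br x (br y z) - br y (br x z).
Proof. by rewrite brJ addrK. Qed.

Lemma br_linr x a u v : br x (a *: u + v) = a *: br x u + br x v.
Proof. by rewrite brDr brZr. Qed.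

Definition ad x : 'End(V) := linfun (br x).
Lemma adE x y : ad x y = br x y.
Proof. by rewrite /ad linfun_apply //; apply: br_linr. Qed.

Definition brs A B : {vspace V} :=
  <<[seq br a b | a <- vbasis A, b <- vbasis B]>>%VS.

Lemma mem_brs A B a b : a \in A -> b \in B -> br a b \in brs A B.
Proof.
move=> aA bB; rewrite (coord_vbasis aA) (coord_vbasis bB).
elim/big_rec: _ => [|i u _ IH]; first by rewrite br0l mem0v.
rewrite brDl memvD // brZl memvZ //.
elim/big_rec: _ => [|j w _ IHw]; first by rewrite br0r mem0v.
rewrite brDr memvD // brZr memvZ // memv_span //.
by apply: allpairs_f; apply: mem_nth; rewrite size_tuple.
Qed.

Lemma brs_subP A B U :
  (forall a b, a \in A -> b \in B -> br a b \in U) <-> (brs A B <= U)%VS.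
Proof.
split=> [H|/subvP sU a b aA bB]; last by apply/sU/mem_brs.
apply/span_subvP=> _ /allpairsP[[a b] /= [aA bB ->]].
by apply: H; apply: vbasis_mem.
Qed.

Lemma brsS A A' B B' : (A <= A')%VS -> (B <= B')%VS -> (brs A B <= brs A' B')%VS.
Proof.
move=> /subvP sA /subvP sB; apply/brs_subP => a b /sA aA /sB bB; exact: mem_brs.
Qed.

Lemma mem_derived x y : br x y \in derived br.
Proof. exact: (@mem_brs fullv fullv x y (memvf _) (memvf _)). Qed.

Lemma idealP I : ideal_of br fullv I <-> forall x i, i \in I -> br x i \in I.
Proof.
by split=> [[_ H] x i iI|H]; [apply: H (memvf x) iI | split=> [|c i _]; [apply: subvf | apply: H]].
Qed.

Lemma ideal_subalg C I : ideal_of br C I -> subalg br I.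
Proof. by case=> /subvP sI H a b /sI aC; apply: H. Qed.

Lemma ideal_r C I : ideal_of br C I -> forall c i, c \in C -> i \in I -> br i c \in I.
Proof. by case=> _ H c i cC iI; rewrite brC memvN H. Qed.

Lemma ideal_cap C I D : ideal_of br C I -> subalg br D -> (D <= C)%VS ->
  ideal_of br D (I :&: D).
Proof.
case=> sIC H Ds /subvP sDC; split=> [|c i cD]; first exact: capvSr.
by rewrite !memv_cap => /andP[iI iD]; rewrite H ?Ds ?sDC.
Qed.

Lemma ideal_capI C I J : ideal_of br C I -> ideal_of br C J -> ideal_of br C (I :&: J).
Proof.
move=> [sI HI] [sJ HJ]; split=> [|c i cC]; first by apply: subv_trans (capvSl _ _) sI.
by rewrite !memv_cap => /andP[iI iJ]; rewrite HI ?HJ.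
Qed.

Lemma ideal_add C I J : ideal_of br C I -> ideal_of br C J -> ideal_of br C (I + J).
Proof.
move=> [sI HI] [sJ HJ]; split=> [|c ij cC]; first by rewrite subv_add sI.
by case/memv_addP=> i iI [j jJ ->]; rewrite brDr memv_add ?HI ?HJ.
Qed.

Lemma ideal_sub C D I : ideal_of br C I -> (I <= D)%VS -> (D <= C)%VS -> ideal_of br D I.
Proof. by case=> _ H sI /subvP sD; split=> // c i /sD; apply: H. Qed.

Lemma ideal_brs C I J : ideal_of br C I -> ideal_of br C J -> ideal_of br C (brs I J).
Proof.
move=> hI hJ; split.
  apply/brs_subP => a b aI bJ; case: hJ => /subvP sJ HJ; apply: sJ; apply: HJ => //.
  by case: hI => /subvP sI _; apply: sI.
move=> c i cC; case: hI hJ => sI HI [sJ HJ].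
have [U HU] := @vspace_of_pred F V (fun v => br c v \in brs I J)
  (ltac:(by rewrite /= br0r mem0v))
  (ltac:(by move=> a u v /= Hu Hv; rewrite br_linr memvD ?memvZ)).
suff /subvP s : (brs I J <= U)%VS by move/s/HU.
apply/brs_subP => a b aI bJ; apply/HU; rewrite brJ memvD //.
  by apply: mem_brs => //; apply: HI.
by apply: mem_brs => //; apply: HJ.
Qed.

Lemma subalg_ideal_add C I D :
  ideal_of br C I -> subalg br D -> (D <= C)%VS -> subalg br (I + D).
Proof.
move=> hI Ds /subvP sD a b /memv_addP[i iI [d dD ->]] /memv_addP[j jI [e eD ->]].
have [/subvP sI HI] := hI.
rewrite brDl !brDr addrA memvD //; last by rewrite (subvP (addvSr _ _)) ?Ds.
rewrite (subvP (addvSl _ _)) // !memvD //.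
- by apply: HI => //; apply: sI.
- by apply: (ideal_r hI) => //; apply: sD.
by apply: HI => //; apply: sD.
Qed.

Lemma abelian_subalg A : abelian br A -> subalg br A.
Proof. by move=> H a b aA bA; rewrite H ?mem0v. Qed.

Lemma abelianS A B : (A <= B)%VS -> abelian br B -> abelian br A.
Proof. by move=> /subvP s H a b /s aB /s bB; apply: H. Qed.

Lemma brs_abelian A : abelian br A <-> brs A A = 0%VS.
Proof.
split=> [H|H a b aA bA]; last by apply/eqP; rewrite -memv0 -H mem_brs.
apply/eqP; rewrite -subv0; apply/brs_subP => a b aA bA; by rewrite H ?mem0v.
Qed.

Lemma vproper_dim A B : vproper A B -> (\dim A < \dim B)%N.
Proof.
case/andP=> sAB; apply: contraR; rewrite -leqNgt => le; by rewrite eqEdim sAB.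
Qed.

Lemma max_subalg_exists C D : subalg br C -> subalg br D -> vproper D C ->
  exists2 M, max_subalg_of br C M & (D <= M)%VS.
Proof.
move=> Cs Ds pD.
have [M [Ms pM sDM] maxM] := @dim_max F V
  (fun M => [/\ subalg br M, vproper M C & (D <= M)%VS]) D
  (And3 Ds pD (subvv D)).
exists M => //; split=> // N Ns sMN sNC.
have [->|neq] := eqVneq N C; [by right|left].
apply/esym/eqP; rewrite eqEdim sMN maxM //; split=> //; first by rewrite /vproper sNC.
exact: subv_trans sDM sMN.
Qed.

(** A proper [D] would lie in a maximal subalgebra, which also contains [I] and hence all of [C]. *)
Lemma in_all_max_supp C I D : subalg br C -> ideal_of br C I -> in_all_max br C I ->
  subalg br D -> (D <= C)%VS -> (C <= I + D)%VS -> D = C.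
Proof.
move=> Cs hI mI Ds sDC sC; apply/eqP; apply: contraT => neq.
have [M maxM sDM] := max_subalg_exists Cs Ds (ltac:(by rewrite /vproper sDC)).
have sIM := mI _ maxM; case: maxM => _ /andP[sMC nMC] _.
case/negP: nMC; rewrite eqEsubv sMC (subv_trans sC) //.
by rewrite subv_add sIM.
Qed.

Lemma frattini_exists C : subalg br C -> exists P, is_frattini br C P.
Proof.
move=> Cs.
have Q0 : ideal_of br C 0 /\ in_all_max br C 0.
  split=> [|M _]; last exact: sub0v.
  by split=> [|c i _]; [exact: sub0v | rewrite !memv0 => /eqP->; rewrite br0r].
have [P [hP mP] maxP] := @dim_max F V (fun I => ideal_of br C I /\ in_all_max br C I) _ Q0.
exists P; split=> // I hI mI.
suff /eqP -> : P == (I + P)%VS by apply: addvSl.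
rewrite eqEdim addvSr maxP //; split; first exact: ideal_add.
by move=> M maxM; rewrite subv_add mI ?mP.
Qed.

Lemma elementaryP C : elementary br C -> forall D I, subalg br D -> (D <= C)%VS ->
  ideal_of br D I -> in_all_max br D I -> I = 0%VS.
Proof.
move=> eC D I Ds sDC hI mI; have [P fP] := frattini_exists Ds.
have P0 := eC _ Ds sDC _ fP; case: fP => _ _ /(_ I hI mI).
by rewrite P0 subv0 => /eqP.
Qed.

(* B is a supplement of A in C of minimal dimension: A meets B in an ideal of C that
   lies in every maximal subalgebra of C. *)
Lemma abelian_ideal_split C A : subalg br C ->
  (forall I, ideal_of br C I -> in_all_max br C I -> I = 0%VS) ->
  ideal_of br C A -> abelian br A ->
  exists B, [/\ subalg br B, (A + B = C)%VS & (A :&: B = 0)%VS].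
Proof.
move=> Cs phi0 hA abA; have [sAC HA] := hA.
have [B [Bs AB] minB] := @dim_min F V (fun B => subalg br B /\ (A + B)%VS = C) C
  (conj Cs (addv_idPr sAC)).
have sBC : (B <= C)%VS by rewrite -AB addvSr.
exists B; split=> //; apply: phi0.
  split=> [|c i]; first by apply: subv_trans (capvSl _ _) sAC.
  rewrite -{1}AB => /memv_addP[a aA [b bB ->]]; rewrite !memv_cap => /andP[iA iB].
  by rewrite brDl (abA a i) // add0r HA ?Bs // (subvP sBC).
move=> M maxM; apply: contraT => nM.
have hI : ideal_of br B (A :&: B) by apply: ideal_cap hA Bs sBC.
have [Ms pM mM] := maxM; have sMC : (M <= C)%VS by case/andP: pM.
have hIC : ideal_of br C (A :&: B).
  split=> [|c i]; first by apply: subv_trans (capvSl _ _) sAC.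
  rewrite -{1}AB => /memv_addP[a aA [b bB ->]]; rewrite !memv_cap => /andP[iA iB].
  by rewrite brDl (abA a i) // add0r HA ?Bs // (subvP sBC).
have IM : (A :&: B + M)%VS = C.
  have := mM (A :&: B + M)%VS (subalg_ideal_add hIC Ms sMC) (addvSr _ _).
  case; rewrite ?subv_add ?sMC ?(subv_trans (capvSl _ _) sAC) // => eM.
  by case/negP: nM; rewrite -eM addvSl.
(* Since [A :&: B + M = C], already [B :&: M] supplements [A]; minimality of [B] then puts [B]
   inside [M]. *)
have ABM : (A + (B :&: M))%VS = C.
  apply/eqP; rewrite eqEsubv subv_add sAC (subv_trans (capvSl _ _) sBC) /=.
  apply/subvP=> c; rewrite -{1}AB => /memv_addP[a aA [b bB ->]].
  have : b \in (A :&: B + M)%VS by rewrite IM (subvP sBC).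
  case/memv_addP=> i iAB [m mM' e]; have [iA iB] : i \in A /\ i \in B.
    by move: iAB; rewrite memv_cap => /andP.
  rewrite e addrA; apply: memv_add; first exact: memvD.
  by rewrite memv_cap mM' andbT -[m](addKr i) -e memvD ?memvN.
have BMs : subalg br (B :&: M).
  move=> a b; rewrite !memv_cap => /andP[aB aM] /andP[bB bM].
  by rewrite Bs ?Ms.
have /eqP eBM : (B :&: M)%VS == B by rewrite eqEdim capvSl minB.
case/negP: nM; apply: subv_trans (capvSr _ _) _; rewrite -eBM; exact: capvSr.
Qed.

Lemma ideal0 C : ideal_of br C 0.
Proof. by split=> [|c i _]; [exact: sub0v | rewrite !memv0 => /eqP->; rewrite br0r]. Qed.

Lemma idealf : ideal_of br fullv fullv.
Proof. by split=> [|c i _ _]; rewrite ?memvf ?subvv. Qed.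

Lemma subalgf : subalg br fullv.
Proof. by move=> *; rewrite memvf. Qed.

Definition dser n C := iter n (fun A => brs A A) C.

Lemma dser_ideal n C I : ideal_of br C I -> ideal_of br C (dser n I).
Proof. by move=> hI; elim: n => //= n IH; apply: ideal_brs. Qed.

Lemma dser_last n I : I != 0%VS -> dser n I = 0%VS ->
  exists k, dser k I != 0%VS /\ abelian br (dser k I).
Proof.
move=> nI; elim: n => [/= e|n IH /= H]; first by rewrite e eqxx in nI.
have [/IH //|nz] := eqVneq (dser n I) 0%VS.
by exists n; split=> //; apply/brs_abelian.
Qed.

Lemma dserD m n I : dser m (dser n I) = dser (m + n) I.
Proof. by rewrite /dser -iterD. Qed.

Lemma dserS n I J : (I <= J)%VS -> (dser n I <= dser n J)%VS.
Proof. by move=> s; elim: n => //= n IH; apply: brsS. Qed.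

Lemma brs_sub C : subalg br C -> (brs C C <= C)%VS.
Proof. by move=> Cs; apply/brs_subP. Qed.

Lemma brs_subalg C : subalg br C -> subalg br (brs C C).
Proof. by move=> Cs a b /(subvP (brs_sub Cs)) aC /(subvP (brs_sub Cs)) bC; apply: mem_brs. Qed.

Lemma dser_subalg n C : subalg br C -> subalg br (dser n C).
Proof. by move=> Cs; elim: n => //= n; apply: brs_subalg. Qed.

Lemma dser_le m n C : subalg br C -> (m <= n)%N -> (dser n C <= dser m C)%VS.
Proof.
move=> Cs /subnK <-; elim: (n - m)%N => [|k IH]; first by rewrite subvv.
by rewrite addSn; exact: subv_trans (brs_sub (@dser_subalg (k + m) C Cs)) IH.
Qed.

End Bracket.

(** * Polynomials in a linear operator *)

Section OperatorPolynomials.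
Variables (F : fieldType) (V : vectType F).
Implicit Types (T S f : 'End(V)) (U A E : {vspace V}) (p q : {poly F}).

Definition opoly T p : 'End(V) := linfun (fun v => \sum_(i < size p) p`_i *: iter i T v).

Lemma iter_lin T k a u v : iter k T (a *: u + v) = a *: iter k T u + iter k T v.
Proof. by elim: k => //= k ->; rewrite linearP. Qed.

Lemma opolyE T p n v : (size p <= n)%N -> opoly T p v = \sum_(i < n) p`_i *: iter i T v.
Proof.
move=> le_n; rewrite /opoly linfun_apply => [|a u w]; last first.
  rewrite scaler_sumr -big_split /=; apply: eq_bigr => i _.
  by rewrite iter_lin scalerDr !scalerA mulrC.
rewrite (big_ord_widen _ (fun i => p`_i *: iter i T v) le_n) big_mkcond /=.
apply: eq_bigr => i _; case: ltnP => // le_i.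
by rewrite nth_default ?scale0r.
Qed.

Lemma opoly0 T v : opoly T 0 v = 0.
Proof. by rewrite (opolyE _ _ (n := 0)) ?size_poly0 // big_ord0. Qed.

Lemma opolyD T p q v : opoly T (p + q) v = opoly T p v + opoly T q v.
Proof.
pose n := maxn (size p) (size q).
rewrite !(opolyE _ _ (n := n)) ?leq_maxl ?leq_maxr ?size_polyD //.
by rewrite -big_split /=; apply: eq_bigr => i _; rewrite coefD scalerDl.
Qed.

Lemma opolyC T c v : opoly T c%:P v = c *: v.
Proof. by rewrite (opolyE _ _ (n := 1)) ?size_polyC_leq1 // big_ord1 coefC. Qed.

Lemma opolyMX T p v : opoly T (p * 'X) v = T (opoly T p v).
Proof.
rewrite (opolyE _ _ (n := (size p).+1)); last first.
  by rewrite (leq_trans (size_polyMleq _ _)) // size_polyX addn2.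
rewrite big_ord_recl coefMX eqxx scale0r add0r (opolyE _ _ (leqnn _)) linear_sum.
by apply: eq_bigr => i _ /=; rewrite coefMX /= linearZ.
Qed.

Lemma opolyX T v : opoly T 'X v = T v.
Proof. by rewrite -[X in opoly T X]mul1r opolyMX -[1]/(1%:P) opolyC scale1r. Qed.

Lemma opolyM T p q v : opoly T (p * q) v = opoly T p (opoly T q v).
Proof.
elim/poly_ind: p => [|p c IH]; first by rewrite mul0r !opoly0.
rewrite mulrDl -mulrA ['X * q]mulrC mulrA !opolyD !opolyMX IH opolyC.
congr (_ + _); elim/poly_ind: q {IH} => [|q d IH]; first by rewrite mulr0 opoly0 scaler0.
rewrite mulrDr mulrA !opolyD !opolyMX IH -polyCM !opolyC linearZ /=.
by rewrite scalerDr scalerA.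
Qed.

Lemma opoly_op T p v : opoly T p (T v) = T (opoly T p v).
Proof. by rewrite -(opolyX T v) -opolyM -opolyMX. Qed.

Lemma opoly_mul_comm T p q v : opoly T p (opoly T q v) = opoly T q (opoly T p v).
Proof. by rewrite -!opolyM mulrC. Qed.

Definition stable T U := forall u, u \in U -> T u \in U.

Lemma opoly_stable T p U : stable T U -> stable (opoly T p) U.
Proof.
move=> TU u uU; elim/poly_ind: p => [|p c IH]; first by rewrite opoly0 mem0v.
by rewrite opolyD opolyMX opolyC memvD ?TU // memvZ.
Qed.

Lemma opoly_comm T S E p : stable T E ->
  (forall v, v \in E -> S (T v) = T (S v)) ->
  forall v, v \in E -> S (opoly T p v) = opoly T p (S v).
Proof.
move=> TE ST v vE; elim/poly_ind: p => [|p c IH]; first by rewrite !opoly0 linear0.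
by rewrite !opolyD !opolyMX !opolyC linearD linearZ /= ST ?IH //; apply: opoly_stable.
Qed.

(** There is one more power of [T] in the list [X] than the dimension of ['End(V)], so the powers
    are linearly dependent. *)
Lemma opoly_annihilator T : exists2 p, p != 0 & forall v, opoly T p v = 0.
Proof.
pose pw i : 'End(V) := linfun (iter i T).
have pwE i v : pw i v = iter i T v by rewrite /pw linfun_apply //; apply: iter_lin.
pose X := [seq pw i | i <- iota 0 (\dim {:'End(V)}).+1].
have nf : ~~ free X.
  apply/negP => /eqP; have := dimvS (subvf <<X>>%VS).
  by move=> le e; move: le; rewrite e size_map size_iota ltnn.
have sX : size X == (\dim {:'End(V)}).+1 by rewrite size_map size_iota.
have /freeP nfP : ~~ free (Tuple sX) by [].
case/not_all_ex_not: (fun H => nfP (fun k => H k)) => k /= {}nfP.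
have [k0 nz] := imply_to_and _ _ nfP; have [i ki] := not_all_ex_not _ _ nz.
exists (\poly_(j < (\dim {:'End(V)}).+1) k (inord j)).
  apply/eqP => /(congr1 (fun q : {poly F} => q`_i)).
  by rewrite coef_poly ltn_ord inord_val coef0.
move=> v; rewrite (opolyE _ _ (size_poly _ _)).
move/(congr1 (fun f : 'End(V) => f v)): k0; rewrite sum_lfunE zero_lfunE => k0.
rewrite -[RHS]k0; apply: eq_bigr => j _.
rewrite coef_poly ltn_ord inord_val scale_lfunE; congr (_ *: _).
by rewrite (nth_map 0%N) ?size_iota // nth_iota // add0n pwE.
Qed.

Definition semisimple_on T E := forall U, (U <= E)%VS -> stable T U ->
  exists U', [/\ (U' <= E)%VS, stable T U', (U + U')%VS = E & (U :&: U')%VS = 0%VS].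

Hypothesis charF : [pchar F] =i pred0.

Lemma deriv_neq0 (u : {poly F}) : (1 < size u)%N -> u^`() != 0.
Proof.
move=> su; apply/eqP => /(congr1 (fun q : {poly F} => q`_(size u).-2)).
rewrite coef_deriv coef0 => /eqP.
have -> : (size u).-2.+1 = (size u).-1 by case: (size u) su => [|[]].
rewrite -mulr_natr mulf_eq0 -[u`__]/(lead_coef u) lead_coef_eq0.
have -> : (u == 0) = false by apply/negP => /eqP u0; rewrite u0 size_poly0 in su.
rewrite /=; apply/negP; move/pcharf0P: charF => ->.
by case: (size u) su => [|[]].
Qed.

(* The minimal polynomial on E is squarefree: if d^2 e annihilates E then (de)(T)
   has square zero and a T-stable complement of its kernel must vanish. *)
Lemma semisimple_separable T E : stable T E -> semisimple_on T E ->
  exists2 p, separable_poly p & forall v, v \in E -> opoly T p v = 0.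
Proof.
move=> TE ssE; have [p0 p0nz kp0] := opoly_annihilator T.
have [|p [pnz kp] minp] := @nat_min {poly F} (fun p => size p)
  (fun p => p != 0 /\ forall v, v \in E -> opoly T p v = 0) p0.
  by split=> // v _; apply: kp0.
exists p => //; apply/separable_polyP; split=> [r s rs|u _ su]; last exact: deriv_neq0.
set d := gcdp r s; have dd : d * d %| p.
  by apply: dvdp_trans rs; rewrite dvdp_mul // ?dvdp_gcdl ?dvdp_gcdr.
case/dvdpP: dd => e pE; set n := opoly T (e * d).
have enz : e != 0 by apply: contra_neq pnz => e0; rewrite pE e0 mul0r.
have dnz : d != 0 by apply: contra_neq pnz => d0; rewrite pE d0 mulr0 mulr0.
have TnE : stable n E by apply: opoly_stable.
have nn v : v \in E -> n (n v) = 0.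
  move=> vE; rewrite /n -opolyM.
  have -> : e * d * (e * d) = e * p by rewrite pE mulrACA -mulrA.
  by rewrite opolyM kp // linear0.
have [||U' [sU' TU' EU' U0]] := ssE (E :&: lker n)%VS; first exact: capvSl.
  move=> u; rewrite !memv_cap !memv_ker => /andP[uE /eqP nu].
  by rewrite TE //= /n opoly_op -/n nu linear0.
have kn v : v \in E -> n v = 0.
  rewrite -EU' => /memv_addP[a]; rewrite memv_cap memv_ker => /andP[aE /eqP na] [b bU ->].
  have bE := subvP sU' _ bU.
  suff nb : n b = 0 by rewrite linearD /= na nb addr0.
  have : n b \in (E :&: lker n :&: U')%VS.
    by rewrite !memv_cap memv_ker nn ?TnE ?eqxx //=; apply: opoly_stable.
  by rewrite U0 memv0 => /eqP.
have ednz : e * d != 0 by rewrite mulf_neq0.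
have := minp (e * d) (conj ednz kn).
rewrite pE mulrA size_mul // /coprimep -/d.
have : (size d > 0)%N by rewrite size_poly_gt0.
case: (size d) => [//|[|m _]] //.
by rewrite !addnS /= ltnNge leq_addr.
Qed.

(** In a Bezout relation a p + b p' = c with c a nonzero constant, p(T) vanishes on [E], so b(T) / c
    inverts p'(T) there. *)
Lemma separable_inverse p T E : separable_poly p ->
  (forall v, v \in E -> opoly T p v = 0) ->
  exists u, forall v, v \in E -> opoly T u (opoly T p^`() v) = v.
Proof.
move=> sp kp; have : coprimep p p^`() by move: sp; rewrite separable_poly.unlock.
move/Bezout_coprimepP=> [[a b] /= /eqpf_eq[c nzc e]].
exists (c^-1 *: b) => v vE.
rewrite -opolyM -scalerAl -[RHS]scale1r -(opolyC T).
have -> : 1%:P = c^-1 *: (a * p + b * p^`()) :> {poly F}.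
  by rewrite e scalerA mulVf // scale1r.
have K : opoly T (c^-1 *: (a * p)) v = 0.
  by rewrite -mul_polyC mulrA opolyM kp // linear0.
by rewrite scalerDr opolyD K add0r.
Qed.

(* [p(T), S] = p'(T) [T, S] when [T, S] commutes with T, and p'(T) is invertible. *)
Lemma separable_comm p T S E : separable_poly p -> stable T E -> stable S E ->
  (forall v, v \in E -> opoly T p v = 0) ->
  (forall v, v \in E -> T (T (S v) - S (T v)) = T (S (T v)) - S (T (T v))) ->
  forall v, v \in E -> T (S v) = S (T v).
Proof.
move=> sp TE SE kp zT v vE; pose z : 'End(V) := ((T \o S) - (S \o T))%VF.
have zE w : z w = T (S w) - S (T w) by rewrite /z add_lfunE opp_lfunE !comp_lfunE.
have zT' w : w \in E -> z (T w) = T (z w) by move=> wE; rewrite !zE zT.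
have key q w : w \in E ->
    opoly T q (S w) - S (opoly T q w) = opoly T q^`() (z w).
  move=> wE; elim/poly_ind: q => [|q c IH].
    by rewrite deriv0 !opoly0 linear0 subr0.
  rewrite derivD derivC addr0 derivM derivX mulr1 !opolyD !opolyMX !opolyC.
  rewrite linearD linearZ /= opprD addrACA subrr addr0 -IH.
  have -> : opoly T q (z w) = z (opoly T q w) by rewrite (opoly_comm _ TE).
  by rewrite zE linearB /= addrA subrK.
have [u uP] := separable_inverse sp kp.
have := key p v vE; rewrite !kp ?SE // linear0 subr0 => k0.
have zvE : z v \in E by rewrite zE memvB ?TE ?SE // TE.
have := uP _ zvE; rewrite -k0 linear0 zE => /esym/eqP.
by rewrite subr_eq0 => /eqP.
Qed.

(* G is (p(s) - p(t)) / (s - t) applied to f, where s and t stand for left and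
   right composition with T. *)
Lemma divided_difference p T f A E : stable T E -> (forall v, v \in E -> f v \in A) ->
  stable T A -> (forall a, a \in A -> f a = a) ->
  exists G : 'End(V), [/\
    forall v, v \in E -> T (G v) - G (T v) = opoly T p (f v) - f (opoly T p v),
    forall a, a \in A -> G a = opoly T p^`() a,
    forall v, v \in E -> G v \in A &
    forall S, stable S E -> (A <= E)%VS -> (forall v, v \in E -> S (T v) = T (S v)) ->
      (forall v, v \in E -> S (f v) = f (S v)) ->
      forall v, v \in E -> S (G v) = G (S v)].
Proof.
move=> TE fA TA fid; elim/poly_ind: p => [|q c [G [G1 G2 G3 G4]]].
  exists 0; split=> [v vE|a aA|v vE|S SE sAE ST Sf v vE].
  - by rewrite !zero_lfunE !opoly0 !linear0.
  - by rewrite zero_lfunE deriv0 opoly0.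
  - by rewrite zero_lfunE mem0v.
  by rewrite !zero_lfunE linear0.
(* From (q(s) s - q(t) t) / (s - t) = t (q(s) - q(t)) / (s - t) + q(s); the constant [c] cancels. *)
exists ((G \o T) + (opoly T q \o f))%VF.
have GE w : ((G \o T) + (opoly T q \o f))%VF w = G (T w) + opoly T q (f w).
  by rewrite add_lfunE !comp_lfunE.
split=> [v vE|a aA|v vE|S SE sAE ST Sf v vE]; rewrite !GE.
- have := G1 _ (TE _ vE); rewrite !opolyD !opolyMX !opolyC !linearD !linearZ /=.
  rewrite -(opoly_op T q v) => /eqP; rewrite subr_eq => /eqP ->.
  rewrite scalerN [RHS]addrACA subrr addr0 [X in X + _]addrAC addrA addrK.
  by rewrite -[X in X - _ = _]addrA [X in X - _ = _]addrC addrK addrC.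
- by rewrite fid // derivD derivC addr0 derivM derivX mulr1 opolyD opolyMX G2 ?TA // opoly_op.
- by rewrite memvD ?G3 ?TE //; apply: opoly_stable => //; apply: fA.
rewrite linearD /= G4 ?TE // ST // -Sf //; congr (_ + _).
rewrite (opoly_comm _ TE) //; apply: (subvP sAE); exact: fA.
Qed.

(** The operators are treated one at a time. Applied to a projection [f] onto [A], the divided
    difference [G] commutes with [T], because p(T) is zero on [E], and equals p'(T) on [A].
    Composing with the inverse of p'(T) gives a projection again, and commutation with the earlier
    operators survives because these commute with both [T] and [f]. *)
Lemma equivariant_projection (Ts : seq 'End(V)) A E : (A <= E)%VS ->
  (forall T, T \in Ts -> [/\ stable T E, stable T A &
     exists2 p, separable_poly p & forall v, v \in E -> opoly T p v = 0]) ->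
  (forall T S v, T \in Ts -> S \in Ts -> v \in E -> S (T v) = T (S v)) ->
  exists f : 'End(V), [/\ forall v, v \in E -> f v \in A, forall a, a \in A -> f a = a &
    forall T v, T \in Ts -> v \in E -> T (f v) = f (T v)].
Proof.
move=> sAE; elim: Ts => [|T Ts IH] TsP cT.
  exists (projv A); split=> // [v _|a aA]; [exact: memv_proj | exact: projv_id].
have [||f [fA fid fT]] := IH; first by move=> S ST; apply: TsP; rewrite inE ST orbT.
  by move=> S S' v ST ST'; apply: cT; rewrite inE ?ST ?ST' orbT.
have [TE TA [p sp kp]] := TsP T (mem_head _ _).
have [G [G1 G2 G3 G4]] := divided_difference p TE fA TA fid.
have [u uP] := separable_inverse sp kp.
have uE := opoly_stable u TE; have uA := opoly_stable u TA.
exists (G \o opoly T u)%VF; split=> [v vE|a aA|S v ST vE]; rewrite !comp_lfunE.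
- by apply: G3; apply: uE.
- by rewrite G2 ?uA // opoly_mul_comm uP // (subvP sAE).
have [SE _ _] := TsP S ST.
have cu w : w \in E -> S (opoly T u w) = opoly T u (S w).
  by apply: (opoly_comm _ TE) => x xE; apply: cT; rewrite ?mem_head.
rewrite -cu //; move: ST; rewrite inE => /predU1P[->|ST].
  have := G1 _ (uE _ vE); rewrite (kp _ (uE _ vE)) linear0 subr0.
  have -> : opoly T p (f (opoly T u v)) = 0.
    by rewrite kp // (subvP sAE) // fA ?uE.
  by move/eqP; rewrite subr_eq0 => /eqP.
apply: G4; rewrite ?uE // => w wE; first by apply: cT; rewrite ?mem_head // inE ST orbT.
exact: fT.
Qed.

End OperatorPolynomials.

(** * Solvable minimal non-elementary algebras *)

Section Solvable.
Variables (F : fieldType) (V : vectType F) (br : V -> V -> V).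
Hypothesis Hlie : is_lie_bracket br.
Hypothesis charF : [pchar F] =i pred0.
Implicit Types (u v w x y z : V) (A B C D E I J M U : {vspace V}).
Local Notation adE := (adE Hlie).

Lemma add_line_subalg E x : subalg br E -> stable (ad br x) E -> subalg br (E + <[x]>)%VS.
Proof.
move=> Es xE _ _ /memv_addP[a aE [_ /vlineP[s ->] ->]] /memv_addP[b bE [_ /vlineP[t ->] ->]].
rewrite (subvP (addvSl _ _)) // (brDl Hlie) !(brDr Hlie) !(brZl Hlie) !(brZr Hlie) (brxx Hlie).
rewrite !scaler0 addr0 !memvD ?memvZ //; first exact: Es.
  by rewrite (brC Hlie) memvN -adE xE.
by rewrite -adE xE.
Qed.

(** A stable [U] is an ideal of [C], so it has a complement [B] in [C]. On the abelian [E], [ad x]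
    agrees with the bracket by the [B]-component of [x]; hence [E :&: B] is stable. *)
Lemma ad_semisimple E x : abelian br E -> stable (ad br x) E ->
  elementary br (E + <[x]>) -> semisimple_on (ad br x) E.
Proof.
move=> abE xE eC U sUE xU; set C := (E + <[x]>)%VS in eC.
have Cs : subalg br C by apply: add_line_subalg => //; apply: abelian_subalg.
have sEC : (E <= C)%VS by apply: addvSl.
have hU : ideal_of br C U.
  split=> [|_ i /memv_addP[a aE [_ /vlineP[s ->] ->]] iU].
    exact: subv_trans sUE sEC.
  have iE := subvP sUE _ iU.
  by rewrite (brDl Hlie) (abE a i) // add0r (brZl Hlie) memvZ // -adE xU.
have phi0 I : ideal_of br C I -> in_all_max br C I -> I = 0%VS.
  exact: (elementaryP Hlie eC Cs (subvv _)).
have [B [Bs UB U0]] := abelian_ideal_split Hlie Cs phi0 hU (abelianS sUE abE).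
have EB : (U + (E :&: B) = E)%VS.
  apply/eqP; rewrite eqEsubv subv_add sUE capvSl /=; apply/subvP=> e eE.
  have : e \in (U + B)%VS by rewrite UB (subvP sEC).
  case/memv_addP=> a aU [b bB e_ab]; rewrite e_ab memv_add // memv_cap bB andbT.
  by rewrite -[b](addKr a) -e_ab memvD ?memvN // (subvP sUE).
exists (E :&: B)%VS; split=> //; first exact: capvSl.
  move=> e; rewrite !memv_cap => /andP[eE eB]; rewrite xE //= adE.
  have : x \in (U + B)%VS by rewrite UB (subvP (addvSr _ _)) ?memv_line.
  case/memv_addP=> a aU [b bB ->].
  have aE := subvP sUE _ aU.
  by rewrite (brDl Hlie) (abE a e) // add0r Bs.
apply/eqP; rewrite -subv0 -U0; apply: capvS => //; exact: capvSr.
Qed.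

Lemma elementary_sep E x : abelian br E -> stable (ad br x) E ->
  elementary br (E + <[x]>) ->
  exists2 p, separable_poly p & forall v, v \in E -> opoly (ad br x) p v = 0.
Proof.
move=> abE xE eC; apply: semisimple_separable => //; exact: ad_semisimple.
Qed.

Lemma abelian_no_frattini C I : abelian br C -> ideal_of br C I -> in_all_max br C I ->
  I = 0%VS.
Proof.
move=> abC hI mI; have [sIC _] := hI.
have DC : (C <= I + (C :\: I))%VS.
  by rewrite -{1}(addv_diff_cap C I) addvC addvS // capvSr.
have sD := diffvSl C I.
have := in_all_max_supp (abelian_subalg abC) hI mI (abelian_subalg (abelianS sD abC)) sD DC.
by move=> e; rewrite -(capv_diff C I) e; apply/esym/capv_idPr.
Qed.

Lemma abelian_elementary C : abelian br C -> elementary br C.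
Proof.
move=> abC D Ds sD P [hP mP _]; apply: abelian_no_frattini hP mP.
exact: abelianS sD abC.
Qed.

Definition min_nonelem_witness P :=
  [/\ ideal_of br fullv P, in_all_max br fullv P & P != 0%VS].

Lemma min_nonelem_ideal : minimal_non_elementary br -> exists P, min_nonelem_witness P.
Proof.
case=> /not_all_ex_not[D H1 H2]; have [Ds H3] := imply_to_and _ _ H1.
have [sD H4] := imply_to_and _ _ H3; have [P H5] := not_all_ex_not _ _ H4.
have [fP nP] := imply_to_and _ _ H5.
have nP' : P != 0%VS by apply/eqP.
have [eD|neD] := eqVneq D fullv.
  by exists P; move: fP; rewrite eD => -[hP mP _]; split.
by case: nP; apply: (H2 D Ds _ D Ds (subvv D) P fP); rewrite /vproper sD.
Qed.

Lemma min_nonelem_proper C : minimal_non_elementary br -> subalg br C -> C != fullv ->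
  elementary br C.
Proof. by case=> _ H Cs nC; apply: H => //; rewrite /vproper subvf. Qed.

Lemma witness_supp P I D : min_nonelem_witness P -> ideal_of br fullv I -> (I <= P)%VS ->
  subalg br D -> (I + D = fullv)%VS -> D = fullv.
Proof.
move=> [hP mP _] hI sIP Ds e; apply: (in_all_max_supp (@subalgf _ _ _) hI) => //.
- by move=> M /mP; apply: subv_trans.
- exact: subvf.
by rewrite e.
Qed.

Lemma elementary_split C A : elementary br C -> subalg br C -> ideal_of br C A ->
  abelian br A ->
  exists B, [/\ subalg br B, (A + B = C)%VS & (A :&: B = 0)%VS].
Proof.
move=> eC Cs hA abA; apply: abelian_ideal_split => // I.
exact: (elementaryP Hlie eC Cs (subvv _)).
Qed.

Lemma ideal_stable I x : ideal_of br fullv I -> stable (ad br x) I.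
Proof. by move/idealP=> H i /(H x); rewrite adE. Qed.

(** On [E], the action of [x, y] is the commutator of [ad x] and [ad y]. The second hypothesis says
    that it commutes with [ad x], and separability of [ad x] then makes it vanish. *)
Lemma sep_bracket_trivial E x y : ideal_of br fullv E ->
  (exists2 p, separable_poly p & forall v, v \in E -> opoly (ad br x) p v = 0) ->
  (forall v, v \in E -> br (br x (br x y)) v = 0) ->
  forall v, v \in E -> br (br x y) v = 0.
Proof.
move=> hE [p sp kp] H v vE.
rewrite (brJl Hlie) -!adE; apply/eqP; rewrite subr_eq0; apply/eqP.
apply: (separable_comm sp _ _ kp) => //; try exact: ideal_stable.
by move=> w wE; rewrite !adE -!(brJl Hlie) (brJ Hlie x) H // add0r.
Qed.

(* ad x is separable on every abelian ideal E of L, so by sep_bracket_trivial the whole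
   derived algebra centralises E. The last term of the derived series then lies in L^2,
   is central there and splits off from it, so it misses [L^2, L^2]. *)
Lemma derived_abelian : minimal_non_elementary br ->
  (exists n, dser br n fullv = 0%VS) -> abelian br (derived br).
Proof.
move=> mne [n sol]; have [P [hP mP nP]] := min_nonelem_ideal mne.
have nz : (fullv : {vspace V}) != 0%VS.
  by apply: contra_neq nP => e; apply/eqP; rewrite -subv0 -e subvf.
apply: NNPP => nab.
have hd k : ideal_of br fullv (dser br k fullv) by apply: dser_ideal => //; apply: idealf.
have triv E : ideal_of br fullv E -> abelian br E ->
    forall k, (0 < k)%N -> forall z v, z \in dser br k fullv -> v \in E -> br z v = 0.
  move=> hE abE.
  have sepE x : exists2 p, separable_poly p & forall v, v \in E -> opoly (ad br x) p v = 0.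
    have xE := ideal_stable x hE.
    apply: elementary_sep => //; apply: min_nonelem_proper => //.
      by apply: add_line_subalg => //; apply: abelian_subalg.
    (* If [E + <[x]>] were all of L, the derived algebra would lie in [E] and be abelian. *)
    apply: contra_not_neq nab => e; apply: abelianS abE.
    apply/(brs_subP Hlie) => a b _ _.
    have : a \in (E + <[x]>)%VS by rewrite e memvf.
    have : b \in (E + <[x]>)%VS by rewrite e memvf.
    case/memv_addP=> b1 bE [_ /vlineP[s ->] ->] /memv_addP[a1 aE [_ /vlineP[t ->] ->]].
    move: hE => /idealP hE.
    rewrite (brDr Hlie); apply: memvD; first exact: hE.
    rewrite (brZr Hlie) memvZ // (brC Hlie) memvN (brDr Hlie).
    by rewrite (brZr Hlie) (brxx Hlie) scaler0 addr0 hE.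
  (* For j in L^(k+1), the bracket [j, [j, x]] lies in L^(k+2), so [j, x] acts trivially on [E].
     With j = [x, y], for x and y in L^(k), this is the hypothesis of [sep_bracket_trivial] for x
     and y. *)
  have step k : (forall z v, z \in dser br k.+2 fullv -> v \in E -> br z v = 0) ->
      forall z v, z \in dser br k.+1 fullv -> v \in E -> br z v = 0.
    move=> IH z v zk vE.
    have T1 j x w : j \in dser br k.+1 fullv -> w \in E -> br (br j x) w = 0.
      move=> jk wE; apply: (sep_bracket_trivial hE (sepE j)) => // e eE; apply: IH => //.
      by apply: mem_brs => //; apply: (ideal_r Hlie (hd k.+1)); rewrite ?memvf.
    have [|a u w /= hu hw|U UP] := @vspace_of_pred F V (fun z => br z v = 0).
    - exact: br0l.
    - by rewrite (brDl Hlie) (brZl Hlie) hu hw scaler0 addr0.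
    apply/UP; apply: (subvP _ z zk); apply/(brs_subP Hlie) => x y xk yk; apply/UP.
    apply: (sep_bracket_trivial hE (sepE x)) => // w wE.
    rewrite (brC Hlie x (br x y)) (brNl Hlie) T1 ?oppr0 //; exact: mem_brs.
  move=> k k_gt0; have [le_nk|lt_kn] := leqP n k.
    move=> z v; have /subvP s := dser_le Hlie (@subalgf _ _ br) le_nk.
    by move=> /s; rewrite sol memv0 => /eqP-> _; rewrite (br0l Hlie).
  have : forall i, (i <= n - k)%N -> forall z v, z \in dser br (n - i)%N fullv -> v \in E -> br z v = 0.
    elim=> [_ z v|i IH lt_i].
      by rewrite subn0 sol memv0 => /eqP->; rewrite (br0l Hlie).
    have e : (n - i.+1).+1 = (n - i)%N by lia.
    have [m em] : exists m, (n - i.+1)%N = m.+1 by exists (n - i.+1).-1; lia.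
    rewrite em; apply: step; rewrite -em e; apply: IH; lia.
  by move/(_ _ (leqnn _)); rewrite subKn // ltnW.
(* The last nonzero term is sought from index 2 on, so that it lies inside [D, D]. *)
have n2 : dser br 2 fullv != 0%VS.
  by apply: contra_not_neq nab => /(brs_abelian Hlie).
have sol2 : dser br n (dser br 2 fullv) = 0%VS.
  rewrite dserD; apply/eqP; rewrite -subv0 -sol.
  by apply: dser_le => //; [exact: subalgf | exact: leq_addr].
have [k [nk abk]] := dser_last Hlie n2 sol2; rewrite dserD in nk abk.
set D := derived br; set E := dser br (k + 2) fullv in nk abk.
have Ds : subalg br D by apply: (ideal_subalg (hd 1%N)).
have nD : D != fullv.
  apply: contra_neq nz => e; rewrite -sol; elim: (n) => //= i <-; exact/esym.
have sED : (E <= D)%VS.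
  apply: (@dser_le _ _ _ Hlie 1 (k + 2)%N fullv); [exact: subalgf | by rewrite addnS].
have hED : ideal_of br D E by apply: (ideal_sub (hd _)) => //; apply: subvf.
have cE z v : z \in D -> v \in E -> br z v = 0.
  by apply: (triv E (hd _) abk 1%N).
have [K [Ks EK EK0]] := elementary_split (min_nonelem_proper mne Ds nD) Ds hED abk.
case/eqP: nk; apply/eqP; rewrite -subv0 -EK0 subv_cap subvv /=.
apply: subv_trans (_ : (brs br D D <= K)%VS).
  apply: (@dser_le _ _ _ Hlie 2 (k + 2)%N fullv); [exact: subalgf | exact: leq_addl].
apply/(brs_subP Hlie) => a b; rewrite -{1 2}EK.
case/memv_addP=> e eE [c cK ->] /memv_addP[f fE [d dK ->]].
have sKD : {subset K <= D} by apply/subvP; rewrite -EK addvSr.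
have ecD : e + c \in D by apply: memvD; [exact: (subvP sED) | exact: sKD].
rewrite (brDr Hlie) (cE _ f ecD fE) add0r (brDl Hlie) (brC Hlie e).
by rewrite (cE d e (sKD _ dK) eE) oppr0 add0r Ks.
Qed.

End Solvable.

(** * Algebras with L = [L, L] + Fx, and alternative (i) *)

Section LineExtensions.
Variables (F : fieldType) (V : vectType F) (br : V -> V -> V).
Hypothesis Hlie : is_lie_bracket br.
Hypothesis charF : [pchar F] =i pred0.
Implicit Types (u v w x y z : V) (A B C D E I J M U : {vspace V}).
Local Notation adE := (adE Hlie).
Local Notation L := (fullv : {vspace V}).

Lemma asoc_exists : exists A, is_asoc br A.
Proof.
have [A ubA minA] := @dim_min F V
  (fun A => forall I, minimal_abelian_ideal br I -> (I <= A)%VS) L (fun I _ => subvf I).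
exists A; split=> // B ubB; apply/capv_idPl/eqP.
rewrite eqEdim capvSl minA // => I mI; by rewrite subv_cap ubA // ubB.
Qed.

(** The vectors that [c] carries into [A] form a subspace containing every minimal abelian ideal,
    hence containing [A] by leastness. *)
Lemma asoc_ideal A : is_asoc br A -> ideal_of br L A.
Proof.
case=> ubA lubA; apply/idealP => c.
have [|a u w /= hu hw|U UP] := @vspace_of_pred F V (fun v => br c v \in A).
- by rewrite (br0r Hlie) mem0v.
- by rewrite (br_linr Hlie) memvD ?memvZ.
suff /subvP s : (A <= U)%VS by move=> i /s/UP.
apply: lubA => I mI; apply/subvP=> i iI; apply/UP; apply: (subvP (ubA I mI)).
by case: mI => [[/idealP hI _ _] _]; apply: hI.
Qed.

Lemma minimal_ideal_below J : ideal_of br L J -> J != 0%VS ->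
  exists2 I, minimal_ideal br I & (I <= J)%VS.
Proof.
move=> hJ nJ.
have [I [hI nI sIJ] minI] := @dim_min F V
  (fun I => [/\ ideal_of br L I, I != 0%VS & (I <= J)%VS]) J (And3 hJ nJ (subvv J)).
exists I => //; split=> // K hK sKI.
have [->|nK] := eqVneq K 0%VS; [by left | right].
by apply/eqP; rewrite eqEdim sKI minI //; split=> //; apply: subv_trans sIJ.
Qed.

(** Complete reducibility of a sum of minimal ideals: [D] is maximal among the ideals in [A] that
    miss [U], and a minimal abelian ideal outside [U + D] could be added to [D]. *)
Lemma asoc_complement A U : is_asoc br A -> ideal_of br L U -> (U <= A)%VS ->
  exists D, [/\ ideal_of br L D, (D <= A)%VS, (U + D = A)%VS & (U :&: D = 0)%VS].
Proof.
move=> aA hU sUA; have [ubA lubA] := aA.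
have [|D [hD sDA D0] maxD] := @dim_max F V
  (fun D => [/\ ideal_of br L D, (D <= A)%VS & (U :&: D = 0)%VS]) 0%VS.
  by split; [exact: ideal0 | exact: sub0v | rewrite capv0].
exists D; split=> //; apply/eqP; rewrite eqEsubv subv_add sUA sDA /=.
apply: lubA => I mI; have [[hI nI minI] abI] := mI.
have hUD : ideal_of br L (U + D) by apply: ideal_add.
have [e|<-] := minI _ (ideal_capI hI hUD) (capvSl _ _); last exact: capvSr.
have ID : (U :&: (D + I) = 0)%VS.
  apply/eqP; rewrite -subv0; apply/subvP=> u; rewrite memv_cap => /andP[uU].
  case/memv_addP=> d dD [i iI eu].
  have i0 : i = 0.
    apply/eqP; rewrite -memv0 -e memv_cap iI /= -[i](addKr d) -eu addrC.
    by rewrite memv_add // memvN.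
  by rewrite -D0 memv_cap uU eu i0 addr0.
have := maxD (D + I)%VS; move/(_ (And3 (ideal_add Hlie hD hI) _ ID)).
rewrite subv_add sDA ubA // => /(_ isT) le.
have /eqP e' : D == (D + I)%VS by rewrite eqEdim addvSl.
by apply: subv_trans (addvSr U D); rewrite e' addvSr.
Qed.

Lemma hyperplane_line (B : {vspace V}) x v : (B + <[x]> = L)%VS ->
  exists t b, b \in B /\ v = b + t *: x.
Proof.
move=> e; have : v \in (B + <[x]>)%VS by rewrite e memvf.
by case/memv_addP=> b bB [_ /vlineP[t ->] ->]; exists t, b.
Qed.

Lemma ideal_abelian_line B x I : abelian br B -> (B + <[x]> = L)%VS -> (I <= B)%VS ->
  stable (ad br x) I -> ideal_of br L I.
Proof.
move=> abB BL /subvP sIB xI; apply/idealP => c i iI.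
have [t [b [bB ->]]] := hyperplane_line c BL.
by rewrite (brDl Hlie) (abB b i bB (sIB _ iI)) add0r (brZl Hlie) memvZ // -adE xI.
Qed.

Lemma derived_ideal : ideal_of br L (derived br).
Proof. by apply: (dser_ideal Hlie 1); apply: idealf. Qed.

(** As [B] is abelian, every bracket of L is a value of [ad x] on [B]. So [ad x] maps [B] onto
    itself, and by dimension injectively. *)
Lemma derived_line x b : abelian br (derived br) -> (derived br + <[x]> = L)%VS ->
  b \in derived br -> exists2 b', b' \in derived br & b = br x b'.
Proof.
set B := derived br => abB BL bB.
suff /subvP s : (B <= ad br x @: B)%VS.
  by have /memv_imgP[b' b'B ->] := s b bB; exists b' => //; rewrite adE.
apply/(brs_subP Hlie) => u v _ _.
have [t [c [cB ->]]] := hyperplane_line u BL.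
have [s [d [dB ->]]] := hyperplane_line v BL.
rewrite (brDl Hlie) !(brDr Hlie) !(brZr Hlie) !(brZl Hlie) (brxx Hlie) !scaler0 addr0.
rewrite (abB c d) // add0r (brC Hlie c) -!adE.
by rewrite memvD ?memvZ ?memvN ?memv_img.
Qed.

Lemma derived_line_inj x b : abelian br (derived br) -> (derived br + <[x]> = L)%VS ->
  b \in derived br -> br x b = 0 -> b = 0.
Proof.
set B := derived br => abB BL bB xb.
have e : (ad br x @: B)%VS = B.
  apply/eqP; rewrite eqEsubv; apply/andP; split; apply/subvP=> c.
    by case/memv_imgP=> c' cB ->; rewrite adE; case: derived_ideal => _ H; rewrite H ?memvf.
  by move=> cB; have [c' c'B ->] := derived_line abB BL cB; rewrite -adE memv_img.
have := limg_ker_dim (ad br x) B; rewrite e => /eqP.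
rewrite -[X in _ == X]add0n eqn_add2r dimv_eq0 => /eqP k0.
by apply/eqP; rewrite -memv0 -k0 memv_cap bB memv_ker adE xb eqxx.
Qed.

(** Such an [I] is central, since [L, I] lies in both [I] and the derived algebra. But [ad x] is
    injective on the nonzero derived algebra, which leaves no centre. *)
Lemma ideal_meets_derived x I : abelian br (derived br) -> (derived br + <[x]> = L)%VS ->
  derived br != 0%VS -> ideal_of br L I -> (I :&: derived br = 0)%VS -> I = 0%VS.
Proof.
set B := derived br => abB BL nB /idealP hI I0.
have cen u i : i \in I -> br u i = 0.
  by move=> iI; apply/eqP; rewrite -memv0 -I0 memv_cap hI // mem_derived.
apply/eqP; rewrite -subv0; apply/subvP=> i iI.
have [t [b [bB e]]] := hyperplane_line i BL.
have b0 : b = 0.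
  apply: (derived_line_inj abB BL bB); have := cen x i iI.
  by rewrite e (brDr Hlie) (brZr Hlie) (brxx Hlie) scaler0 addr0.
rewrite e b0 add0r in iI *; case: (eqVneq t 0) => [->|nt]; first by rewrite scale0r mem0v.
case/eqP: nB; apply/eqP; rewrite -subv0; apply/subvP=> c cB.
rewrite memv0; apply/eqP; apply: (derived_line_inj abB BL cB).
have := cen c _ iI; rewrite (brZr Hlie) => /eqP; rewrite scaler_eq0 (negPf nt) /=.
by rewrite (brC Hlie) oppr_eq0 => /eqP.
Qed.

Definition case_i x := (derived br + <[x]> = L)%VS /\ (derived br :&: <[x]> = 0)%VS /\
  abelian br (derived br) /\
  exists A : {vspace V}, [/\ is_frattini br L A, is_asoc br A, A != 0%VS,
     vproper A (derived br) &
     forall I, ideal_of br L I -> vproper I (derived br) -> (I <= A)%VS].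

Lemma line_notin B x : (B + <[x]> = L)%VS -> B != L -> x \notin B.
Proof. by move=> BL; apply: contra_neqN => xB; rewrite -BL; apply/esym/addv_idPl. Qed.

Lemma line_dim B x : (B + <[x]> = L)%VS -> B != L -> \dim L = (\dim B).+1.
Proof.
move=> BL nB; have xB := line_notin BL nB.
have x0 : x != 0 by apply: contraNneq xB => ->; rewrite mem0v.
rewrite -BL dimv_disjoint_sum ?dim_vline ?x0 ?addn1 //.
apply/eqP; rewrite -subv0; apply/subvP=> y; rewrite memv_cap => /andP[yB /vlineP[k ey]].
case: (eqVneq k 0) => [k0|nk]; first by rewrite ey k0 scale0r mem0v.
by case/negP: xB; rewrite -[x]scale1r -(mulVf nk) -scalerA -ey memvZ.
Qed.

Lemma line_cap B x : x \notin B -> (B :&: <[x]> = 0)%VS.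
Proof.
move=> xB; apply/eqP; rewrite -subv0; apply/subvP=> y; rewrite memv_cap => /andP[yB /vlineP[k ey]].
case: (eqVneq k 0) => [k0|nk]; first by rewrite ey k0 scale0r mem0v.
by case/negP: xB; rewrite -[x]scale1r -(mulVf nk) -scalerA -ey memvZ.
Qed.

Lemma hyperplane_max B x : subalg br B -> (B + <[x]> = L)%VS -> B != L -> max_subalg_of br L B.
Proof.
move=> Bs BL nB; split=> //; first by rewrite /vproper subvf.
move=> N _ sBN _; have dL := line_dim BL nB.
have := dimvS sBN; rewrite leq_eqVlt => /orP[/eqP e|lt]; [left|right].
  by apply/eqP; rewrite eq_sym eqEdim sBN e leqnn.
by apply/eqP; rewrite eqEdim subvf dL.
Qed.

Lemma minimal_nonelem_case_i x : minimal_non_elementary br -> abelian br (derived br) ->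
  derived br != 0%VS -> (derived br + <[x]> = L)%VS -> case_i x.
Proof.
move=> mne abB nB BL; set B := derived br in abB nB BL *.
have hB : ideal_of br L B by exact: derived_ideal.
have Bs : subalg br B by apply: abelian_subalg.
have nBL : B != L.
  apply: contra_neq nB => e; apply/eqP; rewrite -subv0; apply/(brs_subP Hlie) => u v _ _.
  by rewrite (abB u v) ?mem0v // e memvf.
have xB := line_notin BL nBL.
have [P wP] := min_nonelem_ideal mne; have [hP mP nP] := wP.
have maxB := hyperplane_max Bs BL nBL.
have [A aA] := asoc_exists; have hA := asoc_ideal aA; have [ubA lubA] := aA.
have line_proper I y : ideal_of br L I -> (I <= B)%VS -> I != B -> y \notin B ->
    (I + <[y]>)%VS != L.
  move=> hI sI nI yB; apply: contra_neq nI => e.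
  have nIL : I != L by apply: contra_neq nBL => eI; apply/eqP; rewrite eqEsubv subvf -eI.
  by apply/eqP; rewrite eqEdim sI -ltnS -(line_dim BL nBL) (line_dim e nIL) ltnSn.
(* A stable complement [U] of [I :&: A] in [I] is an ideal of L. If nonzero it would contain a
   minimal ideal of L, abelian and hence inside [A]. *)
have c1 I : ideal_of br L I -> (I <= B)%VS -> I != B -> (I <= A)%VS.
  move=> hI sI nI; have xI := ideal_stable Hlie x hI.
  have abI := abelianS sI abB.
  have ss : semisimple_on (ad br x) I.
    apply: ad_semisimple => //; apply: min_nonelem_proper => //; last exact: line_proper.
    by apply: add_line_subalg => //; apply: abelian_subalg.
  have hIA := ideal_capI hI hA.
  have [U [sUI xU UI U0]] := ss _ (capvSl I A) (ideal_stable Hlie x hIA).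
  have hU := ideal_abelian_line abB BL (subv_trans sUI sI) xU.
  have [u0|nU] := eqVneq U 0%VS; first by rewrite -UI u0 addv0 capvSr.
  have [J mJ sJU] := minimal_ideal_below hU nU.
  have sJA : (J <= A)%VS.
    by apply: ubA; split=> //; apply: abelianS abI; apply: subv_trans sUI.
  case: mJ => _ /eqP[]; apply/eqP; rewrite -subv0 -U0 !subv_cap sJU sJA.
  by rewrite (subv_trans sJU).
have sAB : (A <= B)%VS.
  apply: lubA => I [[hI nI minI] _]; have [e|<-] := minI _ (ideal_capI hI hB) (capvSl _ _).
    by case/eqP: nI; exact: (ideal_meets_derived abB BL nB hI e).
  exact: capvSr.
have nPB : (P :&: B)%VS != 0%VS.
  by apply: contra_neq nP => e; exact: (ideal_meets_derived abB BL nB hP e).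
have hPB := ideal_capI hP hB.
(* [<[x]>] is a proper supplement of [B], so [B] itself cannot lie in all maximal subalgebras. *)
have nPBB I : ideal_of br L I -> in_all_max br L I -> I != B.
  move=> hI mI; apply: contra_neq nB => e.
  have xs : subalg br <[x]>%VS.
    by move=> _ _ /vlineP[s ->] /vlineP[t ->]; rewrite (brZl Hlie) (brZr Hlie) (brxx Hlie) !scaler0 mem0v.
  have := in_all_max_supp (@subalgf _ _ br) hI mI xs (subvf _).
  rewrite e BL => /(_ (subvv _)) ex; have := line_cap xB.
  by rewrite ex capvf.
have nPBB' : (P :&: B)%VS != B.
  by apply: nPBB => // M /mP; apply: subv_trans; apply: capvSl.
have sPBA := c1 _ hPB (capvSr _ _) nPBB'.
have nA : A != 0%VS by apply: contra_neq nPB => e; apply/eqP; rewrite -subv0 -e.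
(* If [A = B], the nonzero ideal [P :&: B] has an ideal complement [D] in [B], and [D + <[x]>] is a
   proper supplement of it. *)
have nAB : A != B.
  apply/eqP => eAB; have [D [hD sDA UD UD0]] := asoc_complement aA hPB sPBA.
  have Ds : subalg br (D + <[x]>)%VS.
    by apply: add_line_subalg; [| exact: ideal_subalg hD | exact: ideal_stable].
  have := witness_supp wP hPB (capvSl _ _) Ds.
  rewrite addvA UD eAB BL => /(_ erefl) eD.
  have nD : D != B.
    apply: contra_neq nPB => e.
    by rewrite -UD0 e; apply/esym/capv_idPl; apply: capvSr.
  by have := line_proper D x hD (subv_trans sDA sAB) nD xB; rewrite eD eqxx.
split=> //; split; first exact: line_cap.
split=> //; exists A; split=> //; last first.
- by move=> I hI /andP[sI nI]; apply: c1.
- by rewrite /vproper sAB.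
split=> // [M maxM|I hI mI]; last by apply: c1 => //; [exact: mI | exact: nPBB].
have [Ms /andP[_ nML] mM] := maxM.
have [sMB|/subvPn[m mM' mB]] := boolP (M <= B)%VS.
  by have [<- //|e] := mM B Bs sMB (subvf _); case/eqP: nBL.
(* Now [M] contains an element acting on [B] as a nonzero multiple of [ad x]. So [M :&: B] is an
   ideal of L, smaller than [B], and lies in [A]; then [A + M = L] would give [B = A]. *)
have [t [b [bB em]]] := hyperplane_line m BL.
have nt : t != 0 by apply: contraNneq mB => t0; rewrite em t0 scale0r addr0.
have hMB : ideal_of br L (M :&: B).
  apply: (ideal_abelian_line abB BL (capvSr _ _)) => v; rewrite memv_cap => /andP[vM vB].
  have <- : t^-1 *: br m v = ad br x v.
    by rewrite em (brDl Hlie) (abB b v) // add0r (brZl Hlie) scalerA mulVf // scale1r adE.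
  by rewrite memvZ // memv_cap Ms //=; case: hB => _; apply; rewrite ?memvf.
have nMB : (M :&: B)%VS != B.
  apply: contra_neq nML => e; apply/eqP; rewrite eqEsubv subvf -BL subv_add -{1}e capvSl.
  rewrite -memvE -[x]scale1r -(mulVf nt) -scalerA memvZ //.
  have -> : t *: x = m - b by rewrite em addrC addKr.
  by rewrite memvB // (subvP (capvSl M B)) // e.
have sMBA := c1 _ hMB (capvSr _ _) nMB.
have [<-|e] := mM (A + M)%VS (subalg_ideal_add Hlie hA Ms (subvf _)) (addvSr _ _) (subvf _).
  exact: addvSl.
case/eqP: nAB; apply/eqP; rewrite eqEsubv sAB; apply/subvP=> c cB.
have : c \in (A + M)%VS by rewrite e memvf.
case/memv_addP=> a aA' [m' m'M ec]; rewrite ec memvD // (subvP sMBA) // memv_cap m'M.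
by rewrite -[m'](addKr a) -ec memvD ?memvN // (subvP sAB).
Qed.

End LineExtensions.

(** * The solvable classification and the converse direction *)

Section Classification.
Variables (F : fieldType) (V : vectType F) (br : V -> V -> V).
Hypothesis Hlie : is_lie_bracket br.
Hypothesis charF : [pchar F] =i pred0.
Implicit Types (u v w x y z : V) (A B C D E I J M U : {vspace V}).
Local Notation adE := (adE Hlie).
Local Notation L := (fullv : {vspace V}).

Lemma heisenberg_free x y z : br x y = z -> z != 0 -> br x z = 0 -> br y z = 0 ->
  free [:: x; y; z].
Proof.
move=> xy nz xz yz; rewrite free_cons free_cons seq1_free nz andbT span_cons !span_seq1.
apply/andP; split; apply/negP.
  case/memv_addP=> _ /vlineP[s ->] [_ /vlineP[t ->] ex]; case/eqP: nz.
  by rewrite -xy ex (brDl Hlie) !(brZl Hlie) (brxx Hlie) (brC Hlie z) yz oppr0 !scaler0 addr0.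
case/vlineP=> t ey; case/eqP: nz.
by rewrite -xy ey (brZr Hlie) xz scaler0.
Qed.

Lemma heisenberg_span_subalg x y z : br x y = z -> br x z = 0 -> br y z = 0 ->
  forall u v, u \in <<[:: x; y; z]>>%VS -> v \in <<[:: x; y; z]>>%VS ->
  exists c, br u v = c *: z.
Proof.
move=> xy xz yz u v; rewrite !span_cons span_nil addv0.
case/memv_addP=> _ /vlineP[a ->] [_ /memv_addP[_ /vlineP[b ->] [_ /vlineP[c ->] ->]] ->].
case/memv_addP=> _ /vlineP[a' ->] [_ /memv_addP[_ /vlineP[b' ->] [_ /vlineP[c' ->] ->]] ->].
exists (a * b' - b * a').
rewrite !(brDl Hlie) !(brDr Hlie) !(brZl Hlie) !(brZr Hlie) !(brxx Hlie).
rewrite (brC Hlie z x) (brC Hlie z y) (brC Hlie y x) xy xz yz !oppr0 !scaler0 !addr0 !add0r.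
by rewrite !scalerN !scalerA -scalerBl.
Qed.

(** If the span [H] were proper, the central line [<[z]>] would split off from it with a complement
    [K]. Then z = [x, y] is a bracket of elements of [K] and lies in [K]. *)
Lemma minimal_nonelem_heisenberg x y : minimal_non_elementary br ->
  br x y != 0 -> br x (br x y) = 0 -> br y (br x y) = 0 ->
  basis_of L [:: x; y; br x y].
Proof.
set z := br x y => mne nz xz yz; rewrite /basis_of (heisenberg_free (erefl z)) // andbT.
set H := <<[:: x; y; z]>>%VS; have brH := heisenberg_span_subalg (erefl z) xz yz.
have zH : z \in H by rewrite memv_span // !inE eqxx !orbT.
have xH : x \in H by rewrite memv_span // !inE eqxx.
have yH : y \in H by rewrite memv_span // !inE eqxx orbT.
have Hs : subalg br H by move=> u v uH vH; have [c ->] := brH u v uH vH; rewrite memvZ.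
apply/negPn/negP => nH; have eH := min_nonelem_proper mne Hs nH.
have cz u i : u \in H -> i \in <[z]>%VS -> br u i = 0.
  move=> uH /vlineP[t ->]; rewrite (brZr Hlie); move: uH; rewrite /H !span_cons span_nil addv0.
  case/memv_addP=> _ /vlineP[a ->] [_ /memv_addP[_ /vlineP[b ->] [_ /vlineP[c ->] ->]] ->].
  by rewrite !(brDl Hlie) !(brZl Hlie) xz yz (brxx Hlie) !scaler0 !addr0 scaler0.
have hz : ideal_of br H <[z]>%VS.
  split=> [|u i uH iz]; last by rewrite (cz u i uH iz) mem0v.
  by rewrite -memvE.
have abz : abelian br <[z]>%VS.
  by move=> a b az bz; apply: cz => //; case: hz => /subvP s _; apply: s.
have [K [Ks zK zK0]] := elementary_split Hlie eH Hs hz abz.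
case/eqP: nz; apply/eqP; rewrite -memv0 -zK0 memv_cap memv_line /=.
have : x \in (<[z]> + K)%VS by rewrite zK.
have : y \in (<[z]> + K)%VS by rewrite zK.
have sKH : {subset K <= H} by apply/subvP; rewrite -zK addvSr.
case/memv_addP=> b bz [k kK ey] /memv_addP[a az [l lK ex]].
rewrite /z ey (brDr Hlie) (cz x b xH bz) add0r ex (brDl Hlie) (brC Hlie a).
by rewrite (cz k a (sKH k kK) az) oppr0 add0r Ks.
Qed.

(** The operators [ad x], for x in a basis of L, commute on [B]; the complement is the kernel in [B]
    of an equivariant projection onto [U]. *)
Lemma invariant_complement B U : ideal_of br L B ->
  (forall x, exists2 p, separable_poly p & forall v, v \in B -> opoly (ad br x) p v = 0) ->
  (forall x y v, v \in B -> br (br x y) v = 0) ->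
  ideal_of br L U -> (U <= B)%VS ->
  exists D, [/\ ideal_of br L D, (D <= B)%VS, (U + D = B)%VS & (U :&: D = 0)%VS].
Proof.
move=> hB sepB cB hU sUB.
pose Ts := [seq ad br x | x <- vbasis L].
have [T /mapP[x _ ->]|T S v /mapP[x _ ->] /mapP[y _ ->] vB|f [fU fid fT]] :=
  @equivariant_projection F V Ts U B sUB.
- split; [exact: ideal_stable|exact: ideal_stable|exact: sepB].
- by rewrite !adE; apply/eqP; rewrite -subr_eq0 -(brJl Hlie) cB.
have fbr x v : v \in B -> f (br x v) = br x (f v).
  move=> vB; rewrite (coord_vbasis (memvf x)).
  elim/big_rec: _ => [|i u _ IH]; first by rewrite !(br0l Hlie) linear0.
  rewrite !(brDl Hlie) !(brZl Hlie) linearD linearZ /= IH; congr (_ *: _ + _).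
  rewrite -!adE fT //; apply: map_f; apply: mem_nth; by rewrite size_tuple.
have [_ HB] := hB.
exists (B :&: lker f)%VS; split.
- apply/idealP => x i; rewrite !memv_cap !memv_ker => /andP[iB /eqP fi].
  by rewrite HB ?memvf //= fbr // fi (br0r Hlie).
- exact: capvSl.
- apply/eqP; rewrite eqEsubv subv_add sUB capvSl; apply/subvP=> b bB.
  rewrite -[b](addrNK (f b)) addrC memv_add ?fU // memv_cap memv_ker.
  by rewrite memvB ?(subvP sUB _ (fU _ _)) //= linearB /= (fid (f b)) ?fU // subrr.
apply/eqP; rewrite -subv0; apply/subvP=> u; rewrite !memv_cap memv_ker.
by case/and3P=> uU uB /eqP fu; rewrite memv0 -fu fid.
Qed.

(* Otherwise L is the sum of the null component L0 of ad x and of the ideal B1 = [x, B].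
   An abelian ideal inside the Frattini ideal is complemented by a proper subalgebra of L:
   inside B1 by equivariance if it meets B1, and inside L0 if it does not. *)
Lemma minimal_nonelem_no_line : minimal_non_elementary br -> abelian br (derived br) ->
  (forall x, (derived br + <[x]>)%VS != L) ->
  forall x v, v \in derived br -> br x v = 0.
Proof.
move=> mne abB noline x v0 v0B; set B := derived br in abB noline v0B *.
have hB : ideal_of br L B by exact: derived_ideal.
have [_ HB] := hB; have xB y : stable (ad br y) B by apply: ideal_stable.
have Bs : subalg br B by apply: abelian_subalg.
have eB y : elementary br (B + <[y]>).
  by apply: min_nonelem_proper => //; apply: add_line_subalg.
have sepB y := elementary_sep Hlie charF abB (xB y) (eB y).
have cB y z v : v \in B -> br (br y z) v = 0 by apply: abB; apply: mem_derived.
have [P wP] := min_nonelem_ideal mne; have [hP mP nP] := wP.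
apply: NNPP => /eqP nxv.
have kerS : stable (ad br x) (B :&: lker (ad br x)).
  by move=> u; rewrite !memv_cap !memv_ker => /andP[uB /eqP ->]; rewrite mem0v linear0 eqxx.
have [U [sUB xU BU U0]] := ad_semisimple Hlie abB (xB x) (eB x) (capvSl _ _) kerS.
have Uk : (U :&: lker (ad br x) = 0)%VS.
  apply/eqP; rewrite -subv0 -U0; apply/subvP=> u; rewrite !memv_cap => /andP[uU ->].
  by rewrite (subvP sUB) // uU.
have xUU : (ad br x @: U)%VS = U.
  apply/eqP; rewrite eqEdim; apply/andP; split.
    by apply/subvP=> _ /memv_imgP[u uU ->]; apply: xU.
  by rewrite -{1}(limg_ker_dim (ad br x) U) Uk dimv0 add0n leqnn.
set B1 := (ad br x @: B)%VS.
have hB1 : ideal_of br L B1.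
  apply/idealP => c _ /memv_imgP[b bB ->]; rewrite adE (brJ Hlie) cB // add0r -adE.
  by apply: memv_img; apply: HB; rewrite ?memvf.
have B1U : B1 = U.
  apply/eqP; rewrite eqEsubv -{2}xUU limgS // andbT.
  apply/subvP=> _ /memv_imgP[b bB ->]; move: bB; rewrite -BU => /memv_addP[k].
  rewrite memv_cap memv_ker => /andP[_ /eqP k0] [u uU ->].
  by rewrite linearD /= k0 add0r xU.
have xinj v : v \in B1 -> br x v = 0 -> v = 0.
  by rewrite B1U => vU xv; apply/eqP; rewrite -memv0 -Uk memv_cap vU memv_ker adE xv eqxx.
have nB1 : B1 != 0%VS.
  by apply: contraNneq nxv => e; rewrite -memv0 -e -adE memv_img.
have xB1 v : v \in B1 -> br x v \in B1 by case: hB1 => _ H; apply: H; rewrite memvf.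
(* The square of [ad x] already gives the whole null component: [x, v] lies in [B], on which [ad x]
   is semisimple. *)
have [|a u v /= hu hv|L0 L0P] := @vspace_of_pred F V (fun v => br x (br x v) = 0).
- by rewrite !(br0r Hlie).
- by rewrite !(br_linr Hlie) hu hv scaler0 addr0.
have L0s : subalg br L0.
  move=> a b /L0P ha /L0P hb; apply/L0P.
  have dB y z : br y z \in B by apply: mem_derived.
  rewrite (brJ Hlie x a b) (brDr Hlie) (brJ Hlie x (br x a) b) (brJ Hlie x a (br x b)).
  by rewrite ha hb (br0l Hlie) (br0r Hlie) (abB _ _ (dB x a) (dB x b)) !addr0.
have L0B1 : (L0 :&: B1 = 0)%VS.
  apply/eqP; rewrite -subv0; apply/subvP=> v; rewrite memv_cap memv0 => /andP[/L0P vL vB].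
  by apply/eqP/(xinj _ vB)/(xinj _ (xB1 _ vB)).
have L0B1f : (L0 + B1 = L)%VS.
  apply/eqP; rewrite eqEsubv subvf; apply/subvP=> v _.
  have : br x v \in B by apply: mem_derived.
  rewrite -BU => /memv_addP[k]; rewrite memv_cap memv_ker adE => /andP[_ /eqP k0] [u uU e].
  move: uU; rewrite -xUU => /memv_imgP[u' u'U eu].
  rewrite -[v](subrK u') memv_add ?B1U //; apply/L0P.
  by rewrite (brBr Hlie) e eu adE addrK.
have nL0 : L0 != L.
  by apply: contra_neq nB1 => e; rewrite -L0B1 e capfv.
(* If [P] misses [B], then [P, P] lies in [P :&: B = 0] and [P] itself is abelian. *)
have [A [hA sAP nA abA]] : exists A, [/\ ideal_of br L A, (A <= P)%VS, A != 0%VS & abelian br A].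
  have [e|ne] := eqVneq (P :&: B)%VS 0%VS; last first.
    exists (P :&: B)%VS; split=> //; [exact: ideal_capI|exact: capvSl|].
    exact: abelianS (capvSr _ _) abB.
  exists P; split=> // a b aP bP; apply/eqP; rewrite -memv0 -e memv_cap mem_derived //.
  by case: hP => _ H; rewrite H ?memvf.
have [e|ne] := eqVneq (A :&: B1)%VS 0%VS.
  have sAL0 : (A <= L0)%VS.
    apply/subvP=> a aA; apply/L0P; apply/eqP; rewrite -memv0 -e memv_cap.
    have [_ HA] := hA; rewrite !HA ?memvf //= -adE memv_img //; exact: mem_derived.
  have hAL0 := ideal_sub hA sAL0 (subvf _).
  have [K [Ks AK AK0]] := elementary_split Hlie (min_nonelem_proper mne L0s nL0) L0s hAL0 abA.
  have Ds := subalg_ideal_add Hlie hB1 Ks (subvf _).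
  have := witness_supp wP hA sAP Ds; rewrite addvA (addvC A) -addvA AK addvC => /(_ L0B1f) eL.
  case/eqP: nA; apply/eqP; rewrite -subv0 -AK0; apply/subvP=> a aA.
  have : a \in (B1 + K)%VS by rewrite eL memvf.
  case/memv_addP=> b bB1 [k kK ea]; rewrite memv_cap aA.
  have b0 : b = 0.
    apply/eqP; rewrite -memv0 -L0B1 memv_cap bB1 andbT -[b](addrK k) -ea.
    by apply: memvB; [exact: (subvP sAL0) | rewrite -AK (subvP (addvSr _ _))].
  by rewrite ea b0 add0r.
set W := (A :&: B1)%VS in ne; have hW : ideal_of br L W by apply: ideal_capI.
have sB1B : (B1 <= B)%VS by rewrite B1U.
have sWB : (W <= B)%VS by apply: subv_trans (capvSr _ _) sB1B.
have [D [hD sDB WD WD0]] := invariant_complement hB sepB cB hW sWB.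
have hDB := ideal_capI hD hB1.
have Ds := subalg_ideal_add Hlie hDB L0s (subvf _).
have := witness_supp wP hW (subv_trans (capvSl _ _) sAP) Ds.
have -> : (W + (D :&: B1 + L0) = L)%VS.
  rewrite addvA; have -> : (W + (D :&: B1) = B1)%VS; last by rewrite addvC.
  apply/eqP; rewrite eqEsubv subv_add capvSr capvSr /=; apply/subvP=> b bB1.
  have : b \in (W + D)%VS by rewrite WD (subvP sB1B).
  case/memv_addP=> w wW [d dD eb]; rewrite eb memv_add // memv_cap dD /=.
  by rewrite -[d](addKr w) -eb memvD ?memvN // (subvP (capvSr A B1)).
move=> /(_ erefl) eL; case/eqP: ne; apply/eqP; rewrite -subv0 -WD0; apply/subvP=> w wW.
have : w \in (D :&: B1 + L0)%VS by rewrite eL memvf.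
case/memv_addP=> d; rewrite memv_cap => /andP[dD dB1] [l lL0 ew].
rewrite memv_cap wW /=; suff l0 : l = 0 by rewrite ew l0 addr0.
apply/eqP; rewrite -memv0 -L0B1 memv_cap lL0 -[l](addKr d) -ew addrC memvB //.
exact: (subvP (capvSr A B1)).
Qed.

Lemma minimal_nonelem_solvable : minimal_non_elementary br ->
  (exists n, dser br n L = 0%VS) ->
  (exists x, case_i br x) \/
  (exists x y z : V, [/\ basis_of L [:: x; y; z], br x y = z, br x z = 0 & br y z = 0]).
Proof.
move=> mne sol; have abB := derived_abelian Hlie charF mne sol.
have [P [hP mP nP]] := min_nonelem_ideal mne.
have nB : derived br != 0%VS.
  apply: contra_neq nP => e; apply: (abelian_no_frattini _ hP mP).
  by apply/(brs_abelian Hlie).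
case: (classic (exists x, derived br + <[x]> = L)%VS) => [[x BL]|nl].
  by left; exists x; apply: minimal_nonelem_case_i.
have noline x : (derived br + <[x]>)%VS != L by apply/eqP => e; apply: nl; exists x.
have triv := minimal_nonelem_no_line mne abB noline.
have [x [y nz]] : exists x y, br x y <> 0.
  apply: NNPP => H; case/eqP: nB; apply/eqP; rewrite -subv0; apply/(brs_subP Hlie) => x y _ _.
  by rewrite memv0; apply/eqP; apply: NNPP => nz; apply: H; exists x, y.
right; exists x, y, (br x y).
have xz : br x (br x y) = 0 by apply: triv; apply: mem_derived.
have yz : br y (br x y) = 0 by apply: triv; apply: mem_derived.
by split=> //; apply: minimal_nonelem_heisenberg => //; apply/eqP.
Qed.

(** A proper subalgebra [D] not inside [B] is [K + <[d]>], where K = D :&: B is an ideal of L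
    properly inside [B], hence inside [A]. Since [K] is maximal in [D], it contains the Frattini
    ideal [P] of [D], which is then an ideal of L and has an ideal complement [J] in [A]. As [J :&:
    K + <[d]>] supplements [P] in [D], it is all of [D]; so [K] lies in [J], and P = 0. *)
Lemma case_i_minimal_nonelem x : case_i br x -> minimal_non_elementary br.
Proof.
case=> BL [B0 [abB [A [fA aA nA /andP[sAB nAB] maxA]]]]; set B := derived br in BL B0 abB sAB nAB maxA.
split=> [eL|C Cs pC D Ds sDC P [hP mP _]].
  by case/eqP: nA; apply: (eL L (@subalgf _ _ br) (subvv _) A fA).
have nD : D != L.
  by apply: contraTneq pC => e; rewrite /vproper eqEsubv -e sDC e subvf andbF.
have [sDB|/subvPn[d dD dB]] := boolP (D <= B)%VS.
  by apply: abelian_no_frattini hP mP; apply: abelianS abB.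
have [t [b [bB ed]]] := hyperplane_line d BL.
have nt : t != 0 by apply: contraNneq dB => t0; rewrite ed t0 scale0r addr0.
have hD U : (U <= B)%VS -> (forall u, u \in U -> br d u \in U) -> ideal_of br L U.
  move=> sU HU; apply: (ideal_abelian_line Hlie abB BL sU) => v vU.
  have <- : t^-1 *: br d v = ad br x v.
    rewrite ed (brDl Hlie) (abB b v bB (subvP sU _ vU)) add0r (brZl Hlie) scalerA.
    by rewrite mulVf // scale1r adE.
  by rewrite memvZ // HU.
have hB : ideal_of br L B by exact: derived_ideal.
have HB c i : i \in B -> br c i \in B by case: hB => _ H; apply: H; rewrite memvf.
set K := (D :&: B)%VS.
have hK : ideal_of br L K.
  by apply: hD (capvSr _ _) _ => u; rewrite !memv_cap => /andP[uD uB]; rewrite Ds ?HB.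
have DK : (K + <[d]> = D)%VS.
  apply/eqP; rewrite eqEsubv subv_add capvSl -memvE dD /=; apply/subvP=> v vD.
  have [s [c [cB ev]]] := hyperplane_line v BL.
  have -> : v = (v - (s / t) *: d) + (s / t) *: d by rewrite subrK.
  rewrite memv_add ?memvZ ?memv_line // memv_cap memvB ?memvZ //=.
  by rewrite ev ed scalerDr scalerA divfK // opprD addrACA subrr addr0 memvB ?memvZ.
have nKB : K != B.
  apply: contra_neq nD => e; apply/eqP; rewrite eqEsubv subvf -BL subv_add -{1}e capvSl.
  rewrite -memvE -[x]scale1r -(mulVf nt) -scalerA memvZ //.
  have -> : t *: x = d - b by rewrite ed addrC addKr.
  by rewrite memvB // (subvP (capvSl D B)) // -/K e.
have sKA : (K <= A)%VS by apply: maxA => //; rewrite /vproper capvSr.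
have dK : d \notin K by rewrite memv_cap (negPf dB) andbF.
have line_cap' U : (U <= K)%VS -> (U + <[d]> = D)%VS -> U = K.
  move=> sU e; apply/eqP; rewrite eqEsubv sU; apply/subvP=> k kK.
  have : k \in (U + <[d]>)%VS by rewrite e (subvP (capvSl D B)).
  case/memv_addP=> u uU [_ /vlineP[s ->] ek].
  case: (eqVneq s 0) => [s0|ns]; first by rewrite ek s0 scale0r addr0.
  case/negP: dK; rewrite -[d]scale1r -(mulVf ns) -scalerA memvZ //.
  have -> : s *: d = k - u by rewrite ek addrC addKr.
  by rewrite memvB // (subvP sU).
have sub_line U : ideal_of br L U -> subalg br (U + <[d]>)%VS.
  by move=> hU; apply: add_line_subalg => //; [exact: ideal_subalg hU | exact: ideal_stable].
have sPD : (P <= D)%VS by case: hP.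
have sPK : (P <= K)%VS.
  apply: mP; split; first exact: ideal_subalg hK.
    by rewrite /vproper capvSl; apply: contraNneq dK => ->.
  move=> N _ sKN sND; have [dN|ndN] := boolP (d \in N).
    by right; apply/eqP; rewrite eqEsubv sND -DK subv_add sKN -memvE.
  left; apply/eqP; rewrite eqEsubv sKN andbT; apply/subvP=> v vN.
  have : v \in (K + <[d]>)%VS by rewrite DK (subvP sND).
  case/memv_addP=> k kK [_ /vlineP[s ->] ev].
  case: (eqVneq s 0) => [s0|ns]; first by rewrite ev s0 scale0r addr0.
  case/negP: ndN; rewrite -[d]scale1r -(mulVf ns) -scalerA memvZ //.
  have -> : s *: d = v - k by rewrite ev addrC addKr.
  by rewrite memvB // (subvP sKN).
have hPL : ideal_of br L P.
  apply: hD; first by apply: subv_trans sPK (capvSr _ _).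
  by case: hP => _ H u; apply: H.
have [J [hJ sJA PJ PJ0]] := asoc_complement Hlie aA hPL (subv_trans sPK sKA).
have hJK := ideal_capI hJ hK.
have e : (P + (J :&: K) = K)%VS.
  apply/eqP; rewrite eqEsubv subv_add sPK capvSr; apply/subvP=> k kK.
  have : k \in (P + J)%VS by rewrite PJ (subvP sKA).
  case/memv_addP=> p pP [j jJ ek]; rewrite ek memv_add // memv_cap jJ /=.
  by rewrite -[j](addKr p) -ek memvD ?memvN // (subvP sPK).
have := in_all_max_supp Ds hP mP (sub_line _ hJK).
rewrite addvA e DK subv_add -memvE dD (subv_trans (capvSr _ _)) ?capvSl // => /(_ isT (subvv _)) eD.
have eK := line_cap' _ (capvSr J K) eD.
apply/eqP; rewrite -subv0 -PJ0 subv_cap subvv /=; apply: subv_trans sPK _.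
by rewrite -eK capvSl.
Qed.

(** Any supplement of the central line [<[z]>] contains [x, y] = z, so this line lies in all maximal
    subalgebras. If a and b do not commute, then a, b, [a, b] are independent and span L; so proper
    subalgebras are abelian. *)
Lemma heisenberg_minimal_nonelem x y z : basis_of L [:: x; y; z] -> br x y = z ->
  br x z = 0 -> br y z = 0 -> minimal_non_elementary br.
Proof.
move=> bL xy xz yz; have [/eqP sL fr] := andP bL.
have dimL : \dim L = 3 by rewrite -sL (eqP fr).
have nz : z != 0.
  by move: fr; rewrite free_cons free_cons seq1_free => /and3P[].
have brz u v : exists c, br u v = c *: z.
  by apply: (heisenberg_span_subalg xy xz yz); rewrite sL memvf.
have cz u : br u z = 0.
  have : u \in <<[:: x; y; z]>>%VS by rewrite sL memvf.
  rewrite !span_cons span_nil addv0.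
  case/memv_addP=> _ /vlineP[a ->] [_ /memv_addP[_ /vlineP[b ->] [_ /vlineP[c ->] ->]] ->].
  by rewrite !(brDl Hlie) !(brZl Hlie) xz yz (brxx Hlie) !scaler0 !addr0.
split=> [eL|C Cs pC].
  have [P fP] := frattini_exists Hlie (@subalgf _ _ br).
  have P0 := eL L (@subalgf _ _ br) (subvv _) P fP.
  have hz : ideal_of br L <[z]>%VS.
    by apply/idealP => u _ /vlineP[t ->]; rewrite (brZr Hlie) cz scaler0 mem0v.
  case: fP => _ _ /(_ _ hz); rewrite P0 subv0 -dimv_eq0 dim_vline nz => H.
  suff /H : in_all_max br L <[z]>%VS by [].
  move=> M [Ms _ mM]; rewrite -memvE.
  have [<-|e] := mM _ (subalg_ideal_add Hlie hz Ms (subvf _)) (addvSr _ _) (subvf _).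
    by rewrite (subvP (addvSl _ _)) ?memv_line.
  have : x \in (<[z]> + M)%VS by rewrite e memvf.
  have : y \in (<[z]> + M)%VS by rewrite e memvf.
  case/memv_addP=> _ /vlineP[s ->] [m mM' ey] /memv_addP[_ /vlineP[t ->] [l lM ex]].
  rewrite -xy ey (brDr Hlie) (brZr Hlie) cz scaler0 add0r ex (brDl Hlie) (brZl Hlie).
  by rewrite (brC Hlie z) cz oppr0 scaler0 add0r Ms.
apply: abelian_elementary => a b aC bC; apply/eqP; apply: contraLR pC => nw.
have [c ew] := brz a b.
have cw u : br u (br a b) = 0 by rewrite ew (brZr Hlie) cz scaler0.
have frw := heisenberg_free (erefl (br a b)) nw (cw a) (cw b).
suff <- : C = L by rewrite /vproper eqxx andbF.
apply/eqP; rewrite eqEdim subvf dimL -[3](eqP frw) dimvS //.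
apply/span_subvP=> v; rewrite !inE => /or3P[] /eqP-> //; exact: Cs.
Qed.

End Classification.

(** * Engel's theorem *)

Definition nilpotent_op (F : fieldType) (X : vectType F) (f : 'End(X)) :=
  exists k, forall v, iter k f v = 0.

Section EndBracket.
Variables (F : fieldType) (X : vectType F).
Implicit Types (f g h : 'End(X)) (U : {vspace 'End(X)}).

Definition comm_lfun f g : 'End(X) := linfun (fun v => f (g v) - g (f v)).

Lemma comm_lfunE f g v : comm_lfun f g v = f (g v) - g (f v).
Proof.
rewrite /comm_lfun linfun_apply // => a x y.
by rewrite !linearP /= scalerDr addrACA.
Qed.

Lemma comm_lfun_lie : is_lie_bracket comm_lfun.
Proof.
split=> [a u v w|a u v w|u|u v w]; apply/lfunP => x.
- by rewrite add_lfunE scale_lfunE !comm_lfunE !add_lfunE !scale_lfunE !linearP /= scalerDr addrACA.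
- by rewrite add_lfunE scale_lfunE !comm_lfunE !add_lfunE !scale_lfunE !linearP /= scalerDr addrACA.
- by rewrite comm_lfunE subrr zero_lfunE.
rewrite !add_lfunE zero_lfunE !comm_lfunE !linearB /= !opprK !addrA.
set a := u (v (w x)); set b := u (w (v x)); set c := v (w (u x)).
set d := w (v (u x)); set e := v (u (w x)); set k := w (u (v x)).
rewrite (addrAC _ (- c) d) subrK (addrAC _ (- k) b) subrK (addrAC _ (- e) b).
by rewrite (addrAC _ d b) subrK (addrAC _ (- e) (- d)) addrK (addrAC a) subrr add0r addNr.
Qed.

(** (ad f)^m g is a combination of the products f^i g f^j with i + j = m; for m = 2k each has a
    vanishing factor. *)
Lemma ad_nilpotent f : nilpotent_op f -> nilpotent_op (ad comm_lfun f).
Proof.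
case=> k fk; exists (k + k)%N => g.
pose pw i : 'End(X) := linfun (iter i f).
have pwE i v : pw i v = iter i f v by rewrite /pw linfun_apply //; apply: iter_lin.
(* Quantifying over every subspace [U] that contains these products replaces the binomial expansion:
   the induction step passes to the preimage of [U] under [ad f]. *)
have key m : forall U, (forall i j, (i + j = m)%N -> (pw i \o (g \o pw j))%VF \in U) ->
    iter m (ad comm_lfun f) g \in U.
  elim: m => [|m IH] U HU.
    have := HU 0%N 0%N erefl; congr (_ \in U); apply/lfunP => v.
    by rewrite !comp_lfunE !pwE.
  rewrite iterS; have := IH (ad comm_lfun f @^-1: U)%VS.
  rewrite -memv_preim; apply=> i j ij; rewrite -memv_preim (adE comm_lfun_lie).
  have -> : comm_lfun f (pw i \o (g \o pw j))%VF =
    (pw i.+1 \o (g \o pw j))%VF - (pw i \o (g \o pw j.+1))%VF.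
    apply/lfunP => v; rewrite comm_lfunE add_lfunE opp_lfunE !comp_lfunE !pwE /=.
    by rewrite -iterSr.
  by rewrite memvB // HU //; lia.
apply/eqP; rewrite -memv0; apply: key => i j ij.
have [le_k|lt_k] := leqP k i; rewrite memv0; apply/eqP/lfunP => v; rewrite !comp_lfunE !pwE zero_lfunE.
  rewrite -(subnK le_k) iterD fk; elim: (_ - _)%N => //= n ->; exact: linear0.
have le_j : (k <= j)%N by lia.
rewrite -(subnK le_j) iterD fk.
have -> : iter (j - k) f 0 = 0 by elim: (_ - _)%N => //= n ->; exact: linear0.
by rewrite linear0; elim: (i) => //= n ->; exact: linear0.
Qed.

End EndBracket.

Section AdHom.
Variables (F : fieldType) (V : vectType F) (br : V -> V -> V).
Hypothesis Hlie : is_lie_bracket br.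

Definition adhom : 'Hom(V, 'End(V)) := linfun (ad br).

Lemma adhomE x : adhom x = ad br x.
Proof.
rewrite /adhom linfun_apply // => a u v; apply/lfunP => w.
by rewrite add_lfunE scale_lfunE !adE // (brDl Hlie) (brZl Hlie).
Qed.

Lemma ad_br x y : ad br (br x y) = comm_lfun (ad br x) (ad br y).
Proof. by apply/lfunP => v; rewrite comm_lfunE !adE // (brJl Hlie). Qed.

End AdHom.

(** A quotient-free form: a common null vector of [D] on N / K. The induction needs it, being
    applied to [ad H] on D / H for a proper subalgebra [H] of largest dimension. This yields [y]
    normalising [H] with D = H + Fy, and [y] acts nilpotently on the vectors of [N] that [H] sends
    into [K]. *)
Lemma engel (F : fieldType) d (X : vectType F) (D : {vspace 'End(X)}) (K N : {vspace X}) :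
  (\dim D <= d)%N -> subalg (@comm_lfun F X) D -> (forall f, f \in D -> nilpotent_op f) ->
  (forall f, f \in D -> stable f K /\ stable f N) -> vproper K N ->
  exists v, [/\ v \in N, v \notin K & forall f, f \in D -> f v \in K].
Proof.
elim: d X D K N => [|d IH] X D K N dD Ds nilD KN /andP[sKN nKN].
  have D0 : D = 0%VS by apply/eqP; rewrite -dimv_eq0 -leqn0.
  have /subvPn[v vN vK] : ~~ (N <= K)%VS by apply: contra nKN => s; rewrite eqEsubv sKN.
  exists v; split=> // f; rewrite D0 memv0 => /eqP->; by rewrite zero_lfunE mem0v.
have [le_d|lt_d] := leqP (\dim D) d.
  by apply: (IH X D K N) => //; rewrite /vproper sKN.
have L := @comm_lfun_lie F X; set lb := @comm_lfun F X in L Ds.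
have [|H [Hs pH] maxH] := @dim_max F _ (fun H => subalg lb H /\ vproper H D) 0%VS.
  split; first by move=> a b /[!memv0] /eqP-> _; rewrite (br0l L).
  rewrite /vproper sub0v; apply: contraTneq lt_d => <-; by rewrite dimv0.
have dH : (\dim H <= d)%N by rewrite -ltnS; apply: leq_trans (vproper_dim pH) dD.
have sHD : (H <= D)%VS by case/andP: pH.
have [y [yD yH Hy]] : exists y, [/\ y \in D, y \notin H & forall h, h \in H -> lb h y \in H].
  have [|_ _ /memv_imgP[f fH ->] /memv_imgP[g gH ->]|_ /memv_imgP[f fH ->]|_ /memv_imgP[f fH ->]||y [yD yH Hy]] :=
    IH _ (adhom lb @: H)%VS H D.
  - by apply: leq_trans dH; rewrite -(limg_ker_dim (adhom lb) H) leq_addl.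
  - by rewrite !adhomE // -ad_br // -adhomE // memv_img // Hs.
  - by rewrite adhomE //; apply: ad_nilpotent; apply: nilD; apply: (subvP sHD).
  - rewrite adhomE //; split=> g; rewrite adE // => gH; first exact: Hs.
    by apply: Ds => //; apply: (subvP sHD).
  - exact: pH.
  exists y; split=> // h hH; rewrite -(adE L) -adhomE //; apply: Hy; exact: memv_img.
have DHy : D = (H + <[y]>)%VS.
  have sub : (H + <[y]> <= D)%VS by rewrite subv_add sHD -memvE.
  apply/eqP; rewrite eqEsubv sub andbT; apply: contraT => nD.
  have : (\dim (H + <[y]>) <= \dim H)%N.
    apply: maxH; split; last by rewrite /vproper sub eqEsubv negb_and nD orbT.
    move=> _ _ /memv_addP[a aH [_ /vlineP[s ->] ->]] /memv_addP[b bH [_ /vlineP[t ->] ->]].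
    rewrite (subvP (addvSl _ _)) // (brDl L) !(brDr L) !(brZl L) !(brZr L) (brxx L).
    rewrite !scaler0 addr0 !memvD ?memvZ //; [exact: Hs|exact: Hy|].
    by rewrite (brC L) memvN Hy.
  rewrite leqNgt; case/negP; apply: vproper_dim; rewrite /vproper addvSl.
  by apply: contraNneq yH => ->; rewrite (subvP (addvSr _ _)) ?memv_line.
have [|a u v /= [uN hu] [vN hv]|N' N'P] :=
  @vspace_of_pred F X (fun v => v \in N /\ forall h, h \in H -> h v \in K).
- by split=> [|h _]; rewrite ?linear0 mem0v.
- by split=> [|h hH]; rewrite ?linearP memvD ?memvZ ?hu ?hv.
have [v0 [v0N v0K v0H]] : exists v, [/\ v \in N, v \notin K & forall h, h \in H -> h v \in K].
  apply: (IH X H K N) => //; last by rewrite /vproper sKN.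
    by move=> f fH; apply: nilD; apply: (subvP sHD).
  by move=> f fH; apply: KN; apply: (subvP sHD).
have yN' v : v \in N' -> y v \in N'.
  move=> /N'P[vN vH]; apply/N'P; split=> [|h hH]; first by case: (KN y yD) => _; apply.
  have : lb h y v \in K by apply: vH; apply: Hy.
  rewrite comm_lfunE => e; rewrite -[h _](subrK (y (h v))) memvD //.
  by case: (KN y yD) => Ky _; apply: Ky; apply: vH.
have [k yk] := nilD y yD.
have ex : exists m, iter m y v0 \in K by exists k; rewrite yk mem0v.
(* The vector sought is the last iterate of [y] on [v0] outside [K]. *)
case: (ex_minnP ex) => -[|m] mK minm; first by rewrite mK in v0K.
have itN' i : iter i y v0 \in N' by elim: i => [|i IHi]; [apply/N'P | apply: yN'].
have [vN vH] := (N'P _).1 (itN' m).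
exists (iter m y v0); split=> //; first by apply/negP => /minm; rewrite ltnn.
move=> f; rewrite DHy => /memv_addP[h hH [_ /vlineP[t ->] ->]].
by rewrite add_lfunE scale_lfunE memvD ?vH // memvZ.
Qed.

(** * Cartan's criterion *)

Lemma irreducible_factor (F : fieldType) (p : {poly F}) : (1 < size p)%N ->
  exists2 q, irreducible_poly q & q %| p.
Proof.
move=> sp; have [|q [sq qp] minq] := @nat_min {poly F} (fun q => size q)
  (fun q => (1 < size q)%N /\ q %| p) p; first by rewrite dvdpp.
have q0 : q != 0 by rewrite -size_poly_gt0 ltnW.
exists q => //; split=> // d sd dq; rewrite -dvdp_size_eqp // eqn_leq dvdp_leq //=.
apply: minq; split; last exact: dvdp_trans dq qp.
have : (0 < size d)%N by rewrite size_poly_gt0; apply: contraTneq dq => ->; rewrite dvd0p.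
by case: (size d) sd => [|[]].
Qed.

(** One root is adjoined at a time; the constant [c] is 0 when p = 0. *)
Lemma splitting_field_exists n : forall (F : fieldType) (p : {poly F}), (size p <= n)%N ->
  exists (K : fieldType) (iota : {rmorphism F -> K}) (c : K) (rs : seq K),
    map_poly iota p = c *: \prod_(r <- rs) ('X - r%:P).
Proof.
elim: n => [|n IH] F p sp.
  exists F, idfun, 0, [::]; rewrite (eqP (_ : p == 0)) ?map_poly0 ?scale0r //.
  by rewrite -size_poly_leq0.
have [le1|gt1] := leqP (size p) 1.
  exists F, idfun, p`_0, [::].
  by rewrite big_nil map_poly_id // [p in LHS]size1_polyC // -mul_polyC mulr1.
have [q irq qp] := irreducible_factor gt1.
have [L _ [z rz _]] := irredp_FAdjoin irq.
have : root (map_poly (in_alg L) p) z.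
  by apply: root_dvdp rz; rewrite dvdp_map.
case/factor_theorem=> p1 ep.
have p0 : p != 0 by rewrite -size_poly_gt0 ltnW.
have p10 : p1 != 0.
  by apply: contraNneq p0 => e; rewrite -(map_poly_eq0 (in_alg L)) ep e mul0r.
have sp1 : (size p1 <= n)%N.
  have : size (p1 * ('X - z%:P)) = size p by rewrite -ep size_map_poly.
  by rewrite size_mul ?polyXsubC_eq0 // size_XsubC addn2 /= => e; rewrite -ltnS e.
have [K [iota [c [rs e]]]] := IH L p1 sp1.
exists K, (iota \o in_alg L), c, (iota z :: rs).
by rewrite map_poly_comp ep rmorphM /= e map_polyXsubC big_cons -scalerAl mulrC.
Qed.

Section MatrixTraces.
Variable K : fieldType.

(** With the rank factorisation A = C R, tr A = tr (R C). From C (R C)^k R = A^(k+1) = 0 the outer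
    factors cancel, so R C has a smaller exponent. *)
Lemma mxtrace_nilpotent n (A : 'M[K]_n) k : A ^+ k = 0 -> \tr A = 0.
Proof.
elim: k n A => [|k IH] n A Ak; first by rewrite -[A]mulr1 -(expr0 A) Ak mulr0 raddf0.
rewrite -(mulmx_base A) mxtrace_mulC; apply: IH.
set C := col_base A; set R := row_base A.
have e j : (C *m R) ^+ j.+1 = C *m (R *m C) ^+ j *m R.
  elim: j => [|j IHj]; first by rewrite expr1 expr0 mulmx1.
  by rewrite exprS IHj -[(C *m R) * _]/((C *m R) *m _) exprS !mulmxA.
have := e k; rewrite mulmx_base Ak => /esym e0.
apply: (row_full_inj (col_base_full A)); apply: (row_free_inj (row_base_free A)).
by rewrite mulmx0 mul0mx.
Qed.

Lemma mxtrace_idempotent n (A : 'M[K]_n) : A *m A = A -> \tr A = (\rank A)%:R.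
Proof.
move=> AA; rewrite -{1}(mulmx_base A) mxtrace_mulC.
suff -> : row_base A *m col_base A = 1%:M by rewrite mxtrace1.
apply: (row_full_inj (col_base_full A)); apply: (row_free_inj (row_base_free A)).
move: (mulmx_base A); move: (col_base A) (row_base A) => C R e.
by rewrite mulmxA e -mulmxA e mulmx1 e AA.
Qed.

End MatrixTraces.

Section ChineseRemainder.
Variable K : fieldType.
Implicit Types (s : seq K) (h : {poly K}).

Definition factors N s : {poly K} := \prod_(a <- s) ('X - a%:P) ^+ N.

Lemma factors_coprime N s a : a \notin s -> coprimep (('X - a%:P) ^+ N) (factors N s).
Proof.
rewrite /factors; elim: s => [|b s IH]; first by rewrite big_nil coprimep1.
rewrite inE negb_or big_cons coprimepMr => /andP[ab /IH ->]; rewrite andbT.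
by apply: coprimep_expl; apply: coprimep_expr; apply: coprimep_XsubC2; rewrite subr_eq0 eq_sym.
Qed.

Lemma factors_dvd N s h : uniq s -> (forall a, a \in s -> ('X - a%:P) ^+ N %| h) ->
  factors N s %| h.
Proof.
elim: s => [|a s IH] /=; first by rewrite /factors big_nil dvd1p.
case/andP=> nas us H; rewrite /factors big_cons Gauss_dvdp ?factors_coprime // H ?mem_head //=.
by apply: IH => // b bs; apply: H; rewrite inE bs orbT.
Qed.

Lemma chinese_poly N s (psi : K -> K) : uniq s ->
  exists r, forall a, a \in s -> ('X - a%:P) ^+ N %| r - (psi a)%:P.
Proof.
elim: s => [|a s IH] /=; first by exists 0.
case/andP=> nas us; have [r Hr] := IH us.
have /Bezout_coprimepP[[u v] /= /eqpf_eq[c nzc e]] := factors_coprime N nas.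
pose w := r - (psi a)%:P.
exists (r - c^-1 *: (w * v * factors N s)) => b; rewrite inE => /predU1P[->|bs].
  rewrite addrAC -/w; have {1}-> : w = c^-1 *: (w * (u * ('X - a%:P) ^+ N + v * factors N s)).
    by rewrite e -scalerAr mulr1 scalerA mulVf // scale1r.
  by rewrite mulrDr scalerDr !mulrA addrK dvdpZr ?invr_eq0 // dvdp_mull.
rewrite addrAC dvdp_sub ?Hr // dvdpZr ?invr_eq0 // dvdp_mull //.
by rewrite /factors (big_rem b) //= dvdp_mulr.
Qed.

End ChineseRemainder.

Section IntegerFunctional.
Variable K : fieldType.
Hypothesis charK : [pchar K] =i pred0.

Lemma intr_eq0_char0 (z : int) : (z%:~R == 0 :> K) = (z == 0).
Proof.
have N n : (n.+1%:R == 0 :> K) = false by move/pcharf0P: charK => ->.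
by case: z => [[|n]|n]; rewrite ?eqxx // ?NegzE ?mulrNz ?oppr_eq0 -pmulrn N.
Qed.

(* The values on s of a nonzero additive map from the subgroup spanned by s to the integers. *)
Lemma integer_functional (s : seq K) : uniq s -> (exists2 a, a \in s & a != 0) ->
  exists phi : K -> int, (exists2 a, a \in s & phi a != 0) /\
    forall c : K -> int, \sum_(a <- s) (c a)%:~R * a = 0 -> \sum_(a <- s) c a * phi a = 0.
Proof.
have [n] := ubnP (size s); elim: n s => // n IH s sn us [a0 a0s a0nz].
case: (classic (forall c : K -> int, \sum_(a <- s) (c a)%:~R * a = 0 ->
    forall a, a \in s -> c a = 0)) => [H|].
  exists (fun=> 1); split; first by exists a0.
  by move=> c /H c0; rewrite big_seq big1 // => a /c0 ->; rewrite mul0r.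
move=> /(not_all_ex_not _ _) [c H1]; have [c0 H2] := imply_to_and _ _ H1.
have [b H3] := not_all_ex_not _ _ H2; have [bs /eqP nb] := imply_to_and _ _ H3.
have usb : uniq (rem b s) by apply: rem_uniq.
have bb : b \notin rem b s by rewrite mem_rem_uniq // inE eqxx.
have sub a : a \in rem b s -> a \in s by apply: mem_rem.
have cb : (c b)%:~R * b = - \sum_(a <- rem b s) (c a)%:~R * a.
  by apply/eqP; rewrite -addr_eq0; have := c0; rewrite (big_rem b) //= => ->.
have [||phi [[a1 a1s p1] Hphi]] := IH (rem b s) _ usb.
- rewrite size_rem //; case: (s) bs sn => //= ? ? _; lia.
- apply: NNPP => H; have z a : a \in rem b s -> a = 0.
    by move=> ar; apply: NNPP => /eqP nza; apply: H; exists a.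
  have b0 : b = 0.
    apply/eqP; move/eqP: cb; rewrite big_seq big1 ?oppr0 ?mulf_eq0 ?intr_eq0_char0 ?(negPf nb) //.
    by move=> a /z ->; rewrite mulr0.
  case/eqP: a0nz; have [->|nab] := eqVneq a0 b; first exact: b0.
  by apply: z; rewrite mem_rem_uniq // inE nab.
(* The relation [cb] prescribes the value at [b] only up to the factor [c b]; all values are
   multiplied by [c b] to stay integral. *)
exists (fun a => if a == b then - \sum_(a <- rem b s) c a * phi a else c b * phi a).
split.
  exists a1; first exact: sub.
  have /negPf -> : a1 != b by apply/eqP => e; rewrite e (negPf bb) in a1s.
  by rewrite mulf_neq0.
move=> d d0; rewrite (big_rem b) //= eqxx.
rewrite [X in _ + X](eq_big_seq (fun a => d a * (c b * phi a))); last first.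
  by move=> a ar /=; case: (eqVneq a b) => [e|_] //; rewrite e (negPf bb) in ar.
rewrite mulrN mulr_sumr -sumrN -big_split /=.
have rel (f : K -> int) : \sum_(a <- s) (f a)%:~R * a = 0 ->
    \sum_(a <- rem b s) (f a)%:~R * a = - ((f b)%:~R * b).
  by rewrite (big_rem b) //= addrC => /eqP; rewrite addr_eq0 => /eqP.
(* The combination of the relations [d] and [c] in which the coefficient of [b] cancels. *)
have /Hphi e : \sum_(a <- rem b s) (c b * d a - d b * c a)%:~R * a = 0.
  transitivity ((c b)%:~R * (\sum_(a <- rem b s) (d a)%:~R * a) -
                (d b)%:~R * \sum_(a <- rem b s) (c a)%:~R * a).
    rewrite !mulr_sumr -sumrB; apply: eq_bigr => a _.
    by rewrite rmorphB !rmorphM /=; ring.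
  by rewrite !rel //; ring.
by rewrite -[RHS]e; apply: eq_bigr => a _; ring.
Qed.

(** The equality of differences is itself an integer relation on [s]. Its coefficient function [c]
    adds indicators, which also covers coincidences among the four elements. *)
Lemma integer_functional_sub (s : seq K) (phi : K -> int) : uniq s ->
  (forall c : K -> int, \sum_(a <- s) (c a)%:~R * a = 0 -> \sum_(a <- s) c a * phi a = 0) ->
  forall a b a' b', a \in s -> b \in s -> a' \in s -> b' \in s -> a - b = a' - b' ->
  phi a - phi b = phi a' - phi b'.
Proof.
move=> us H a b a' b' as_ bs as' bs' e.
have E (M : comRingType) (f : K -> M) x : x \in s -> \sum_(y <- s) (y == x)%:R * f y = f x.
  move=> xs; rewrite (big_rem x) //= eqxx mul1r big_seq big1 ?addr0 // => y.
  by rewrite mem_rem_uniq // inE => /andP[/negPf -> _]; rewrite mul0r.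
pose c x : int := (x == a)%:R - (x == b)%:R - (x == a')%:R + (x == b')%:R.
have S (M : comRingType) (f : K -> M) :
    \sum_(x <- s) (c x)%:~R * f x = f a - f b - f a' + f b'.
  rewrite -(E M f a) // -(E M f b) // -(E M f a') // -(E M f b') //.
  rewrite -!sumrB -big_split /=; apply: eq_bigr => x _.
  by rewrite /c rmorphD !rmorphB /= !rmorph_nat; ring.
have hK : \sum_(x <- s) (c x)%:~R * x = 0 by rewrite (S K id) /= e; ring.
have := S int phi; rewrite (eq_bigr (fun x => c x * phi x)) => [|x _]; last by rewrite intz.
by rewrite (H c hK) => h; apply/eqP; rewrite -subr_eq0 [X in _ == X]h; apply/eqP; ring.
Qed.

End IntegerFunctional.

Lemma seq_choice (T : eqType) (U : Type) (R : T -> U -> Prop) (s : seq T) :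
  (forall a, exists u, R a u) -> U -> exists f, forall a, a \in s -> R a (f a).
Proof.
move=> H u0; elim: s => [|b s [f Hf]]; first by exists (fun=> u0).
have [u Hu] := H b; exists (fun a => if a == b then u else f a) => a.
by rewrite inE; case: (eqVneq a b) => [->|_] //= /Hf.
Qed.

Section SpectralProjections.
Variables (K : fieldType) (m : nat) (A : 'M[K]_m.+1) (s : seq K) (N : nat).
Hypotheses (us : uniq s) (As : horner_mx A (factors N s) = 0).
Implicit Types (p : {poly K}) (psi : K -> K).

Lemma horner_mx_eq p q : (forall a, a \in s -> ('X - a%:P) ^+ N %| p - q) ->
  horner_mx A p = horner_mx A q.
Proof.
move=> H; apply/eqP; rewrite -subr_eq0 -rmorphB.
have /dvdpP[h ->] := factors_dvd us H.
by rewrite rmorphM /= As mulr0.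
Qed.

Lemma spectral_projections : exists P : K -> 'M[K]_m.+1,
  [/\ \sum_(a <- s) P a = 1, forall a, a \in s -> P a * P a = P a,
      forall a, a \in s -> (A - a%:M) ^+ N * P a = 0,
      forall a, P a * A = A * P a &
      forall psi, exists q, forall a, a \in s ->
        horner_mx A q * P a = psi a *: P a /\ P a * horner_mx A q = psi a *: P a].
Proof.
have [e He] := @seq_choice _ _ (fun a e => forall b, b \in s ->
  ('X - b%:P) ^+ N %| e - ((b == a)%:R : K)%:P) s
  (fun a => chinese_poly N (fun b => (b == a)%:R) us) 0.
have e1 a : a \in s -> ('X - a%:P) ^+ N %| e a - 1.
  by move=> as_; have := He a as_ a as_; rewrite eqxx.
have e0 a b : a \in s -> b \in s -> b != a -> ('X - b%:P) ^+ N %| e a.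
  by move=> as_ bs /negPf ba; have := He a as_ b bs; rewrite ba subr0.
exists (fun a => horner_mx A (e a)); split.
- rewrite -rmorph_sum -(rmorph1 (horner_mx A)); apply: horner_mx_eq => b bs /=.
  rewrite (big_rem b) //= addrAC dvdp_add ?e1 // big_seq.
  elim/big_ind: _ => [|p q|a]; [exact: dvdp0 | exact: dvdp_add|].
  rewrite mem_rem_uniq // inE => /andP[ab as_]; apply: e0 => //; by rewrite eq_sym.
- move=> a as_; rewrite -rmorphM; apply: horner_mx_eq => b bs.
  rewrite -{3}[e a]mulr1 -mulrBr; have [->|ba] := eqVneq b a; first by rewrite dvdp_mull ?e1.
  by rewrite dvdp_mulr ?e0.
- move=> a as_; have -> : A - a%:M = horner_mx A ('X - a%:P).
    by rewrite rmorphB /= horner_mx_X horner_mx_C.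
  rewrite -rmorphXn -rmorphM -(rmorph0 (horner_mx A)); apply: horner_mx_eq => b bs.
  rewrite subr0; have [->|ba] := eqVneq b a; first by rewrite dvdp_mulr.
  by rewrite dvdp_mull ?e0.
- by move=> a; rewrite -{2 3}[A]horner_mx_X -!rmorphM mulrC.
move=> psi; have [q Hq] := chinese_poly N psi us; exists q => a as_.
  suff E : horner_mx A (q * e a) = psi a *: horner_mx A (e a).
    by split; rewrite -rmorphM; last rewrite mulrC.
  rewrite -linearZ; apply: horner_mx_eq => b bs /=.
  rewrite -mul_polyC -mulrBl; have [->|ba] := eqVneq b a; first by rewrite dvdp_mulr ?Hq.
  by rewrite dvdp_mull ?e0.
Qed.

End SpectralProjections.

Definition mxcomm (K : fieldType) n (A B : 'M[K]_n) := A *m B - B *m A.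

Lemma mxcomm_linear (K : fieldType) n (A : 'M[K]_n) a u v :
  mxcomm A (a *: u + v) = a *: mxcomm A u + mxcomm A v.
Proof.
by rewrite /mxcomm mulmxDr mulmxDl -scalemxAr -scalemxAl scalerBr opprD addrACA.
Qed.

(* On P_a y P_b the operator [A, -] has the single generalised eigenvalue a - b,
   so a polynomial in [A, -] acts there as a scalar. *)
Lemma opoly_mxcomm (K : fieldType) m (A z : 'M[K]_m.+1) a b N r c :
  (A - a%:M) ^+ N * z = 0 -> z * (A - b%:M) ^+ N = 0 ->
  ('X - (a - b)%:P) ^+ (N + N) %| r - c%:P ->
  opoly (linfun (mxcomm A)) r z = c *: z.
Proof.
move=> Az zA /dvdpP[h eh].
have -> : r = h * ('X - (a - b)%:P) ^+ (N + N) + c%:P by rewrite -eh subrK.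
set T := linfun (mxcomm A).
have TE w : T w = A * w - w * A by rewrite /T linfun_apply //; apply: mxcomm_linear.
rewrite opolyD opolyC opolyM.
suff -> : opoly T (('X - (a - b)%:P) ^+ (N + N)) z = 0 by rewrite linear0 add0r.
(* As in [ad_nilpotent]: powers of [A, -] - (a - b) at [z] are combinations of (A - a)^i z (A -
   b)^j, and for i + j = 2N one factor annihilates [z]. *)
have key k : forall U : {vspace 'M[K]_m.+1}, (forall i j, (i + j = k)%N ->
    (A - a%:M) ^+ i * z * (A - b%:M) ^+ j \in U) -> opoly T (('X - (a - b)%:P) ^+ k) z \in U.
  elim: k => [|k IH] U HU.
    have := HU 0%N 0%N erefl; rewrite !expr0 mul1r mulr1.
    by rewrite -[X in opoly _ X]/(1%:P) opolyC scale1r.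
  rewrite exprS opolyM; set Q := opoly T _.
  have QE w : Q w = (A - a%:M) * w - w * (A - b%:M).
    rewrite /Q opolyD opolyX -polyCN opolyC TE mulrBl mulrBr.
    rewrite -[a%:M * w]/(a%:M *m w) mul_scalar_mx -[w * b%:M]/(w *m b%:M) mul_mx_scalar.
    by rewrite !opprB scalerBl addrACA [RHS]addrACA [- _ + _]addrC.
  have := IH (Q @^-1: U)%VS; rewrite -memv_preim; apply=> i j ij; rewrite -memv_preim QE.
  rewrite !mulrA -exprS -[_ * _ * (A - b%:M)]mulrA -exprSr.
  by rewrite memvB // HU //; lia.
apply/eqP; rewrite -memv0; apply: key => i j ij; rewrite memv0.
have [le_N|lt_N] := leqP N i.
  by rewrite -(subnK le_N) exprD -[_ * _ * z]mulrA Az mulr0 mul0r.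
have le_j : (N <= j)%N by lia.
by rewrite -(subnKC le_j) exprD -mulrA [z * _]mulrA zA mul0r mulr0.
Qed.

Lemma span_pred (F : fieldType) (V : vectType F) (X : seq V) (Q : V -> Prop) :
  Q 0 -> (forall a u v, Q u -> Q v -> Q (a *: u + v)) -> (forall x, x \in X -> Q x) ->
  forall v, v \in <<X>>%VS -> Q v.
Proof.
move=> Q0 QL QX v vX; have [U UP] := vspace_of_pred Q0 QL.
by apply/UP; apply: (subvP _ v vX); apply/span_subvP => x /QX /UP.
Qed.

(* D multiplies the generalised eigenspace of A for a by phi a. As phi is additive, [D, -]
   is a polynomial in [A, -] and preserves I, so tr (A D) = \sum m_a phi(a) a vanishes;
   applying phi once more gives \sum m_a phi(a)^2 = 0. *)
Lemma cartan_trace (K : fieldType) (charK : [pchar K] =i pred0) m (A : 'M[K]_m.+1)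
    (I : {vspace 'M[K]_m.+1}) (rs : seq K) :
  (forall y, y \in I -> mxcomm A y \in I) ->
  (forall D : 'M[K]_m.+1, (forall y, y \in I -> mxcomm D y \in I) -> \tr (A *m D) = 0) ->
  char_poly A %| \prod_(r <- rs) ('X - r%:P) -> A ^+ size rs = 0.
Proof.
move=> AI trA chA; set s := undup rs; set N := size rs.
have us : uniq s by apply: undup_uniq.
have As : horner_mx A (factors N s) = 0.
  have /dvdpP[h eh] : char_poly A %| factors N s.
    apply: dvdp_trans chA _; rewrite -(big_undup_iterop_count _ rs) /factors.
    elim/big_ind2: _ => [|p1 q1 p2 q2|a _]; [exact: dvdpp | exact: dvdp_mul |].
    by apply: dvdp_exp2l; apply: count_size.
  by rewrite eh rmorphM /= Cayley_Hamilton mulr0.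
have [P [P1 PP PA Pc Pq]] := spectral_projections us As.
case: (classic (exists2 a, a \in s & P a != 0 /\ a != 0)) => [[a0 a0s [Pa0 a0nz]]|nz]; last first.
  have -> : A ^+ N = \sum_(a <- s) A ^+ N * P a by rewrite -mulr_sumr P1 mulr1.
  rewrite big_seq big1 // => a as_; have [->|Pa] := eqVneq (P a) 0; first by rewrite mulr0.
  have a0 : a = 0 by apply: NNPP => /eqP na; apply: nz; exists a.
  by have := PA a as_; rewrite a0 raddf0 subr0.
(* The list may contain more than the spectrum; dropping the rest makes every multiplicity
   [\rank (P a)] positive at the end. *)
pose s' := [seq a <- s | P a != 0].
have us' : uniq s' by apply: filter_uniq.
have ss' a : a \in s' -> a \in s by rewrite mem_filter => /andP[].
have [|phi [[a1 a1s p1] Hphi]] := integer_functional charK us'.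
  by exists a0 => //; rewrite mem_filter Pa0.
have Hsub := integer_functional_sub us' Hphi.
have sum' (M : zmodType) (G : K -> M) : (forall a, P a = 0 -> G a = 0) ->
    \sum_(a <- s) G a = \sum_(a <- s') G a.
  move=> G0; rewrite big_filter [LHS](bigID (fun a => P a != 0)) /= [X in _ + X]big1 ?addr0 //.
  by move=> a /negPn /eqP /G0.
have P1' : \sum_(a <- s') P a = 1 by rewrite -P1 -sum'.
have [q Hq] := Pq (fun a => (phi a)%:~R); set D := horner_mx A q in Hq.
(* The eigenvalue of [D, -] as a function of that of [A, -]. It is well defined on differences by
   [Hsub]; the default 0 is used only elsewhere. *)
pose psi (c : K) : K :=
  if [pick ij : 'I_(size s') * 'I_(size s') | s'`_ij.1 - s'`_ij.2 == c] is Some ij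
  then (phi s'`_ij.1 - phi s'`_ij.2)%:~R else 0.
have psiE a b : a \in s' -> b \in s' -> psi (a - b) = (phi a - phi b)%:~R.
  move=> as_ bs; rewrite /psi; case: pickP => [[i j] /= /eqP e|].
    by congr (_%:~R); apply: Hsub => //; apply: mem_nth.
  have ia : (index a s' < size s')%N by rewrite index_mem.
  have ib : (index b s' < size s')%N by rewrite index_mem.
  by move/(_ (Ordinal ia, Ordinal ib)) => /=; rewrite !nth_index // eqxx.
have [r Hr] := chinese_poly (N + N) psi (undup_uniq [seq a - b | a <- s', b <- s']).
have DI y : y \in I -> mxcomm D y \in I.
  move=> yI; have <- : opoly (linfun (mxcomm A)) r y = mxcomm D y.
    have dec : y = \sum_(a <- s') \sum_(b <- s') P a * y * P b.
      rewrite -[LHS]mulr1 -[LHS]mul1r -P1' mulr_suml; apply: eq_bigr => a _.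
      by rewrite mulrA mulr_sumr.
    have mD z : linfun (mxcomm D) z = mxcomm D z.
      by rewrite linfun_apply //; apply: mxcomm_linear.
    rewrite -mD [in LHS]dec [in RHS]dec !linear_sum big_seq [RHS]big_seq; apply: eq_bigr => a as_.
    rewrite !linear_sum big_seq [RHS]big_seq; apply: eq_bigr => b bs /=.
    rewrite (@opoly_mxcomm _ _ A _ a b N r (psi (a - b))).
    - rewrite mD psiE // /mxcomm -![_ *m _]/(_ * _).
      rewrite [D * _]mulrA [D * _]mulrA (Hq a (ss' a as_)).1 -!mulrA (Hq b (ss' b bs)).2.
      by rewrite -!scalerAl -!scalerAr -scalerBl intrB.
    - by rewrite !mulrA PA ?ss' // !mul0r.
    - have cPA j : P b * (A - b%:M) ^+ j = (A - b%:M) ^+ j * P b.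
        elim: j => [|j IH]; first by rewrite !expr0 mulr1 mul1r.
        rewrite exprSr mulrA IH -!mulrA; congr (_ * _); rewrite mulrBr mulrBl Pc.
        by rewrite -[P b * b%:M]/(P b *m b%:M) mul_mx_scalar -[b%:M * P b]/(b%:M *m P b) mul_scalar_mx.
      by rewrite -mulrA cPA PA ?ss' // mulr0.
    by apply: Hr; rewrite mem_undup; apply: allpairs_f.
  apply: opoly_stable => // w wI; rewrite linfun_apply; last exact: mxcomm_linear.
  exact: AI.
have trP a : a \in s' -> \tr (A * P a) = (a * (\rank (P a))%:R).
  move=> as_; rewrite -mxtrace_idempotent; last by apply: PP; apply: ss'.
  have -> : A * P a = a *: P a + (A - a%:M) * P a.
    rewrite mulrBl -[a%:M * P a]/(a%:M *m P a) mul_scalar_mx addrC subrK //.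
  rewrite raddfD /= mxtraceZ (@mxtrace_nilpotent _ _ ((A - a%:M) * P a) N) ?addr0 //.
  have cPA : GRing.comm (A - a%:M) (P a).
    rewrite /GRing.comm mulrBr mulrBl Pc.
    by rewrite -[P a * a%:M]/(P a *m a%:M) mul_mx_scalar -[a%:M * P a]/(a%:M *m P a) mul_scalar_mx.
  have N0 : (0 < N)%N by move: (ss' a as_); rewrite mem_undup /N; case: (rs).
  by rewrite exprMn_comm // -[in X in _ * X](prednK N0) [X in _ * X]exprS mulrA PA ?ss' // mul0r.
have tr0 : \sum_(a <- s') (phi a * (\rank (P a))%:Z)%:~R * a = 0.
  rewrite -[RHS](trA D DI) -[A *m D]/(A * D) -[D]mulr1 -P1' !mulr_sumr raddf_sum /= big_seq [RHS]big_seq.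
  apply: eq_bigr => a as_; rewrite (Hq a (ss' a as_)).1.
  by rewrite -scalerAr mxtraceZ trP // intrM -pmulrn; ring.
have := Hphi _ tr0 => /eqP; rewrite big_seq psumr_eq0.
  move=> /allP /(_ a1 a1s); rewrite a1s /= !mulf_eq0 (negPf p1) /= orbF.
  by move: a1s; rewrite mem_filter -mxrank_eq0 => /andP[/negPf nr _]; rewrite eqz_nat nr.
by move=> a _; rewrite mulrAC mulr_ge0 // -expr2 sqr_ge0.
Qed.

Lemma cartan_mx (F : fieldType) (charF : [pchar F] =i pred0) n (I : {vspace 'M[F]_n}) A :
  (forall B C, B \in I -> C \in I -> mxcomm B C \in I) ->
  (forall B C, B \in I -> C \in I -> \tr (B *m C) = 0) ->
  A \in I -> A \in <<[seq mxcomm B C | B <- vbasis I, C <- vbasis I]>>%VS ->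
  exists k, A ^+ k = 0.
Proof.
case: n I A => [|m] I A Ic It AI Ader.
  by exists 1%N; apply/matrixP => -[].
have [K [iota [c [rs e]]]] := splitting_field_exists (leqnn (size (char_poly A))).
have charK : [pchar K] =i pred0 by move=> p; rewrite (fmorph_pchar iota) charF.
pose AK := map_mx iota A.
pose J := <<[seq map_mx iota B | B <- vbasis I]>>%VS.
have mI B : B \in I -> map_mx iota B \in J.
  move=> BI; rewrite (coord_vbasis BI) raddf_sum; apply: memv_suml => i _ /=.
  rewrite map_mxZ memvZ // memv_span // map_f // mem_nth //; by rewrite size_tuple.
have mc B C : map_mx iota (mxcomm B C) = mxcomm (map_mx iota B) (map_mx iota C).
  by rewrite /mxcomm map_mxB !map_mxM.
have AJ B y : B \in I -> y \in J -> mxcomm (map_mx iota B) y \in J.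
  move=> BI; apply: (@span_pred _ _ _ (fun y => mxcomm (map_mx iota B) y \in J))
    => [|a u v /= hu hv|_ /mapP[C CI ->]].
  - by rewrite /mxcomm mulmx0 mul0mx subrr mem0v.
  - by rewrite mxcomm_linear memvD ?memvZ.
  by rewrite -mc mI // Ic //; apply: vbasis_mem.
have TJ B y : B \in I -> y \in J -> \tr (map_mx iota B *m y) = 0.
  move=> BI; apply: (@span_pred _ _ _ (fun y => \tr (map_mx iota B *m y) = 0))
    => [|a u v /= hu hv|_ /mapP[C CI ->]].
  - by rewrite mulmx0 raddf0.
  - by rewrite mulmxDr raddfD /= -scalemxAr mxtraceZ hu hv mulr0 addr0.
  rewrite -map_mxM -(rmorph0 iota) -(It B C) // ?trace_map_mx //; exact: vbasis_mem.
suff e0 : AK ^+ size rs = 0.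
  exists (size rs); apply/eqP; rewrite -(map_mx_eq0 iota) -[map_mx _ _]/(map_mx iota (A ^+ _)).
  by rewrite rmorphXn /= -/AK e0.
apply: (cartan_trace charK (I := J)).
- by move=> y; apply: AJ.
- move=> D DJ; move: Ader; rewrite /AK.
  apply: (@span_pred _ _ _ (fun B => \tr (map_mx iota B *m D) = 0)) => [|a u v hu hv|].
  - by rewrite map_mx0 mul0mx raddf0.
  - by rewrite map_mxD map_mxZ mulmxDl raddfD /= -scalemxAl mxtraceZ hu hv mulr0 addr0.
  move=> _ /allpairsP[[B C] /= [BI CI ->]].
  have [BI' CI'] := (vbasis_mem BI, vbasis_mem CI).
  (* By cyclicity tr([B, C] D) = - tr(B [D, C]), and [D, C] is again in [J]. *)
  have := TJ B _ BI' (DJ _ (mI C CI')); rewrite mc /mxcomm.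
  set b := map_mx iota B; set d := map_mx iota C => H.
  have e1 : \tr (d *m b *m D) = \tr (b *m (D *m d)) by rewrite -mulmxA mxtrace_mulC mulmxA.
  have e2 : \tr (b *m d *m D) = \tr (b *m (d *m D)) by rewrite mulmxA.
  rewrite mulmxBl raddfB /= e1 e2; apply/eqP; rewrite -oppr_eq0 opprB -H.
  by rewrite mulmxBr raddfB.
have nz : map_poly iota (char_poly A) != 0.
  by rewrite map_char_poly monic_neq0 ?char_poly_monic.
rewrite /AK -map_char_poly e dvdpZl //.
by apply: contraNneq nz => c0; rewrite e c0 scale0r.
Qed.

(** [f2mx] is the matrix acting on row vectors, so it reverses composition; the trace is
    unaffected. *)
Definition ltr (F : fieldType) (X : vectType F) (f : 'End(X)) : F := \tr (f2mx f).

Section LinearTrace.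
Variables (F : fieldType) (X : vectType F).
Implicit Types f g : 'End(X).

Lemma f2mx_apply f v : f v = r2v (v2r v *m f2mx f).
Proof. by rewrite unlock. Qed.

Lemma f2mx_comp f g : f2mx (f \o g)%VF = f2mx g *m f2mx f.
Proof.
suff -> : (f \o g)%VF = Hom (f2mx g *m f2mx f) by [].
by apply/lfunP => v; rewrite comp_lfunE !f2mx_apply r2vK mulmxA.
Qed.

Lemma f2mxP a f g : f2mx (a *: f + g) = a *: f2mx f + f2mx g.
Proof.
suff -> : a *: f + g = Hom (a *: f2mx f + f2mx g) by [].
apply/lfunP => v; rewrite add_lfunE scale_lfunE !f2mx_apply /=.
by rewrite mulmxDr -scalemxAr linearP.
Qed.

Lemma f2mx_iter f k v : iter k f v = r2v (v2r v *m f2mx f ^+ k).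
Proof.
elim: k => [|k IH]; first by rewrite expr0 mulmx1 v2rK.
by rewrite iterS IH f2mx_apply r2vK -mulmxA exprSr.
Qed.

Lemma ltrC f g : ltr (f \o g)%VF = ltr (g \o f)%VF.
Proof. by rewrite /ltr !f2mx_comp mxtrace_mulC. Qed.

Lemma ltrP a f g : ltr (a *: f + g) = a * ltr f + ltr g.
Proof. by rewrite /ltr f2mxP mxtraceD mxtraceZ. Qed.

Lemma ltr0 : ltr (0 : 'End(X)) = 0.
Proof. by have := ltrP (-1) 0 0; rewrite scaleN1r addNr mulN1r addNr. Qed.

Lemma f2mx_comm f g : f2mx (comm_lfun f g) = - mxcomm (f2mx f) (f2mx g).
Proof.
have -> : comm_lfun f g = (-1) *: (g \o f)%VF + (f \o g)%VF.
  by apply/lfunP => v; rewrite comm_lfunE add_lfunE scale_lfunE !comp_lfunE scaleN1r addrC.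
by rewrite f2mxP !f2mx_comp scaleN1r /mxcomm opprB addrC.
Qed.

End LinearTrace.

(** Perfectness of [D] puts every [sigma x] in the span of commutators, as the matrix form of the
    criterion requires. *)
Lemma cartan_nilpotent (F : fieldType) (charF : [pchar F] =i pred0) (W X : vectType F)
    (br : W -> W -> W) (Hlie : is_lie_bracket br) (sigma : 'Hom(W, 'End(X))) (D : {vspace W}) :
  (forall x y, sigma (br x y) = comm_lfun (sigma x) (sigma y)) ->
  brs br D D = D -> (forall x y, x \in D -> y \in D -> ltr (sigma x \o sigma y)%VF = 0) ->
  forall x, x \in D -> nilpotent_op (sigma x).
Proof.
move=> sbr DD tr0 x xD.
pose M : 'Hom('End(X), 'M[F]_(dim X)) := linfun (@f2mx F X X).
have ME f : M f = f2mx f by rewrite /M linfun_apply //; apply: f2mxP.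
pose I := ((M \o sigma) @: D)%VS.
have IP B : B \in I -> exists2 y, y \in D & B = f2mx (sigma y).
  by case/memv_imgP=> y yD ->; exists y; rewrite // comp_lfunE ME.
have PI y : y \in D -> f2mx (sigma y) \in I.
  by move=> yD; rewrite -ME -comp_lfunE memv_img.
have Ds : subalg br D by move=> a b aD bD; rewrite -DD mem_brs.
have [|B C|||k Ak] := @cartan_mx F charF _ I (f2mx (sigma x)).
- move=> B C /IP[a aD ->] /IP[b bD ->].
  by rewrite -[mxcomm _ _]opprK -f2mx_comm -sbr memvN PI ?Ds.
- move=> /IP[a aD ->] /IP[b bD ->]; have := tr0 b a bD aD.
  by rewrite /ltr f2mx_comp.
- exact: PI.
- set S := <<_>>%VS.
  have mS B C : B \in I -> C \in I -> mxcomm B C \in S.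
    move=> BI CI; rewrite (coord_vbasis CI) /mxcomm mulmx_sumr mulmx_suml -sumrB.
    apply: memv_suml => j _; rewrite -scalemxAr -scalemxAl -scalerBr memvZ //.
    rewrite (coord_vbasis BI) mulmx_sumr mulmx_suml -sumrB.
    apply: memv_suml => i _; rewrite -scalemxAr -scalemxAl -scalerBr memvZ //.
    by apply/memv_span/allpairs_f; apply: mem_nth; rewrite size_tuple.
  suff sub : (D <= ((M \o sigma) @^-1: S))%VS.
    by have := subvP sub x xD; rewrite -memv_preim comp_lfunE ME.
  rewrite -[X in (X <= _)%VS]DD; apply/(brs_subP Hlie) => a b aD bD.
  by rewrite -memv_preim comp_lfunE ME sbr f2mx_comm memvN mS ?PI.
by exists k => v; rewrite f2mx_iter Ak mulmx0 linear0.
Qed.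

(** * Semisimple algebras and Weyl's theorem *)

Definition semisimple_lie (F : fieldType) (W : vectType F) (br : W -> W -> W) :=
  forall I : {vspace W}, ideal_of br fullv I -> abelian br I -> I = 0%VS.

Definition lie_rep (F : fieldType) (W X : vectType F) (br : W -> W -> W)
  (sigma : 'Hom(W, 'End(X))) :=
  forall x y, sigma (br x y) = comm_lfun (sigma x) (sigma y).

Definition trace_form (F : fieldType) (W X : vectType F) (sigma : 'Hom(W, 'End(X))) x y :=
  ltr (sigma x \o sigma y)%VF.

Section TraceForm.
Variables (F : fieldType) (W X : vectType F) (br : W -> W -> W) (sigma : 'Hom(W, 'End(X))).
Hypotheses (Hlie : is_lie_bracket br) (rep : lie_rep br sigma).
Local Notation T := (trace_form sigma).

Lemma trace_formC x y : T x y = T y x.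
Proof. exact: ltrC. Qed.

Lemma trace_form_linl a x y z : T (a *: x + y) z = a * T x z + T y z.
Proof.
by rewrite /trace_form linearP /= comp_lfunDl -comp_lfunZl ltrP.
Qed.

Lemma trace_form_linr a x y z : T z (a *: x + y) = a * T z x + T z y.
Proof. by rewrite trace_formC trace_form_linl !(trace_formC z). Qed.

Lemma trace_form_0l z : T 0 z = 0.
Proof. by have := trace_form_linl (-1) 0 0 z; rewrite scaler0 addr0 mulN1r addNr. Qed.

Lemma trace_form_suml (J : Type) (r : seq J) (c : J -> F) (e : J -> W) z :
  T (\sum_(i <- r) c i *: e i) z = \sum_(i <- r) c i * T (e i) z.
Proof.
elim/big_rec2: _ => [|i u v _ IH]; first exact: trace_form_0l.
by rewrite trace_form_linl IH.
Qed.

Lemma trace_form_inv x y z : T (br x y) z = T x (br y z).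
Proof.
rewrite /trace_form !rep.
have -> : (comm_lfun (sigma x) (sigma y) \o sigma z)%VF =
  (-1) *: (sigma y \o (sigma x \o sigma z))%VF + (sigma x \o (sigma y \o sigma z))%VF.
  by apply/lfunP => v; rewrite add_lfunE scale_lfunE !comp_lfunE comm_lfunE scaleN1r addrC.
have -> : (sigma x \o comm_lfun (sigma y) (sigma z))%VF =
  (-1) *: (sigma x \o sigma z \o sigma y)%VF + (sigma x \o (sigma y \o sigma z))%VF.
  by apply/lfunP => v; rewrite add_lfunE scale_lfunE !comp_lfunE comm_lfunE linearB scaleN1r addrC.
by rewrite !ltrP (ltrC (sigma y)).
Qed.

Lemma orthogonal_exists (I : {vspace W}) : ideal_of br fullv I ->
  exists O : {vspace W}, [/\ ideal_of br fullv O,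
    forall x, x \in O <-> forall y, y \in I -> T x y = 0 &
    (\dim {:W} <= \dim I + \dim O)%N].
Proof.
move=> hI; have [_ HI] := hI.
have [|a u v /= hu hv|O OP] := @vspace_of_pred F W (fun x => forall y, y \in I -> T x y = 0).
- by move=> y _; apply: trace_form_0l.
- by move=> y yI; rewrite trace_form_linl hu // hv // mulr0 addr0.
exists O; split=> //.
  apply/idealP => c o oO; rewrite (brC Hlie) memvN; apply/OP => y yI.
  by rewrite trace_form_inv; apply: (OP o).1 => //; apply: HI; rewrite ?memvf.
pose g : 'Hom(W, 'rV[F]_(\dim I)) := linfun (fun x => \row_i T x (vbasis I)`_i).
have gE x : g x = \row_i T x (vbasis I)`_i.
  rewrite /g linfun_apply // => a u v; apply/rowP => i; by rewrite !mxE trace_form_linl.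
rewrite -(limg_ker_dim g fullv) addnC leq_add //.
  by apply: leq_trans (dimvS (subvf _)) _; rewrite dimvf /dim /= mul1n.
rewrite dimvS //; apply/subvP => x; rewrite memv_cap memv_ker => /andP[_ /eqP gx].
apply/OP => y yI; rewrite (coord_vbasis yI) trace_formC trace_form_suml big1 // => i _.
have := congr1 (fun r : 'rV_ _ => r 0 i) gx; rewrite gE !mxE => e.
by rewrite trace_formC e mulr0.
Qed.

End TraceForm.

Lemma adhom_rep (F : fieldType) (W : vectType F) (br : W -> W -> W) :
  is_lie_bracket br -> lie_rep br (adhom br).
Proof. by move=> Hlie x y; rewrite !adhomE // ad_br. Qed.

Section Semisimple.
Variables (F : fieldType) (W : vectType F) (br : W -> W -> W).
Hypotheses (charF : [pchar F] =i pred0) (Hlie : is_lie_bracket br).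
Hypothesis ss : semisimple_lie br.
Local Notation L := (fullv : {vspace W}).
Local Notation killing := (trace_form (adhom br)).

Lemma semisimple_solvable n (I : {vspace W}) : ideal_of br L I -> dser br n I = 0%VS -> I = 0%VS.
Proof.
move=> hI sol; have [//|nI] := eqVneq I 0%VS.
have [k [nk abk]] := dser_last Hlie nI sol.
by case/eqP: nk; apply: ss => //; apply: dser_ideal.
Qed.

Lemma dser_perfect (I : {vspace W}) : subalg br I ->
  exists n, brs br (dser br n I) (dser br n I) = dser br n I.
Proof.
move=> Is; have [n _ minn] := @nat_min nat (fun n => \dim (dser br n I)) (fun=> True) 0%N Logic.I.
exists n; apply/eqP; rewrite eqEdim (minn n.+1) // andbT.
by apply: brs_sub => //; apply: dser_subalg.
Qed.

(** On the perfect term [D] of the derived series of [I], Cartan's criterion makes all [ad x]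
    nilpotent. By Engel, if [D] is nonzero it has a nonzero centre, which is an abelian ideal of L;
    if [D = 0], then [I] is solvable. *)
Lemma killing_isotropic (I : {vspace W}) : ideal_of br L I ->
  (forall x y, x \in I -> y \in I -> killing x y = 0) -> I = 0%VS.
Proof.
move=> hI iso; have [n perf] := dser_perfect (ideal_subalg hI).
set D := dser br n I in perf.
have hD : ideal_of br L D by apply: dser_ideal.
have [_ HD] := hD.
have sDI : (D <= I)%VS by apply: (@dser_le _ _ _ Hlie 0 n) => //; apply: ideal_subalg hI.
have [D0|nD] := eqVneq D 0%VS; first exact: semisimple_solvable D0.
have nil x : x \in D -> nilpotent_op (adhom br x).
  apply: (cartan_nilpotent charF Hlie (adhom_rep Hlie) perf) => {}x y xD yD.
  by apply: iso; apply: (subvP sDI).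
have [|||| v [vD v0 Dv]] := @engel F _ _ (adhom br @: D)%VS 0%VS D (leqnn _).
- move=> _ _ /memv_imgP[f fD ->] /memv_imgP[g gD ->].
  by rewrite -adhom_rep // memv_img //; apply: HD; rewrite ?memvf.
- by move=> _ /memv_imgP[f fD ->]; apply: nil.
- move=> _ /memv_imgP[f fD ->]; split=> u; first by rewrite !memv0 => /eqP->; rewrite linear0.
  by rewrite adhomE // adE // => uD; apply: HD; rewrite ?memvf.
- by rewrite /vproper sub0v eq_sym.
have [|a x y /= [xD hx] [yD hy]|Z ZP] := @vspace_of_pred F W
  (fun v => v \in D /\ forall d, d \in D -> br d v = 0).
- by split=> [|d _]; rewrite ?mem0v ?(br0r Hlie).
- by split=> [|d dD]; rewrite ?memvD ?memvZ // (br_linr Hlie) hx ?hy // scaler0 addr0.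
have Z0 : Z = 0%VS.
  apply: ss; last first.
    by move=> a b /ZP[aD _] /ZP[bD]; apply.
  apply/idealP => c z /ZP[zD hz]; apply/ZP; split; first by apply: HD; rewrite ?memvf.
  move=> d dD; rewrite (brJ Hlie) (hz d dD) (br0r Hlie) addr0 hz //.
  by rewrite (brC Hlie) memvN; apply: HD; rewrite ?memvf.
case/negP: v0; rewrite -Z0; apply/ZP; split=> // d dD.
apply/eqP; rewrite -memv0 -adE // -adhomE //; apply: Dv; exact: memv_img.
Qed.

Lemma killing_complement (I : {vspace W}) : ideal_of br L I ->
  exists J, [/\ ideal_of br L J, (I + J = L)%VS, (I :&: J = 0)%VS &
    forall x, x \in J <-> forall y, y \in I -> killing x y = 0].
Proof.
move=> hI; have [J [hJ JP dJ]] := orthogonal_exists Hlie (adhom_rep Hlie) hI.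
have IJ : (I :&: J = 0)%VS.
  apply: killing_isotropic; first exact: ideal_capI.
  move=> x y; rewrite !memv_cap => /andP[_ xJ] /andP[yI _]; exact: (JP x).1.
exists J; split=> //; apply/eqP; rewrite eqEdim subvf /= dimv_disjoint_sum //.
Qed.

(** By invariance of the Killing form, the complement [J] orthogonal to [L, L] has [J, J] orthogonal
    to L. So [J] is an abelian ideal. *)
Lemma semisimple_perfect : brs br L L = L.
Proof.
have hB := ideal_brs Hlie (idealf br) (idealf br).
have [J [hJ BJ _ JP]] := killing_complement hB.
have [O [hO OP dO]] := orthogonal_exists Hlie (adhom_rep Hlie) (idealf br).
have O0 : O = 0%VS.
  by apply: killing_isotropic => // x y xO yO; apply: (OP x).1; rewrite ?memvf.
suff J0 : J = 0%VS by move: BJ; rewrite J0 addv0.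
apply: ss => // x y xJ yJ; apply/eqP; rewrite -memv0 -O0; apply/OP => z _.
rewrite (trace_form_inv (adhom_rep Hlie)); apply: (JP x).1 => //.
by apply: mem_brs; rewrite ?memvf.
Qed.

End Semisimple.

Section Weyl.
Variables (F : fieldType) (W X : vectType F) (br : W -> W -> W).
Hypotheses (charF : [pchar F] =i pred0) (Hlie : is_lie_bracket br).
Hypothesis ss : semisimple_lie br.
Local Notation L := (fullv : {vspace W}).
Implicit Types (sigma : 'Hom(W, 'End(X))) (N : {vspace X}).

Lemma repE sigma : lie_rep br sigma ->
  forall x y v, sigma (br x y) v = sigma x (sigma y v) - sigma y (sigma x v).
Proof. by move=> rep x y v; rewrite rep comm_lfunE. Qed.

(** The restriction to [N] is kept on the space [X]. Since it vanishes on the kernel of [p] and has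
    values in [N], its traces are those of the action on [N]. *)
Lemma restrict_rep sigma N (p : 'End(X)) : lie_rep br sigma ->
  (forall w, stable (sigma w) N) -> (forall v, p v \in N) -> (forall v, v \in N -> p v = v) ->
  exists tau : 'Hom(W, 'End(X)), lie_rep br tau /\ forall w, tau w = (sigma w \o p)%VF.
Proof.
move=> rep sN pN pid; exists (linfun (fun w => (sigma w \o p)%VF)).
have E w : linfun (fun w => (sigma w \o p)%VF) w = (sigma w \o p)%VF.
  by rewrite linfun_apply // => a u v; rewrite linearP /= comp_lfunDl -comp_lfunZl.
split=> // x y; apply/lfunP => v; rewrite comm_lfunE !E !comp_lfunE repE //.
by rewrite (pid (sigma y (p v)) (sN _ _ (pN v))) (pid (sigma x (p v)) (sN _ _ (pN v))).
Qed.

(** The action on X / N, again kept on [X], so that the induction in Weyl's theorem stays on one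
    space. *)
Lemma quotient_rep sigma N : lie_rep br sigma -> (forall w, stable (sigma w) N) ->
  exists tau : 'Hom(W, 'End(X)), lie_rep br tau /\
    forall w v, tau w v = sigma w v - projv N (sigma w v).
Proof.
move=> rep sN.
have [f fE] : exists f : W -> 'End(X), forall w v, f w v = sigma w v - projv N (sigma w v).
  exists (fun w => sigma w - (projv N \o sigma w)%VF) => w v.
  by rewrite add_lfunE opp_lfunE comp_lfunE.
have E w : linfun f w = f w.
  rewrite linfun_apply // => a u v; apply/lfunP => z.
  by rewrite add_lfunE scale_lfunE !fE linearP add_lfunE scale_lfunE linearP scalerBr opprD addrACA.
exists (linfun f); split=> [x y|w v]; last by rewrite E fE.
apply/lfunP => v; rewrite comm_lfunE !E !fE repE //.
have red x' u : sigma x' (u - projv N u) - projv N (sigma x' (u - projv N u)) =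
    sigma x' u - projv N (sigma x' u).
  rewrite !linearB /= (projv_id (sN x' _ (memv_proj N u))).
  by rewrite opprK addrA addrAC subrK.
by rewrite !red linearB /= !opprB addrACA [RHS]addrACA [- _ - _]addrC.
Qed.

(* T is the trace form of the representation on N, I its radical and J the complement of I
   for the Killing form. If J = 0, then N is trivial by the theorems of Cartan and Engel;
   otherwise the Casimir operator Om of T on J has trace dim J on N, so it is invertible
   there, and its kernel provides m. *)
Lemma weyl_irreducible sigma N m0 : lie_rep br sigma ->
  (forall w, stable (sigma w) N) -> (forall w, sigma w m0 \in N) ->
  (forall N', (N' <= N)%VS -> (forall w, stable (sigma w) N') -> N' != 0%VS -> N' = N) ->
  N != 0%VS ->
  exists m, m - m0 \in N /\ forall w, sigma w m = 0.
Proof.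
move=> rep sN m0N irr nN.
have [tau [trep tauE]] := restrict_rep rep sN (memv_proj N) (@projv_id _ _ N).
set p := projv N in tauE.
pose T := trace_form tau.
have [I [hI IP _]] := orthogonal_exists Hlie trep (idealf br).
have [J [hJ IJ IJ0 _]] := killing_complement charF Hlie ss hI.
(* Irreducibility as a proof principle: a linear invariant property of one nonzero vector of [N]
   holds on [N]. *)
have sub_inv (Q : X -> Prop) : Q 0 -> (forall a u v, Q u -> Q v -> Q (a *: u + v)) ->
    (forall w v, v \in N -> Q v -> Q (sigma w v)) ->
    (exists v, [/\ v \in N, v != 0 & Q v]) -> forall v, v \in N -> Q v.
  move=> Q0 QL QS [v [vN v0 Qv]].
  have [||N' N'P] := @vspace_of_pred F X (fun v => v \in N /\ Q v).
  - by rewrite mem0v.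
  - by move=> a u w [uN Qu] [wN Qw]; rewrite memvD ?memvZ //; split=> //; apply: QL.
  have <- : N' = N.
    apply: irr; first by apply/subvP => u /N'P[].
      by move=> w u /N'P[uN Qu]; apply/N'P; split; [apply: sN | apply: QS].
    apply: contraNneq v0 => e; rewrite -memv0 -e; exact/N'P.
  by move=> u /N'P[].
have [J0|nJ] := eqVneq J 0%VS.
  have IL : I = L by rewrite -IJ J0 addv0.
  have nil w : w \in L -> nilpotent_op (tau w).
    move: w; apply: (cartan_nilpotent charF Hlie trep (semisimple_perfect charF Hlie ss)).
    by move=> x y _ _; apply: (IP x).1; rewrite ?IL memvf.
  have [||||v [vN v0 Dv]] := @engel F _ _ (tau @: L)%VS 0%VS N (leqnn _).
  - move=> _ _ /memv_imgP[f _ ->] /memv_imgP[g _ ->]; by rewrite -trep memv_img ?memvf.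
  - by move=> _ /memv_imgP[f _ ->]; apply: nil; apply: memvf.
  - move=> _ /memv_imgP[f _ ->]; split=> u; first by rewrite !memv0 => /eqP->; rewrite linear0.
    by move=> uN; rewrite tauE comp_lfunE sN ?memv_proj.
  - by rewrite /vproper sub0v eq_sym.
  have kill u : u \in N -> forall w, sigma w u = 0.
    apply: (sub_inv (fun u => forall w, sigma w u = 0)).
    - by move=> w; rewrite linear0.
    - by move=> a u1 u2 h1 h2 w; rewrite linearP /= h1 h2 scaler0 addr0.
    - by move=> w u1 _ h1 w' /=; rewrite h1 linear0.
    exists v; split=> //; first by rewrite -memv0.
    move=> w; have := Dv (tau w) (memv_img _ (memvf w)).
    by rewrite memv0 tauE comp_lfunE projv_id // => /eqP.
  (* All of [N] is killed, so every [x, y] kills [m0], and such brackets span L. *)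
  exists m0; rewrite subrr mem0v; split=> // w.
  have [|a x y /= hx hy|U UP] := @vspace_of_pred F W (fun w => sigma w m0 = 0).
  - by rewrite linear0 zero_lfunE.
  - by rewrite linearP add_lfunE scale_lfunE hx hy scaler0 addr0.
  apply/UP; apply: (subvP _ w (memvf w)).
  rewrite -(semisimple_perfect charF Hlie ss); apply/(brs_subP Hlie) => x y _ _.
  by apply/UP; rewrite repE // (kill _ (m0N y)) (kill _ (m0N x)) subrr.
have [_ HJ] := hJ.
pose d := \dim J; pose e (i : 'I_d) := (vbasis J)`_i.
have eJ i : e i \in J by apply: vbasis_mem; apply: mem_nth; rewrite size_tuple.
have ndJ u : u \in J -> (forall k, T (e k) u = 0) -> u = 0.
  move=> uJ hu; apply/eqP; rewrite -memv0 -IJ0 memv_cap uJ andbT; apply/IP => y _.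
  have : y \in (I + J)%VS by rewrite IJ memvf.
  case/memv_addP=> a aI [b bJ ->].
  rewrite -[a]scale1r trace_form_linr (trace_formC tau u a) ((IP a).1 aI) ?memvf // mulr0 add0r.
  rewrite trace_formC (coord_vbasis bJ) trace_form_suml big1 // => i _.
  by rewrite -/T -/(e i) hu mulr0.
pose G := \matrix_(i < d, j < d) T (e i) (e j).
have Gu : G \in unitmx.
  rewrite -row_free_unit; apply: inj_row_free => v vG.
  pose u := \sum_i v 0 i *: e i.
  have uJ : u \in J by apply: memv_suml => i _; rewrite memvZ.
  have u0 : u = 0.
    apply: ndJ => // k; rewrite /T trace_formC trace_form_suml.
    have := congr1 (fun r : 'rV_d => r 0 k) vG; rewrite !mxE => ek; rewrite -[RHS]ek.
    by apply: eq_bigr => i _; rewrite mxE.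
  apply/rowP => i; rewrite mxE.
  have fr : free (vbasis J) by apply: basis_free (vbasisP J).
  by have /freeP := fr; apply; exact: u0.
(* [f] is the basis of [J] dual to [e] for [T]. *)
pose H := invmx G; pose f i := \sum_j H i j *: e j.
have fJ i : f i \in J by apply: memv_suml => j _; rewrite memvZ.
have Tfe i k : T (f i) (e k) = (i == k)%:R.
  rewrite /T trace_form_suml; have := mulVmx Gu => /matrixP /(_ i k); rewrite !mxE => <-.
  by apply: eq_bigr => j _; rewrite mxE.
have deltaE (c : 'I_d -> F) k : \sum_i c i * (i == k)%:R = c k.
  rewrite (bigD1 k) //= eqxx mulr1 big1 ?addr0 // => i /negPf->; by rewrite mulr0.
have dec_e u : u \in J -> u = \sum_j T (f j) u *: e j.
  move=> uJ; apply/eqP; rewrite -subr_eq0; apply/eqP; set w := \sum_j _.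
  have wJ : w \in J by apply: memv_suml => j _; rewrite memvZ.
  have fw k : T (f k) (u - w) = 0.
    rewrite -[u - w]addrC -scaleN1r /T trace_form_linr trace_formC trace_form_suml.
    rewrite (eq_bigr (fun j => T (f j) u * (j == k)%:R)) => [|j _]; last first.
      by rewrite trace_formC -/T Tfe (eq_sym k).
    by rewrite deltaE mulN1r addNr.
  apply: ndJ => [|k]; first by rewrite memvB.
  have -> : e k = \sum_j G k j *: f j.
    have GH : G *m H = 1%:M by apply: mulmxV.
    under eq_bigr do rewrite /f scaler_sumr.
    rewrite exchange_big /= (eq_bigr (fun i => (i == k)%:R *: e i)) => [|i _].
      by rewrite (bigD1 k) //= eqxx scale1r big1 ?addr0 // => i /negPf->; rewrite scale0r.
    under eq_bigr do rewrite scalerA.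
    rewrite -scaler_suml; congr (_ *: _).
    by have /matrixP /(_ k i) := GH; rewrite !mxE eq_sym.
  by rewrite /T trace_form_suml big1 // => j _; rewrite -/T fw mulr0.
have dec_f u : u \in J -> u = \sum_j T (e j) u *: f j.
  move=> uJ; apply/eqP; rewrite -subr_eq0; apply/eqP; set w := \sum_j _.
  have wJ : w \in J by apply: memv_suml => j _; rewrite memvZ.
  apply: ndJ => [|k]; first by rewrite memvB.
  rewrite -[u - w]addrC -scaleN1r /T trace_form_linr trace_formC trace_form_suml.
  rewrite (eq_bigr (fun j => T (e j) u * (j == k)%:R)) => [|j _]; last by rewrite -/T Tfe.
  by rewrite deltaE mulN1r addNr.
pose Om v := \sum_i sigma (e i) (sigma (f i) v).
have OmL a u v : Om (a *: u + v) = a *: Om u + Om v.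
  rewrite /Om scaler_sumr -big_split; apply: eq_bigr => i _ /=.
  by rewrite !linearP.
have Om0 : Om 0 = 0 by rewrite /Om big1 // => i _; rewrite !linear0.
have OmN v : (forall w, sigma w v \in N) -> Om v \in N.
  by move=> hv; apply: memv_suml => i _; apply: sN; apply: hv.
have OmC x v : sigma x (Om v) = Om (sigma x v).
  apply/eqP; rewrite -subr_eq0 /Om linear_sum -sumrB /=.
  have -> : \sum_i (sigma x (sigma (e i) (sigma (f i) v)) - sigma (e i) (sigma (f i) (sigma x v)))
    = \sum_i (sigma (br x (e i)) (sigma (f i) v) + sigma (e i) (sigma (br x (f i)) v)).
    apply: eq_bigr => i _; rewrite !repE // linearB /= addrA subrK //.
  rewrite big_split /= addr_eq0 -sumrN; apply/eqP.
  have xJ u : u \in J -> br x u \in J by move=> uJ; apply: HJ; rewrite ?memvf.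
  (* By invariance of [T], the coefficient of e_j in [x, e_i] is minus that of f_i in [x, f_j], so
     the two double sums cancel. *)
  transitivity (\sum_i \sum_j T (f j) (br x (e i)) *: sigma (e j) (sigma (f i) v)).
    apply: eq_bigr => i _; rewrite {1}(dec_e (br x (e i))) ?xJ //.
    by rewrite linear_sum sum_lfunE; apply: eq_bigr => j _ /=; rewrite linearZ scale_lfunE.
  rewrite exchange_big /=; apply: eq_bigr => j _.
  rewrite {1}(dec_f (br x (f j))) ?xJ // linear_sum sum_lfunE linear_sum -sumrN.
  apply: eq_bigr => i _ /=; rewrite linearZ scale_lfunE linearZ /= -scaleNr; congr (_ *: _).
  rewrite /T -(trace_form_inv trep (f j)) trace_formC (brC Hlie (f j)) -scaleN1r.
  rewrite -[_ *: br _ _]addr0 trace_form_linr (trace_formC tau _ 0) trace_form_0l.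
  by rewrite addr0 mulN1r.
have trOm : exists v, v \in N /\ Om v != 0.
  apply: NNPP => no.
  have z v : v \in N -> Om v = 0 by move=> vN; apply: NNPP => /eqP nv; apply: no; exists v.
  have : \sum_i T (e i) (f i) = 0.
    rewrite -[RHS](ltr0 X); have <- : \sum_i (tau (e i) \o tau (f i))%VF = 0.
      apply/lfunP => v; rewrite sum_lfunE zero_lfunE -[RHS](z (p v)) ?memv_proj //.
      by apply: eq_bigr => i _; rewrite comp_lfunE !tauE !comp_lfunE projv_id // sN ?memv_proj.
    rewrite /T /trace_form; elim/big_rec2: _ => [|i u v _ ->]; first by rewrite ltr0.
    by rewrite -[(tau _ \o _)%VF]scale1r ltrP mul1r scale1r.
  rewrite (eq_bigr (fun=> 1)) => [|i _]; last by rewrite /T trace_formC -/T Tfe eqxx.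
  rewrite sumr_const card_ord => /eqP; apply/negP.
  by move/pcharf0P: charF => ->; rewrite dimv_eq0.
have inj v : v \in N -> Om v = 0 -> v = 0.
  move=> vN ov; apply: NNPP => /eqP v0; case: trOm => u [uN /eqP]; apply.
  apply: (sub_inv (fun u => Om u = 0)) => //.
  - by move=> a u1 u2 h1 h2; rewrite OmL h1 h2 scaler0 addr0.
  - by move=> w u1 _ h1; rewrite -OmC h1 linear0.
  by exists v.
pose O : 'End(X) := linfun Om.
have OE v : O v = Om v by rewrite /O linfun_apply.
have ON : (O @: N)%VS = N.
  apply/eqP; rewrite eqEdim; apply/andP; split.
    by apply/subvP=> _ /memv_imgP[v vN ->]; rewrite OE; apply: OmN => w; apply: sN.
  have k0 : (N :&: lker O = 0)%VS.
    apply/eqP; rewrite -subv0; apply/subvP=> v; rewrite memv_cap memv_ker OE memv0.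
    by case/andP=> vN /eqP ov; apply/eqP; apply: inj.
  by rewrite -{1}(limg_ker_dim O N) k0 dimv0 add0n leqnn.
(* Subtract from [m0] the n in [N] with the same image under [Om]. Each sigma w (m0 - n) lies in [N]
   and is killed by [Om], hence is zero. *)
have : Om m0 \in N by apply: OmN.
rewrite -{1}ON => /memv_imgP[n nN']; rewrite OE => en.
have Om_m : Om (m0 - n) = 0.
  by rewrite addrC -scaleN1r OmL en scaleN1r addNr.
exists (m0 - n); rewrite addrC addKr memvN; split=> // w.
apply: inj; last by rewrite -OmC Om_m linear0.
by rewrite linearB memvB //= sN.
Qed.

(** Weyl's theorem for [N] in [N + <[m0]>]; the later applications reach other complements through
    spaces of linear maps. A first correction of [m0] works modulo a minimal stable [N1], a second
    one inside [N1]. *)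
Lemma weyl_invariant n : forall sigma N m0, lie_rep br sigma -> (\dim N <= n)%N ->
  (forall w, stable (sigma w) N) -> (forall w, sigma w m0 \in N) ->
  exists m, m - m0 \in N /\ forall w, sigma w m = 0.
Proof.
elim: n => [|n IH] sigma N m0 rep dN sN m0N.
  exists m0; rewrite subrr mem0v; split=> // w; have := m0N w.
  by move: dN; rewrite leqn0 dimv_eq0 => /eqP->; rewrite memv0 => /eqP.
have [N0|nN] := eqVneq N 0%VS; first by apply: IH => //; rewrite N0 dimv0.
have [N1 [sN1N sN1 nN1] minN1] := @dim_min F X
  (fun N' => [/\ (N' <= N)%VS, forall w, stable (sigma w) N' & N' != 0%VS]) N
  (And3 (subvv N) sN nN).
have irr N' : (N' <= N1)%VS -> (forall w, stable (sigma w) N') -> N' != 0%VS -> N' = N1.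
  move=> s1 s2 s3; apply/eqP; rewrite eqEdim s1 minN1 //; split=> //.
  exact: subv_trans s1 sN1N.
have dN1 : (0 < \dim N1)%N by rewrite lt0n dimv_eq0.
have [tau [trep tauE]] := quotient_rep rep sN1.
have [m1 [m1N hm1]] : exists m, m - m0 \in N /\ forall w, sigma w m \in N1.
  pose q : 'End(X) := \1%VF - projv N1.
  have qE v : q v = v - projv N1 v by rewrite /q add_lfunE opp_lfunE id_lfunE.
  have qN : (q @: N <= N)%VS.
    apply/subvP=> _ /memv_imgP[v vN ->]; rewrite qE memvB // (subvP sN1N) //; exact: memv_proj.
  have [|||m [mN hm]] := IH tau (q @: N)%VS m0 trep.
  - rewrite -ltnS; apply: leq_trans dN; rewrite -(limg_ker_dim q N) -[X in (X < _)%N]add0n ltn_add2r.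
    apply: leq_trans dN1 (dimvS _); rewrite subv_cap sN1N; apply/subvP=> v vN1.
    by rewrite memv_ker qE projv_id // subrr.
  - by move=> w _ /memv_imgP[v vN ->]; rewrite tauE -qE memv_img // sN // (subvP qN) ?memv_img.
  - by move=> w; rewrite tauE -qE memv_img.
  exists m; split; first exact: (subvP qN).
  move=> w; have := hm w; rewrite tauE => /eqP; rewrite subr_eq0 => /eqP->; exact: memv_proj.
have [m [mN hm]] := weyl_irreducible rep sN1 hm1 irr nN1.
exists m; split=> //; rewrite -(subrK m1 m) -addrA memvD //.
exact: (subvP sN1N).
Qed.

End Weyl.

(** * Levi complements *)

Section QuotientMap.
Variables (F : fieldType) (V W : vectType F).

(** L / R presented by the projection [pr] and a section [sec] that is only linear. *)
Record quotient_map (br : V -> V -> V) (q : W -> W -> W) (R : {vspace V})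
    (pr : 'Hom(V, W)) (sec : 'Hom(W, V)) : Prop := QuotientMap {
  quo_lie : is_lie_bracket q;
  quo_br : forall x y, pr (br x y) = q (pr x) (pr y);
  quo_sec : forall w, pr (sec w) = w;
  quo_ker : forall v, (v \in R) = (pr v == 0) }.

Variables (br : V -> V -> V) (q : W -> W -> W) (R : {vspace V})
  (pr : 'Hom(V, W)) (sec : 'Hom(W, V)).
Hypotheses (Hlie : is_lie_bracket br) (Q : quotient_map br q R pr sec).

Lemma quo_ideal_img I : ideal_of br fullv I -> ideal_of q fullv (pr @: I)%VS.
Proof.
move=> /idealP hI; apply/idealP => w _ /memv_imgP[i iI ->].
by rewrite -(quo_sec Q w) -(quo_br Q) memv_img // hI.
Qed.

Lemma quo_ideal_preim J : ideal_of q fullv J -> ideal_of br fullv (pr @^-1: J)%VS.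
Proof.
move=> /idealP hJ; apply/idealP => c i; rewrite -!memv_preim (quo_br Q); exact: hJ.
Qed.

Lemma quo_subalg_preim J : subalg q J -> subalg br (pr @^-1: J)%VS.
Proof. by move=> hJ a b; rewrite -!memv_preim (quo_br Q); apply: hJ. Qed.

Lemma quo_sub_preim J : (R <= pr @^-1: J)%VS.
Proof. by apply/subvP => r; rewrite (quo_ker Q) -memv_preim => /eqP->; rewrite mem0v. Qed.

Lemma quo_preim_add I J : (pr @: I + J = fullv)%VS -> (I + pr @^-1: J = fullv)%VS.
Proof.
move=> e; apply/eqP; rewrite eqEsubv subvf; apply/subvP => v _.
have : pr v \in (pr @: I + J)%VS by rewrite e memvf.
case/memv_addP=> _ /memv_imgP[i iI ->] [j jJ ev].
rewrite -[v](subrK i) addrC memv_add // -memv_preim linearB /= ev addrC addKr //.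
Qed.

Lemma quo_preim_full J : (pr @^-1: J = fullv)%VS -> J = fullv.
Proof.
move=> e; apply/eqP; rewrite eqEsubv subvf; apply/subvP => w _.
by rewrite -(quo_sec Q w) memv_preim e memvf.
Qed.

Lemma quo_sec_mod v : v - sec (pr v) \in R.
Proof. by rewrite (quo_ker Q) linearB /= (quo_sec Q) subrr. Qed.

End QuotientMap.

Lemma quotient_exists (F : fieldType) (V : vectType F) (br : V -> V -> V) (R : {vspace V}) :
  is_lie_bracket br -> ideal_of br fullv R ->
  exists (W : vectType F) q pr sec, @quotient_map F V W br q R pr sec.
Proof.
move=> Hlie hR; have [_ HR] := hR; pose U := (R^C)%VS.
pose pr : 'Hom(V, subvs_of U) := linfun (fun v => vsproj U (v - projv R v)).
pose sec : 'Hom(subvs_of U, V) := linfun (fun w => vsval w).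
have secE w : sec w = vsval w by rewrite /sec linfun_apply.
have prE v : pr v = vsproj U (v - projv R v).
  rewrite /pr linfun_apply // => a u w; rewrite -linearP; congr (vsproj U _).
  by rewrite linearP scalerBr opprD addrACA.
have secpr v : sec (pr v) = v - projv R v by rewrite secE prE vsprojK // memv_projC.
have prsec w : pr (sec w) = w.
  rewrite prE secE; have -> : projv R (vsval w) = 0.
    by apply/eqP; rewrite -memv_ker lker_proj; apply: subvsP.
  by rewrite subr0 vsvalK.
have ker v : (v \in R) = (pr v == 0).
  apply/idP/eqP => [vR|e]; first by rewrite prE projv_id // subrr linear0.
  have := secpr v; rewrite e linear0 => /esym /eqP; rewrite subr_eq0 => /eqP ->.
  exact: memv_proj.
pose q w w' := pr (br (sec w) (sec w')).
have prbr x y : pr (br x y) = q (pr x) (pr y).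
  rewrite /q !secpr; apply/eqP; rewrite -subr_eq0 -linearB -ker /=.
  set rx := projv R x; set ry := projv R y.
  have rxR : rx \in R := memv_proj R x; have ryR : ry \in R := memv_proj R y.
  have -> : br x y = br (x - rx) (y - ry) + (br (x - rx) ry + br rx y).
    by rewrite addrA -(brDr Hlie) subrK -(brDl Hlie) subrK.
  rewrite addrC addKr; apply: memvD; first by apply: HR; rewrite ?memvf.
  by apply: (ideal_r Hlie hR); rewrite ?memvf.
have qq u v w : q u (q v w) = pr (br (sec u) (br (sec v) (sec w))).
  by rewrite -{1}(prsec u) {2}/q -prbr.
exists (subvs_of U), q, pr, sec; split=> //.
split=> [a u v w|a u v w|u|u v w].
- by rewrite /q linearP (brDl Hlie) (brZl Hlie) linearP.
- by rewrite /q linearP (brDr Hlie) (brZr Hlie) linearP.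
- by rewrite /q (brxx Hlie) linear0.
by rewrite !qq -!linearD; case: Hlie => _ _ _ ->; rewrite linear0.
Qed.

(** L / R has no nonzero abelian ideal, expressed through the ideals of L that contain [R]. *)
Definition semisimple_mod (F : fieldType) (V : vectType F) (br : V -> V -> V) R :=
  forall I, ideal_of br fullv I -> (R <= I)%VS -> (brs br I I <= R)%VS -> (I <= R)%VS.

Section RelativeWeyl.
Variables (F : fieldType) (V X : vectType F) (br : V -> V -> V) (R : {vspace V}).
Hypotheses (charF : [pchar F] =i pred0) (Hlie : is_lie_bracket br).
Hypothesis hR : ideal_of br fullv R.

Lemma quotient_semisimple W q pr sec : @quotient_map F V W br q R pr sec ->
  semisimple_mod br R -> semisimple_lie q.
Proof.
move=> Q ss I hI abI.
have s : (pr @^-1: I <= R)%VS.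
  apply: ss; [exact: (quo_ideal_preim Q hI) | exact: (quo_sub_preim Q) |].
  apply/(brs_subP Hlie) => a b; rewrite -!memv_preim (quo_ker Q) (quo_br Q) => aI bI.
  by rewrite abI.
apply/eqP; rewrite -subv0; apply/subvP => w wI.
have : sec w \in R by apply: (subvP s); rewrite -memv_preim (quo_sec Q).
by rewrite (quo_ker Q) (quo_sec Q) memv0.
Qed.

(* Weyl's theorem for the action of L / R on M / K. *)
Lemma weyl_relative (sigma : 'Hom(V, 'End(X))) (K N M : {vspace X}) m0 :
  semisimple_mod br R -> lie_rep br sigma -> (K <= N)%VS -> (N <= M)%VS ->
  (forall x, stable (sigma x) K) -> (forall x, stable (sigma x) N) ->
  (forall x, stable (sigma x) M) ->
  (forall r m, r \in R -> m \in M -> sigma r m \in K) ->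
  m0 \in M -> (forall x, sigma x m0 \in N) ->
  exists m, m - m0 \in N /\ forall x, sigma x m \in K.
Proof.
move=> ss rep sKN sNM sK sN sM RK m0M m0N.
have [W [q [pr [sec Q]]]] := quotient_exists Hlie hR.
have ssW := quotient_semisimple Q ss.
pose pK v := v - projv K v.
have pKl a u v : pK (a *: u + v) = a *: pK u + pK v.
  by rewrite /pK linearP scalerBr opprD addrACA.
have pKB u v : pK (u - v) = pK u - pK v by rewrite /pK linearB /= !opprB addrACA [RHS]addrACA [- _ - _]addrC.
have pK0 v : v \in K -> pK v = 0 by move=> vK; rewrite /pK projv_id // subrr.
have pKK v : pK v = 0 -> v \in K.
  by move/eqP; rewrite subr_eq0 => /eqP ->; exact: memv_proj.
have pKN v : v \in N -> pK v \in N.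
  by move=> vN; rewrite memvB // (subvP sKN) // memv_proj.
have pKM v : v \in M -> pK v \in M.
  by move=> vN; rewrite memvB // (subvP sNM) // (subvP sKN) // memv_proj.
(* The choice of the section is immaterial modulo [K], because [R] sends [M] into [K]. *)
pose f w : 'End(X) := linfun (fun v => pK (sigma (sec w) (projv M v))).
have fE w v : f w v = pK (sigma (sec w) (projv M v)).
  by rewrite /f linfun_apply // => a u z; rewrite linearP /= linearP /= pKl.
pose tau : 'Hom(W, 'End(X)) := linfun f.
have tauE w v : tau w v = pK (sigma (sec w) (projv M v)).
  rewrite /tau linfun_apply ?fE // => a u z; apply/lfunP => t.
  by rewrite add_lfunE scale_lfunE !fE !linearP add_lfunE scale_lfunE pKl.
have trep : lie_rep q tau.
  move=> w w'; apply/lfunP => v; rewrite comm_lfunE !tauE; set u := projv M v.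
  have uM : u \in M := memv_proj M v.
  have red x y : pK (sigma x (projv M (pK (sigma y u)))) = pK (sigma x (sigma y u)).
    rewrite projv_id; last by apply: pKM; apply: sM.
    rewrite {2}/pK linearB pKB /= [X in _ - X]pK0 ?subr0 //; apply: sK; exact: memv_proj.
  rewrite !red -pKB -(repE rep); apply/eqP; rewrite -subr_eq0 -pKB -opp_lfunE -add_lfunE.
  rewrite -linearB; apply/eqP/pK0; apply: RK => //.
  by rewrite (quo_ker Q) linearB /= (quo_br Q) !(quo_sec Q) subrr.
have [||m [mN hm]] := @weyl_invariant F W X q charF (quo_lie Q) ssW _ tau N m0 trep (leqnn _).
- by move=> w n nN; rewrite tauE projv_id ?(subvP sNM) //; apply: pKN; apply: sN.
- by move=> w; rewrite tauE projv_id //; apply: pKN.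
have mM : m \in M by rewrite -[m](subrK m0) memvD // (subvP sNM).
exists m; split=> // x; have := hm (pr x); rewrite tauE projv_id // => /pKK h.
rewrite -[x](subrK (sec (pr x))) linearD add_lfunE memvD // RK //.
exact: (quo_sec_mod Q).
Qed.

End RelativeWeyl.

Section Levi.
Variables (F : fieldType).
Hypothesis (charF : [pchar F] =i pred0).

Lemma end_action (V : vectType F) (br : V -> V -> V) : is_lie_bracket br ->
  exists sigma : 'Hom(V, 'End('End(V))), lie_rep br sigma /\
    forall x f, sigma x f = comm_lfun (ad br x) f.
Proof.
move=> Hlie; have Lc := @comm_lfun_lie F V.
have E x f : (adhom (@comm_lfun F V) \o adhom br)%VF x f = comm_lfun (ad br x) f.
  by rewrite comp_lfunE !adhomE // adE.
exists (adhom (@comm_lfun F V) \o adhom br)%VF; split=> // x y.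
by rewrite !comp_lfunE !adhom_rep.
Qed.

(* L / R acts on the maps from L to R that are scalar on R, modulo K = ad R. If m is an
   invariant with m = id on R, its annihilator C in L supplements R; when C = L, the map m
   is L-equivariant and its kernel is a complement. *)
Lemma levi_abelian (V : vectType F) (br : V -> V -> V) (R : {vspace V}) :
  is_lie_bracket br -> ideal_of br fullv R -> abelian br R -> R != 0%VS ->
  semisimple_mod br R ->
  exists C, [/\ subalg br C, C != fullv & (C + R = fullv)%VS].
Proof.
move=> Hlie hR abR nR ss; have [_ HR] := hR.
have [sigma [rep sigE]] := end_action Hlie.
have sE x f v : sigma x f v = br x (f v) - f (br x v).
  by rewrite sigE comm_lfunE !adE.
have [||N NP] := @vspace_of_pred F 'End(V)
  (fun f => (forall v, f v \in R) /\ forall r, r \in R -> f r = 0).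
- by split=> [v|r _]; rewrite zero_lfunE ?mem0v.
- move=> a f g [f1 f2] [g1 g2]; split=> [v|r rR]; rewrite add_lfunE scale_lfunE ?memvD ?memvZ //.
  by rewrite f2 // g2 // scaler0 addr0.
pose K := (adhom br @: R)%VS; pose f0 : 'End(V) := projv R; pose M := (N + <[f0]>)%VS.
have HRl v r : r \in R -> br v r \in R by apply: HR; apply: memvf.
have sN x : stable (sigma x) N.
  move=> f /NP[f1 f2]; apply/NP; split=> [v|r rR]; rewrite sE.
    by rewrite memvB ?HRl.
  by rewrite !f2 ?HRl // (br0r Hlie) subrr.
have f0N x : sigma x f0 \in N.
  apply/NP; split=> [v|r rR]; rewrite sE; first by rewrite memvB ?HRl ?memv_proj.
  by rewrite !projv_id ?HRl // subrr.
have [||||||||m [mN hm]] := @weyl_relative F V _ br R charF Hlie hR sigma K N M f0 ss rep.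
- apply/subvP => _ /memv_imgP[r rR ->]; rewrite adhomE //; apply/NP.
  split=> [v|r' r'R]; rewrite adE //; last exact: abR.
  by apply: (ideal_r Hlie hR); rewrite ?memvf.
- exact: addvSl.
- move=> x _ /memv_imgP[r rR ->].
  rewrite sigE !adhomE // -ad_br // -adhomE // memv_img //; exact: HRl.
- exact: sN.
- move=> x _ /memv_addP[n nN [_ /vlineP[t ->] ->]].
  rewrite (subvP (addvSl _ _)) // linearD linearZ /=; apply: memvD; [exact: sN | apply: memvZ; exact: f0N].
- move=> r _ rR /memv_addP[n /NP[n1 n2] [_ /vlineP[t ->] ->]].
  (* The map has values in the abelian [R] and is multiplication by [t] on [R], which contains
     [r, v]. *)
  have -> : sigma r (n + t *: f0) = adhom br (- (t *: r)).
    apply/lfunP => v; rewrite adhomE // adE // sE !add_lfunE !scale_lfunE.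
    have br_rv : br r v \in R by apply: (ideal_r Hlie hR); rewrite ?memvf.
    rewrite (abR r) ?memvD ?memvZ ?memv_proj // n2 // projv_id // !add0r.
    by rewrite (brNl Hlie) (brZl Hlie).
  by rewrite memv_img // memvN memvZ.
- by rewrite (subvP (addvSr _ _)) ?memv_line.
- exact: f0N.
have [d1 d2] := (NP _).1 mN.
have mR v : m v \in R.
  by rewrite -[m](subrK f0) add_lfunE memvD // memv_proj.
have mid r : r \in R -> m r = r.
  by move=> rR; rewrite -[m](subrK f0) add_lfunE d2 // add0r projv_id.
have [|a x y /= hx hy|C CP] := @vspace_of_pred F V (fun x => sigma x m = 0).
- by rewrite linear0 zero_lfunE.
- by rewrite linearP add_lfunE scale_lfunE hx hy scaler0 addr0.
have Cs : subalg br C.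
  move=> a b /CP ha /CP hb; apply/CP.
  by rewrite (repE rep) ha hb !linear0 addr0.
have CR : (C + R = fullv)%VS.
  apply/eqP; rewrite eqEsubv subvf; apply/subvP => x _.
  (* As [m] is the identity on [R], [sigma r m] is - ad r; adding [r] to [x] therefore cancels
     [sigma x m] = ad r. *)
  have /memv_imgP[r rR e] := hm x.
  rewrite -[x](addrK r) memv_add ?memvN //; apply/CP; apply/lfunP => v.
  rewrite linearD add_lfunE e add_lfunE adhomE // adE // sE zero_lfunE.
  rewrite (abR r (m v) rR (mR v)) add0r mid ?subrr //.
  by apply: (ideal_r Hlie hR); rewrite ?memvf.
have [eC|nC] := eqVneq C fullv; last by exists C.
have mhom x v : m (br x v) = br x (m v).
  apply/eqP; rewrite eq_sym -subr_eq0 -sE; have /CP -> : x \in C by rewrite eC memvf.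
  by rewrite zero_lfunE.
exists (lker m); split.
- by move=> a b; rewrite !memv_ker => _ /eqP hb; rewrite mhom hb (br0r Hlie).
- apply: contra_neq nR => e; apply/eqP; rewrite -subv0; apply/subvP => r rR.
  have : r \in lker m by rewrite e memvf.
  by rewrite memv_ker mid // memv0.
apply/eqP; rewrite eqEsubv subvf; apply/subvP => x _.
rewrite -[x](subrK (m x)); apply: memv_add; last exact: mR.
by rewrite memv_ker linearB /= (mid (m x)) // subrr.
Qed.

(** Passing to L / [R, R] makes the image of [R] abelian and nonzero, and supplements pull back. A
    proper supplement is enough: trivial intersection with the radical comes later from
    elementarity. *)
Lemma levi (V : vectType F) (br : V -> V -> V) (R : {vspace V}) n :
  is_lie_bracket br -> ideal_of br fullv R -> dser br n R = 0%VS -> R != 0%VS ->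
  semisimple_mod br R ->
  exists C, [/\ subalg br C, C != fullv & (C + R = fullv)%VS].
Proof.
move=> Hlie hR sol nR ss; set R2 := brs br R R.
have hR2 : ideal_of br fullv R2 by apply: ideal_brs.
have sR2 : (R2 <= R)%VS by apply: brs_sub => //; apply: ideal_subalg hR.
have nR2 : R2 != R.
  apply: contra_neq nR => e; rewrite -sol; elim: (n) => //= k <-; exact/esym.
have [W [q [pr [sec Q]]]] := quotient_exists Hlie hR2.
have [||||C [Cs nC CR]] := @levi_abelian W q (pr @: R)%VS (quo_lie Q).
- exact: (quo_ideal_img Q hR).
- move=> _ _ /memv_imgP[a aR ->] /memv_imgP[b bR ->].
  by apply/eqP; rewrite -(quo_br Q) -(quo_ker Q) mem_brs.
- apply: contra_neq nR2 => e; apply/eqP; rewrite eqEsubv sR2; apply/subvP => r rR.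
  by rewrite (quo_ker Q) -memv0 -e memv_img.
- move=> I hI sRI sI.
  have s : (pr @^-1: I <= R)%VS.
    apply: ss; first exact: (quo_ideal_preim Q hI).
      by apply/subvP => r rR; rewrite -memv_preim (subvP sRI) // memv_img.
    apply/(brs_subP Hlie) => a b; rewrite -!memv_preim => aI bI.
    have : q (pr a) (pr b) \in (pr @: R)%VS.
      by apply: (subvP sI); apply: (mem_brs (quo_lie Q)).
    rewrite -(quo_br Q) => /memv_imgP[r rR e].
    rewrite -[br a b](subrK r) memvD // (subvP sR2) //.
    by rewrite (quo_ker Q) linearB /= e subrr.
  apply/subvP => w wI; rewrite -(quo_sec Q w) memv_img // (subvP s) //.
  by rewrite -memv_preim (quo_sec Q).
exists (pr @^-1: C)%VS; split; first exact: (quo_subalg_preim Q Cs).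
  by apply: contra_neq nC; apply: (quo_preim_full Q).
by rewrite addvC (quo_preim_add (I := R)) // addvC.
Qed.

End Levi.

(** * Minimal non-elementary algebras are solvable *)

Lemma cocycle_cancel (M : zmodType) (a b x y z u : M) :
  a + x - (b + y) - (a - z + (u - b)) = x - u - (y - z).
Proof.
have -> : a + x - (b + y) = (a - b) + (x - y) by rewrite opprD addrACA.
have -> : a - z + (u - b) = (a - b) + (u - z).
  by rewrite [u - b]addrC addrACA [- z + u]addrC.
by rewrite opprD addrACA subrr add0r !opprB addrACA [RHS]addrACA [- y - u]addrC.
Qed.

Section NonSolvable.
Variables (F : fieldType) (V : vectType F) (br : V -> V -> V).
Hypothesis Hlie : is_lie_bracket br.
Hypothesis charF : [pchar F] =i pred0.
Local Notation L := (fullv : {vspace V}).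
Implicit Types (A B C R : {vspace V}).

Lemma radical_exists : exists R, [/\ ideal_of br L R, exists n, dser br n R = 0%VS &
  semisimple_mod br R].
Proof.
have [|R [hR [n sR]] maxR] := @dim_max F V
  (fun R => ideal_of br L R /\ exists n, dser br n R = 0%VS) 0%VS.
  by split; [exact: ideal0 | exists 0%N].
exists R; split=> //; first by exists n.
move=> I hI sRI sI; suff /eqP <- : R == I by [].
rewrite eqEdim sRI maxR //; split=> //; exists (n + 1)%N.
rewrite -dserD; apply/eqP; rewrite -subv0 -sR; exact: dserS.
Qed.

(** In the semisimple L / R the image of [P] has an ideal complement, whose preimage supplements
    [P]. This preimage must be L, so the image of [P] is zero. *)
Lemma witness_in_radical P R : min_nonelem_witness br P -> ideal_of br L R ->
  semisimple_mod br R -> (P <= R)%VS.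
Proof.
move=> wP hR ss; have [hP mP nP] := wP.
have [W [q [pr [sec Q]]]] := quotient_exists Hlie hR.
have ssW := quotient_semisimple Hlie Q ss.
have hI := quo_ideal_img Q hP.
have [J [hJ IJ IJ0 _]] := killing_complement charF (quo_lie Q) ssW hI.
have Js := ideal_subalg (quo_ideal_preim Q hJ).
have := witness_supp wP hP (subvv _) Js (quo_preim_add IJ) => /(quo_preim_full Q) JL.
apply/subvP => x xP; rewrite (quo_ker Q) -memv0 -IJ0 memv_cap JL memvf andbT.
exact: memv_img.
Qed.

(* f0, the projection onto A along B + C, is a cocycle on R. Weyl's theorem for the action
   of L / R = C on the maps that are scalar on A and cocycles on R makes it equivariant. *)
Lemma equivariant_cocycle A B C R : ideal_of br L R -> semisimple_mod br R ->
  subalg br C -> (C + R = L)%VS -> (C :&: R = 0)%VS ->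
  ideal_of br L A -> abelian br A -> subalg br B -> (A + B = R)%VS -> (A :&: B = 0)%VS ->
  exists m : 'End(V), [/\ forall v, m v \in A, forall a, a \in A -> m a = a,
    forall r s, r \in R -> s \in R -> m (br r s) = br r (m s) - br s (m r) &
    forall c v, c \in C -> m (br c v) = br c (m v)].
Proof.
move=> hR ss Cs CR CR0 hA abA Bs AB AB0; have [_ HR] := hR; have [_ HA] := hA.
have HRl v r : r \in R -> br v r \in R by apply: HR; apply: memvf.
have HAl v a : a \in A -> br v a \in A by apply: HA; apply: memvf.
have sAR : (A <= R)%VS by rewrite -AB addvSl.
have sBR : (B <= R)%VS by rewrite -AB addvSr.
(* The projection onto [C] along [R] is a Lie homomorphism. Acting through it makes [R] act by zero,
   as [weyl_relative] with [K = 0] requires. *)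
pose ga := daddv_pi C R.
have gaC c : c \in C -> ga c = c by apply: daddv_pi_id.
have gaR r : r \in R -> ga r = 0.
  move=> rR; have := @daddv_pi_add _ _ C R r CR0; rewrite CR memvf => /(_ isT).
  rewrite (@daddv_pi_id _ _ R C r) // 1?capvC // => /eqP.
  by rewrite -subr_eq0 addrK => /eqP.
have gain v : ga v \in C by apply: memv_pi.
have gabr x y : ga (br x y) = br (ga x) (ga y).
  have : x \in (C + R)%VS by rewrite CR memvf.
  have : y \in (C + R)%VS by rewrite CR memvf.
  case/memv_addP=> c' c'C [r' r'R ->] /memv_addP[c cC [r rR ->]].
  rewrite (brDl Hlie) !(brDr Hlie) !linearD /= (gaC (br c c')) ?Cs // (gaR (br c r')) ?HRl //.
  rewrite (gaR (br r r')) ?HRl // (gaR (br r c')); last first.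
    by apply: (ideal_r Hlie hR); rewrite ?memvf.
  by rewrite (gaC c) // (gaC c') // (gaR r) // (gaR r') // !addr0.
have [act [arep actE]] := end_action Hlie.
pose sigma := (act \o ga)%VF.
have rep : lie_rep br sigma by move=> x y; rewrite !comp_lfunE gabr arep.
have sE x f v : sigma x f v = br (ga x) (f v) - f (br (ga x) v).
  by rewrite comp_lfunE actE comm_lfunE !adE.
(* The cocycle identity is what will make the kernel in [R] a subalgebra; being linear, it cuts out
   a subspace. *)
have [||N NP] := @vspace_of_pred F 'End(V)
  (fun f => [/\ forall v, f v \in A, forall a, a \in A -> f a = 0 &
     forall r s, r \in R -> s \in R -> f (br r s) = br r (f s) - br s (f r)]).
- by split=> [v|a _|r s _ _]; rewrite !zero_lfunE ?mem0v ?(br0r Hlie) ?subrr.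
- move=> a f g [f1 f2 f3] [g1 g2 g3]; split=> [v|b bA|r s rR sR].
  + by rewrite add_lfunE scale_lfunE memvD ?memvZ.
  + by rewrite add_lfunE scale_lfunE f2 // g2 // scaler0 addr0.
  rewrite !add_lfunE !scale_lfunE f3 // g3 // !(brDr Hlie) !(brZr Hlie).
  by rewrite scalerBr opprD addrACA.
pose f0 := daddv_pi A (B + C).
have ABC : (A :&: (B + C) = 0)%VS.
  apply/eqP; rewrite -subv0; apply/subvP => a; rewrite memv_cap => /andP[aA].
  case/memv_addP=> b bB [c cC e].
  have c0 : c = 0.
    apply/eqP; rewrite -memv0 -CR0 memv_cap cC -[c](addKr b) -e addrC.
    by apply: memvB; [exact: (subvP sAR) | exact: (subvP sBR)].
  by rewrite -AB0 memv_cap aA e c0 addr0.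
have f0A a : a \in A -> f0 a = a by apply: daddv_pi_id.
have f0in v : f0 v \in A by apply: memv_pi.
have f0B b : b \in B -> f0 b = 0.
  move=> bB; have b' : b \in (B + C)%VS by rewrite (subvP (addvSl _ _)).
  have := @daddv_pi_add _ _ A (B + C)%VS b ABC; rewrite (subvP (addvSr _ _)) // => /(_ isT).
  rewrite (@daddv_pi_id _ _ (B + C)%VS A b) // 1?capvC // => /eqP.
  by rewrite -subr_eq0 addrK => /eqP.
have f0c r s : r \in R -> s \in R -> f0 (br r s) = br r (f0 s) - br s (f0 r).
  rewrite -AB => /memv_addP[a aA [b bB ->]] /memv_addP[a' a'A [b' b'B ->]].
  rewrite !linearD /= (f0A a) // (f0A a') // (f0B b) // (f0B b') // !addr0 !(brDl Hlie) !(brDr Hlie).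
  rewrite (abA a a') // (abA a' a) // !add0r !linearD /= (f0A (br b a')) ?HAl //.
  rewrite (f0B (br b b')) ?Bs // addr0 (brC Hlie a b') linearN /= f0A ?HAl //.
  by rewrite addrC.
have sNc x (f : 'End(V)) : (forall v, f v \in A) ->
    (forall r s, r \in R -> s \in R -> f (br r s) = br r (f s) - br s (f r)) ->
    (forall v, sigma x f v \in A) /\
    (forall r s, r \in R -> s \in R ->
      sigma x f (br r s) = br r (sigma x f s) - br s (sigma x f r)).
  move=> f1 f3; split=> [v|r s rR sR]; first by rewrite sE memvB ?HAl.
  rewrite !sE; set c := ga x.
  rewrite (f3 r s rR sR) (brJ Hlie c r s) linearD /= (f3 (br c r) s) ?HRl // (f3 r (br c s)) ?HRl //.
  rewrite !(brBr Hlie) (brJ Hlie c r) (brJ Hlie c s).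
  exact: cocycle_cancel.
have sN x : stable (sigma x) N.
  move=> f /NP[f1 f2 f3]; have [g1 g3] := sNc x f f1 f3; apply/NP; split=> // a aA.
  by rewrite sE !f2 ?HAl // (br0r Hlie) subrr.
have f0N x : sigma x f0 \in N.
  have [g1 g3] := sNc x f0 f0in f0c; apply/NP; split=> // a aA.
  by rewrite sE !f0A ?HAl // subrr.
have [||||||||m [mN hm]] :=
  @weyl_relative F V _ br R charF Hlie hR sigma 0%VS N fullv f0 ss rep.
- exact: sub0v.
- exact: subvf.
- by move=> x v; rewrite !memv0 => /eqP->; rewrite linear0.
- exact: sN.
- by move=> x v _; exact: memvf.
- move=> r f rR _; rewrite memv0; apply/eqP/lfunP => v.
  by rewrite sE gaR // !(br0l Hlie) linear0 subrr zero_lfunE.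
- exact: memvf.
- exact: f0N.
have [n1 n2 n3] := (NP _).1 mN.
have mE v : m v = (m - f0) v + f0 v by rewrite -add_lfunE subrK.
exists m; split=> [v|a aA|r s rR sR|c v cC].
- by rewrite mE memvD.
- by rewrite mE n2 // add0r f0A.
- rewrite !mE n3 // f0c // !(brDr Hlie) opprD addrACA //.
have := hm c; rewrite memv0 => /eqP /(congr1 (fun f : 'End(V) => f v)).
by rewrite zero_lfunE sE gaC // => /eqP; rewrite subr_eq0 => /eqP.
Qed.

Lemma minimal_nonelem_is_solvable : minimal_non_elementary br -> exists n, dser br n L = 0%VS.
Proof.
move=> mne; apply: NNPP => nsol.
have [R [hR [n sR] ss]] := radical_exists.
have [P wP] := min_nonelem_ideal mne; have [hP mP nP] := wP.
have sPR := witness_in_radical wP hR ss.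
have nR : R != 0%VS by apply: contra_neq nP => e; apply/eqP; rewrite -subv0 -e.
have nRL : R != L by apply/eqP => e; apply: nsol; exists n; rewrite -e.
have Rs := ideal_subalg hR; have eR := min_nonelem_proper mne Rs nRL.
have sP : dser br n P = 0%VS by apply/eqP; rewrite -subv0 -sR; apply: dserS.
have [k [nA abA]] := dser_last Hlie nP sP; set A := dser br k P in nA abA.
have hA : ideal_of br L A by apply: dser_ideal.
have sAP : (A <= P)%VS by apply: (@dser_le _ _ _ Hlie 0 k) => //; apply: ideal_subalg hP.
have sAR := subv_trans sAP sPR.
have [B [Bs AB AB0]] := elementary_split Hlie eR Rs (ideal_sub hA sAR (subvf _)) abA.
have [C0 [C0s nC0 C0R]] := levi charF Hlie hR sR nR ss.
have [C [Cs CR] minC] := @dim_min F V (fun C => subalg br C /\ (C + R = L)%VS) C0 (conj C0s C0R).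
have nC : C != L.
  apply: contra_neq nC0 => e; apply/eqP; rewrite eqEdim subvf -e; exact: minC.
have eC := min_nonelem_proper mne Cs nC.
(* A maximal subalgebra of [C] that does not contain [C :&: R] would still supplement [R], against
   the minimality of [C]. So this ideal lies in all of them and vanishes, [C] being elementary. *)
have CR0 : (C :&: R = 0)%VS.
  rewrite capvC; have hRC := ideal_cap hR Cs (subvf _).
  apply: (elementaryP Hlie eC Cs (subvv _)) => // M [Ms pM mM].
  have sMC : (M <= C)%VS by case/andP: pM.
  have [<-|e] := mM _ (subalg_ideal_add Hlie hRC Ms sMC) (addvSr _ _)
    (ltac:(by rewrite subv_add capvSr)); first exact: addvSl.
  have : (\dim C <= \dim M)%N; last by rewrite leqNgt vproper_dim.
  apply: minC; split=> //; apply/eqP; rewrite eqEsubv subvf -CR subv_add addvSr andbT -{1}e.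
  by rewrite subv_add addvSl (subv_trans (capvSl _ _)) ?addvSr.
have [m [mA mid mc mC]] := equivariant_cocycle hR ss Cs CR CR0 hA abA Bs AB AB0.
pose B1 := (R :&: lker m)%VS.
have HR v r : r \in R -> br v r \in R by case: hR => _ H; apply: H; rewrite memvf.
have B1P b : b \in B1 -> b \in R /\ m b = 0.
  by rewrite memv_cap memv_ker => /andP[bR /eqP].
have PB1 b : b \in R -> m b = 0 -> b \in B1.
  by move=> bR mb; rewrite memv_cap bR memv_ker mb eqxx.
have CB1 c b : c \in C -> b \in B1 -> br c b \in B1.
  by move=> cC /B1P[bR mb]; apply: PB1; rewrite ?HR // mC // mb (br0r Hlie).
have Ds : subalg br (B1 + C)%VS.
  move=> _ _ /memv_addP[b bB [c cC ->]] /memv_addP[b' bB' [c' cC' ->]].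
  rewrite (brDl Hlie) !(brDr Hlie) addrA; apply: memv_add; last exact: Cs.
  rewrite memvD ?CB1 // memvD //; last by rewrite (brC Hlie) memvN CB1.
  have [[bR mb] [bR' mb']] := (B1P _ bB, B1P _ bB').
  by apply: PB1; rewrite ?HR // mc // mb mb' !(br0r Hlie) subrr.
have := witness_supp wP hA sAP Ds.
have -> : (A + (B1 + C) = L)%VS.
  rewrite addvA; have -> : (A + B1 = R)%VS; last by rewrite addvC.
  apply/eqP; rewrite eqEsubv subv_add sAR capvSl; apply/subvP => r rR.
  rewrite -[r](subrK (m r)) addrC memv_add //; apply: PB1.
    by apply: memvB => //; apply: (subvP sAR).
  by rewrite linearB /= (mid _ (mA r)) subrr.
move=> /(_ erefl) eL; case/eqP: nA; apply/eqP; rewrite -subv0; apply/subvP => a aA.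
have : a \in (B1 + C)%VS by rewrite eL memvf.
case/memv_addP=> b /B1P[bR mb] [c cC ea]; rewrite memv0 -(mid a aA).
have c0 : c = 0.
  apply/eqP; rewrite -memv0 -CR0 memv_cap cC -[c](addKr b) -ea addrC.
  by apply: memvB => //; apply: (subvP sAR).
by rewrite ea c0 addr0 mb.
Qed.

End NonSolvable.

Theorem theorem4p5 (F : fieldType) (V : vectType F) (br : V -> V -> V)
    (Hlie : is_lie_bracket br) (Hchar : [pchar F] =i pred0) :
  minimal_non_elementary br <->
  ((exists x : V,
      (derived br + <[x]> = fullv)%VS /\ (derived br :&: <[x]> = 0)%VS /\
      abelian br (derived br) /\
      exists A : {vspace V},
        [/\ is_frattini br fullv A, is_asoc br A, A != 0%VS,
            vproper A (derived br) &
            forall I, ideal_of br fullv I -> vproper I (derived br) -> (I <= A)%VS])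
   \/
   (exists x y z : V,
      [/\ basis_of fullv [:: x; y; z], br x y = z, br x z = 0 & br y z = 0])).
Proof.
split=> [mne|[[x ci]|[x [y [z [bL xy xz yz]]]]]].
- by apply: minimal_nonelem_solvable => //; apply: minimal_nonelem_is_solvable.
- exact: (case_i_minimal_nonelem Hlie (x := x)).
exact: (heisenberg_minimal_nonelem Hlie bL xy xz yz).
Qed.
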